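(* Let $d\ge 3$, $H\in(0,1)$, $T>0$, $\mathbb{T}=[0,T]$, and let $(A_\ell,\ell\in\mathbb{N}_0)$, $A_\ell\ge0$, satisfy for some $\eta>0$ $$\sum_{\ell=0}^{\infty}A_\ell\,\ell^{d-2+\eta}<\infty .$$ Let $$B_Q^H(t,x)=\sum_{\ell=0}^\infty\sum_{m=1}^{h(\ell,d)}\sqrt{A_\ell}\,\beta^H_{\ell,m}(t)\,S^{(d-1)}_{\ell,m}(x),\qquad t\in\mathbb{T},\ x\in\mathbb{S}^{d-1}.$$ Then $B_Q^H$ has a continuous modification which is in $C^{H^-,(\eta/2)^-}(\mathbb{T}\times\mathbb{S}^{d-1})$.
   Context: $\mathbb{S}^{d-1}$ is the unit sphere in $\mathbb{R}^d$ with geodesic distance $d_{\mathbb{S}^{d-1}}(x,y)=\arccos\langle x,y\rangle$. $(S^{(d-1)}_{\ell,m},\ \ell\in\mathbb{N}_0,\ m=1,\dots,h(\ell,d))$ are the real-valued spherical harmonics on $\mathbb{S}^{d-1}$, an orthonormal basis of $L^2(\mathbb{S}^{d-1})$, where $h(\ell,d)=(2\ell+d-2)(\ell+d-3)!/((d-2)!\,\ell!)$. $(\beta^H_{\ell,m})$ are independent real-valued fractional Brownian motions with Hurst parameter $H$ (continuous centered Gaussian processes with covariance $\frac12(t^{2H}+s^{2H}-|t-s|^{2H})$). $B_Q^H$ is the isotropic $Q$-fractional Brownian motion on $\mathbb{S}^{d-1}$ with covariance operator $QS^{(d-1)}_{\ell,m}=A_\ell S^{(d-1)}_{\ell,m}$.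 For $\gamma>0$, ''$\in C^{\gamma^-}$'' means $\in C^{\gamma'}$ for every $\gamma'\in(0,\gamma)$ (standard extension of Hölder spaces to orders greater than 1). $C^{\alpha,\beta}(\mathbb{T}\times\mathbb{S}^{d-1})$ is the set of $f\in C^{\min\{\alpha,\beta\}}(\mathbb{T}\times\mathbb{S}^{d-1})$ (metric $|t-s|+d_{\mathbb{S}^{d-1}}(x,y)$) with $f(\cdot,x)\in C^\alpha(\mathbb{T})$ for all $x$ and $f(t,\cdot)\in C^\beta(\mathbb{S}^{d-1})$ for all $t$; $\min\{\alpha^-,\beta^-\}$ is read as $\min\{\alpha,\beta\}^-$. *)

(* Defs.v *)
From HB Require Import structures.
From mathcomp Require Import all_boot all_order all_algebra.
From mathcomp Require Import all_classical all_reals all_analysis.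
Set Implicit Arguments. Unset Strict Implicit. Unset Printing Implicit Defensive.
Import Order.TTheory GRing.Theory Num.Theory.
Import numFieldNormedType.Exports.
Local Open Scope classical_set_scope.
Local Open Scope ring_scope.

Section Defs.
Variable R : realType.

Definition dotp (d : nat) (x y : 'rV[R]_d) : R := \sum_(i < d) x ord0 i * y ord0 i.
Definition eucl (d : nat) (x : 'rV[R]_d) : R := Num.sqrt (dotp x x).
Definition sphere (d : nat) : set 'rV[R]_d := [set x | dotp x x = 1].
Definition geod (d : nat) (x y : 'rV[R]_d) : R := acos (dotp x y).
Definition evec (d : nat) (i : 'I_d) : 'rV[R]_d := delta_mx ord0 i.

(** ** Lebesgue integral on R^d (iterated one-dimensional Lebesgue integrals)
   and surface measure on the sphere (cone construction:
   sigma(A) = d * Leb{ r x : 0 < r <= 1, x in A }). *)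
Fixpoint iint (n : nat) (F : (nat -> R) -> R) : R :=
  match n with
  | 0 => F (fun _ => 0)
  | n'.+1 => Rintegral (@lebesgue_measure R) setT
      (fun t => iint n' (fun g => F (fun i => if i == n' then t else g i)))
  end.
Definition leb_int (d : nat) (f : 'rV[R]_d -> R) : R :=
  iint d (fun g => f (\row_(i < d) g (i : nat))).
Definition sphere_int (d : nat) (g : 'rV[R]_d -> R) : R :=
  d%:R * leb_int (fun x : 'rV[R]_d =>
    if (x != 0) && (eucl x <= 1) then g ((eucl x)^-1 *: x) else 0).

Definition hpoly (d l : nat) (c : {ffun 'I_d -> 'I_l.+1} -> R) (x : 'rV[R]_d) : R :=
  \sum_(a : {ffun 'I_d -> 'I_l.+1} | (\sum_(i < d) (a i : nat) == l)%N)
     c a * \prod_(i < d) x ord0 i ^+ a i.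
Definition harmonic (d : nat) (p : 'rV[R]_d -> R) : Prop :=
  forall x, \sum_(i < d) derive (fun y => derive p y (evec i)) x (evec i) = 0.
Definition spherical_harmonic (d l : nat) (f : 'rV[R]_d -> R) : Prop :=
  exists c : {ffun 'I_d -> 'I_l.+1} -> R,
    harmonic (hpoly c) /\ forall x, sphere x -> f x = hpoly c x.

Definition hdim (l d : nat) : nat :=
  (((2 * l + d - 2) * (l + d - 3)`!) %/ ((d - 2)`! * l`!))%N.

Definition sph_harm_basis (d : nat) (S : nat -> nat -> 'rV[R]_d -> R) : Prop :=
  (forall l m, (1 <= m <= hdim l d)%N -> spherical_harmonic l (S l m)) /\
  (forall l m l' m', (1 <= m <= hdim l d)%N -> (1 <= m' <= hdim l' d)%N ->
     sphere_int (fun x => S l m x * S l' m' x) = ((l == l') && (m == m'))%:R).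

Definition holder_le1 (U : Type) (D : set U) (dist : U -> U -> R) (g : R)
  (f : U -> R) : Prop :=
  exists C : R, forall p q, D p -> D q ->
    `|f p| <= C /\ `|f p - f q| <= C * powR (dist p q) g.

Definition iter_partial (d : nat) (s : seq 'I_d) (f : 'rV[R]_d -> R) : 'rV[R]_d -> R :=
  foldr (fun i F => fun x => derive F x (evec i)) f s.

(** C^b(S^{d-1}) for b > 0, b = k + theta with k in N, theta in (0,1]:
    the 0-homogeneous extension f(x/|x|) is C^k on the open shell
    1/2 < |x| < 2, and its partial derivatives of order <= k are bounded on
    the sphere, those of order k being theta-Hoelder w.r.t. the geodesic
    distance. *)
Definition holder_sphere (d : nat) (b : R) (f : 'rV[R]_d -> R) : Prop :=
  let fh := fun x : 'rV[R]_d => f ((eucl x)^-1 *: x) in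
  let U := [set x : 'rV[R]_d | 2^-1 < eucl x < 2] in
  exists k : nat, k%:R < b <= k%:R + 1 /\
   (forall s : seq 'I_d, (size s <= k)%N -> forall x, U x ->
      {for x, continuous (iter_partial s fh)} /\
      ((size s < k)%N -> forall i, derivable (iter_partial s fh) x (evec i))) /\
   exists C : R, forall s : seq 'I_d, (size s <= k)%N ->
     forall x y, sphere x -> sphere y ->
       `|iter_partial s fh x| <= C /\
       ((size s = k)%N -> `|iter_partial s fh x - iter_partial s fh y|
                          <= C * powR (geod x y) (b - k%:R)).

Definition holder_TS (d : nat) (T a b : R) (f : R -> 'rV[R]_d -> R) : Prop :=
  holder_le1 ([set t | 0 <= t <= T] `*` @sphere d)
    (fun p q => `|p.1 - q.1| + geod p.2 q.2) (Num.min a b) (fun p => f p.1 p.2) /\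
  (forall x, sphere x ->
     holder_le1 [set t | 0 <= t <= T] (fun t s => `|t - s|) a (fun t => f t x)) /\
  (forall t, 0 <= t <= T -> holder_sphere b (f t)).

Definition holder_TS_minus (d : nat) (T a b : R) (f : R -> 'rV[R]_d -> R) : Prop :=
  forall a' b', 0 < a' < a -> 0 < b' < b -> holder_TS T a' b' f.

Definition fbm_cov (H t s : R) : R :=
  2^-1 * (powR t (2 * H) + powR s (2 * H) - powR `|t - s| (2 * H)).

Local Open Scope ereal_scope.

(** X is a continuous real fractional Brownian motion with Hurst index H on
    [0,T]: continuous paths, and it is a centered Gaussian process with
    covariance fbm_cov H (every finite linear combination is centered
    Gaussian with the corresponding variance; Gaussianity expressed through
    the characteristic function, which covers degenerate variances). *)
Definition is_fBm (dT : measure_display) (Om : measurableType dT)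
  (P : probability Om R) (T H : R) (X : R -> Om -> R) : Prop :=
  (forall w, {within [set t | (0 <= t <= T)%R], continuous (fun t => X t w)}) /\
  (forall t, (0 <= t <= T)%R -> measurable_fun setT (X t)) /\
  (forall (ts : seq (R * R)), all (fun p => (0 <= p.1 <= T)%R) ts ->
     let Y := fun w => (\sum_(p <- ts) p.2 * X p.1 w)%R in
     let V := (\sum_(p <- ts) \sum_(q <- ts) p.2 * q.2 * fbm_cov H p.1 q.1)%R in
     forall u : R,
       'E_P[fun w => cos (u * Y w)] = (expR (- (u ^+ 2 * V) / 2))%:E /\
       'E_P[fun w => sin (u * Y w)] = 0).

Definition proc_events (dT : measure_display) (Om : measurableType dT) (T : R)
  (X : R -> Om -> R) : set (set Om) :=
  <<s [set A | exists t B, (0 <= t <= T)%R /\ measurable B /\ A = X t @^-1` B] >>.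

Definition indep_procs (I : eqType) (dT : measure_display) (Om : measurableType dT)
  (P : probability Om R) (T : R) (J : set I) (X : I -> R -> Om -> R) : Prop :=
  forall (s : seq I) (A : I -> set Om), uniq s -> {subset s <= J} ->
    (forall k, k \in s -> proc_events T (X k) (A k)) ->
    P (\bigcap_(k in [set k | k \in s]) A k) = \prod_(k <- s) P (A k).

End Defs.

(* Main.v *)
(** For a fixed degree [l], the sum over [m] of the squares of any [k]-fold
    derivatives of the spherical harmonics is bounded on the sphere by
    [C (l+1)^(d-2+2k)]: derivatives of 0-homogeneous functions are combinations
    of the rotation fields [x_j d_i - x_i d_j]; these act antisymmetrically on the
    harmonics of degree [l], the sum of their squares is the scalar
    [-l(l+d-2)], and [\sum_m S_lm^2] is constant on the sphere.  Hence, over the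
    dyadic block of degrees [2^j <= l+1 < 2^(j+1)], each derivative of order
    [k] of the random field is at a fixed point Gaussian with increments of
    variance [C 2^(j (2k - eta)) |t-t'|^(2H)].  High moments, finite nets of
    coefficient vectors and dyadic chaining in time turn this into almost sure
    bounds [M 2^(j (k - eta/2 + eps)) |t-t'|^a], uniform in [x], for every [a < H]
    and [eps > 0].  Summing the blocks, and interpolating between consecutive orders
    of differentiation, gives the Hölder classes; on the exceptional null set
    the field is replaced by 0. *)
Require Import Defs.
From HB Require Import structures.
From mathcomp Require Import all_boot all_order all_algebra.
From mathcomp Require Import all_classical all_reals all_analysis.
From mathcomp Require Import ring lra zify.
From mathcomp Require Import measurable_realfun.
From mathcomp Require mpoly.
Import -(notations) mpoly.
Import Order.TTheory GRing.Theory Num.Theory.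
Import numFieldNormedType.Exports.
Local Open Scope classical_set_scope.
Local Open Scope ring_scope.

Set Implicit Arguments.
Unset Strict Implicit.
Unset Printing Implicit Defensive.

(** * Integrals over [R^d] and rotation invariance *)

(** Orthonormality of the harmonics is given only through iterated one-dimensional integrals, and
    completeness is not assumed. Rotation invariance is therefore derived from Fubini and
    translation invariance alone: a plane rotation is a product of three shears. It yields
    integration by parts for the rotation fields. A dimension count ([hdim l d] is the number of
    monomials of degree [l] with last exponent at most 1) shows that the given harmonics of degree
    [l] span all of that degree, so the rotation fields become matrices in the given basis. Of the
    Brownian motions only characteristic functions are known; even moments are recovered from
    iterated second differences of these functions at the origin. The constants so obtained are not
    sharp, which is harmless: only the power of the variance counts. The number of net vectors grows
    exponentially in the block index; a large but fixed moment order beats this growth at the price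
    of the factor [2^(eps j)]. The exponents run along sequences, so that one null set serves all
    Hölder orders. *)

Section Cylinder.
Variable R : realType.
Implicit Types (F G : (nat -> R) -> R) (g : nat -> R) (i j k m n d : nat).

Definition cylinders : set (set (nat -> R)) :=
  [set A | exists i B, measurable B /\ A = (fun g : nat -> R => g i) @^-1` B].
Notation M := (g_sigma_algebraType cylinders).
Local Notation leb := (@lebesgue_measure R).

Definition upd i (t : R) g : nat -> R := fun k => if k == i then t else g k.

Lemma upd_same i t g : upd i t g i = t. Proof. by rewrite /upd eqxx. Qed.

Lemma upd_neq i t g k : k != i -> upd i t g k = g k.
Proof. by rewrite /upd => /negbTE ->. Qed.

Lemma upd_comm i j s t g : i != j -> upd i s (upd j t g) = upd j t (upd i s g).
Proof.
move=> ij; apply/funext => k; rewrite /upd.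
by have [->|//] := eqVneq k i; rewrite (negbTE ij).
Qed.

Lemma measurable_coord i : measurable_fun setT (fun g : M => g i).
Proof.
move=> _ B mB; rewrite setTI; apply: sub_gen_smallest.
by exists i, B.
Qed.

Lemma measurable_to_cyl (dT : measure_display) (T : measurableType dT) (f : T -> M) :
  (forall i, measurable_fun setT (fun x => f x i)) -> measurable_fun setT f.
Proof.
move=> mf; apply: (@measurability _ _ T M setT f cylinders) => //.
move=> _ [_ [i [B [mB ->]] <-]].
exact: (mf i measurableT B mB).
Qed.

Lemma measurable_upd i : measurable_fun setT (fun p : M * R => upd i p.2 p.1 : M).
Proof.
apply: measurable_to_cyl => k; rewrite /upd; case: eqP => _.
  exact: measurable_snd.
exact: (measurableT_comp (@measurable_coord k) measurable_fst).
Qed.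

Definition coord_int i F : (nat -> R) -> R :=
  fun g => Rintegral leb setT (fun t => F (upd i t g)).

Fixpoint coord_ints n F : (nat -> R) -> R :=
  if n is n'.+1 then coord_int n' (coord_ints n' F) else F.

(** Relates two forms of nesting: [iint] substitutes outer variables into the integrand, whereas
    [coord_ints] composes operators on functions of all coordinates. *)
Lemma coord_ints_upd n k t F g : (n <= k)%N ->
  coord_ints n (fun g' => F (upd k t g')) g = coord_ints n F (upd k t g).
Proof.
elim: n g => [//|n IH] g nk /=; rewrite /coord_int.
congr (Rintegral _ _ _); apply/funext => s.
rewrite IH ?(ltnW nk)// upd_comm//.
by rewrite neq_ltn nk orbT.
Qed.

Lemma iint_coord_ints n F : iint n F = coord_ints n F (fun=> 0).
Proof.
elim: n F => [//|n IH] F /=; rewrite /coord_int.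
congr (Rintegral _ _ _); apply/funext => t.
by rewrite IH -[RHS]coord_ints_upd.
Qed.

(** The support is controlled only in the coordinates [m <= i < d]: the first [m] have been
    integrated out, those from [d] on are never integrated. On this class all integrals converge
    absolutely, so linearity and Fubini hold for [Rintegral]. *)
Definition bounded_supp m d F := measurable_fun [set: M] F /\
  exists C K : R, [/\ 0 <= C, 0 <= K, (forall g, `|F g| <= C) &
   forall g, F g != 0 -> forall i, (m <= i < d)%N -> `|g i| <= K].

Lemma indic_box (K t : R) : `|t| <= K -> \1_`[- K, K] t = 1 :> R.
Proof. by rewrite ler_norml => tK; rewrite indicE mem_set//= in_itv. Qed.

Lemma indic_box_ge0 (K t : R) : 0 <= \1_`[- K, K] t :> R.
Proof. by rewrite indicE. Qed.

Lemma integrable_box (C K : R) : leb.-integrable setT (EFin \o (fun t => C * \1_`[- K, K] t)).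
Proof.
rewrite (_ : _ \o _ = (fun t => C%:E * (EFin \o (\1_`[- K, K] : R -> R)%R) t)%E) //.
by apply: integrableZl => //; exact: integrable_indic_itv.
Qed.

Lemma bounded_supp_fiber m d F i g : bounded_supp m d F -> (m <= i < d)%N ->
  leb.-integrable setT (EFin \o (fun t => F (upd i t g))).
Proof.
move=> [mF [C [K [C0 K0 FC FK]]]] im.
have mf : measurable_fun setT (fun t : R => F (upd i t g)).
  apply: (measurableT_comp mF).
  apply: measurable_to_cyl => k; rewrite /upd; case: eqP => _ //.
apply: (@le_integrable _ _ _ leb _ measurableT _
   (EFin \o (fun t => C * \1_`[- K, K] t))).
- exact/measurable_EFinP.
- move=> t _ /=; rewrite lee_fin normrM (ger0_norm C0) (ger0_norm (indic_box_ge0 _ _)).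
  have [F0|F0] := eqVneq (F (upd i t g)) 0; first by rewrite F0 normr0 mulr_ge0// indic_box_ge0.
  by have := FK _ F0 _ im; rewrite upd_same => tK; rewrite indic_box// mulr1.
- exact: integrable_box.
Qed.

(** Tonelli applied to the positive and the negative part; [fine] of their difference is measurable
    in any case. *)
Lemma measurable_coord_int i F : measurable_fun [set: M] F ->
  measurable_fun [set: M] (coord_int i F).
Proof.
move=> mF; have mu := measurable_upd i.
have mf : measurable_fun [set: M * R] (EFin \o (fun p : M * R => F (upd i p.2 p.1))).
  by apply/measurable_EFinP; exact: (measurableT_comp mF mu).
rewrite /coord_int /Rintegral; apply: (measurableT_comp (fine_measurable measurableT)).
rewrite (_ : (fun g : M => _) = (fun g : M => fubini_F leb (EFin \o (fun p : M * R => F (upd i p.2 p.1)))^\+ g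
   - fubini_F leb (EFin \o (fun p : M * R => F (upd i p.2 p.1)))^\- g)%E); last first.
  apply/funext => g; rewrite integralE /fubini_F; congr (_ - _)%E;
  apply: eq_integral => x _; rewrite ?funeposE ?funenegE//.
have m1 : measurable_fun [set: M] (fubini_F leb (EFin \o (fun p : M * R => F (upd i p.2 p.1)))^\+)%E.
  by apply: measurable_fun_fubini_tonelli_F => //; exact: measurable_funepos.
have m2 : measurable_fun [set: M] (fubini_F leb (EFin \o (fun p : M * R => F (upd i p.2 p.1)))^\-)%E.
  by apply: measurable_fun_fubini_tonelli_F => //; exact: measurable_funeneg.
exact: (emeasurable_funB m1 m2).
Qed.

Lemma leb_box (K : R) : 0 <= K -> leb `[- K, K]%classic = (2 * K)%:E.
Proof.
move=> K0; have -> := lebesgue_measure_itv `[- K, K]; rewrite /= lte_fin.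
case: ifPn => [_|]; first by rewrite -EFinD; congr EFin; ring.
by rewrite -leNgt => h; rewrite (_ : K = 0) ?mulr0//; lra.
Qed.

Lemma Rintegral_box (C K : R) : 0 <= K ->
  Rintegral leb setT (fun t => C * \1_`[- K, K] t) = C * (2 * K).
Proof.
move=> K0; rewrite RintegralZl//; last exact: integrable_indic_itv.
congr (_ * _); by rewrite /Rintegral integral_indic// setIT; by have := leb_box K0; rewrite /= => ->.
Qed.

Lemma coord_int_bounded_supp m d F : bounded_supp m d F -> (m < d)%N ->
  bounded_supp m.+1 d (coord_int m F).
Proof.
move=> bF md; have [mF [C [K [C0 K0 FC FK]]]] := bF.
have im : (m <= m < d)%N by rewrite leqnn.
split; first exact: measurable_coord_int.
have FI t g : `|F (upd m t g)| <= C * \1_`[- K, K] t.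
  have [F0|F0] := eqVneq (F (upd m t g)) 0.
    by rewrite F0 normr0 mulr_ge0// indic_box_ge0.
  by have := FK _ F0 _ im; rewrite upd_same => tK; rewrite indic_box// mulr1.
exists (C * (2 * K)), K; split => //.
- by rewrite !mulr_ge0.
- move=> g; apply: (le_trans (le_normr_Rintegral measurableT (bounded_supp_fiber g bF im))).
  rewrite -Rintegral_box//; apply: le_Rintegral => //.
  + exact: integrable_norm (bounded_supp_fiber g bF im).
  + exact: integrable_box.
(* If a coordinate of [g] beyond [m] exceeds [K], the whole fibre over coordinate [m] vanishes, so
   the bound [K] survives. *)
- move=> g; apply: contra_neqP => /existsNP[k /not_implyP[/andP[mk kd] /negP gK]].
  rewrite /coord_int (_ : (fun t => _) = cst 0) ?Rintegral_cst ?mul0r//.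
  apply/funext => t /=; apply/eqP; apply: contraT => F0.
  exfalso; move/negP: gK; apply; have := FK _ F0 k; rewrite upd_neq ?gtn_eqF//; apply.
  by rewrite kd andbT ltnW.
Qed.

Lemma coord_ints_bounded_supp n d F : bounded_supp 0 d F -> (n <= d)%N ->
  bounded_supp n d (coord_ints n F).
Proof.
move=> bF; elim: n => [//|n IH] nd /=.
by apply: coord_int_bounded_supp => //; apply: IH; exact: ltnW.
Qed.

(** Fubini on the square [[-K, K]^2], outside which the integrand vanishes as a function of the two
    coordinates; it is bounded on a set of finite measure, hence integrable. *)
Lemma coord_int_comm m d F i j : bounded_supp m d F -> (m <= i < d)%N -> (m <= j < d)%N ->
  i != j -> coord_int i (coord_int j F) = coord_int j (coord_int i F).
Proof.
move=> bF im jm ij; apply/funext => g.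
have [mF [C [K [C0 K0 FC FK]]]] := bF.
pose f (p : R * R) : \bar R := (F (upd i p.1 (upd j p.2 g)))%:E.
have mf : measurable_fun [set: R * R] f.
  apply/measurable_EFinP; apply: (measurableT_comp mF).
  apply: measurable_to_cyl => k; rewrite /upd; case: eqP => _; first exact: measurable_fst.
  by case: eqP => _ //; exact: measurable_snd.
have If : (leb \x leb)%E.-integrable setT f.
  pose D : set (R * R) := `[- K, K]%classic `*` `[- K, K]%classic.
  have mD : measurable D by exact: measurableX.
  have fD : f \_ D = f.
    apply/funext => -[s t]; rewrite patchE; case: ifPn => //; rewrite notin_setE => nD.
    rewrite /f/=; apply/esym; congr EFin; apply/eqP; apply: contraT => F0; exfalso; apply: nD.
    have := FK _ F0 _ im; have := FK _ F0 _ jm.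
    by rewrite upd_same upd_comm// upd_same /D/= !in_itv/= -!ler_norml.
  rewrite -fD; have [H _] := @integrable_mkcond _ _ R (leb \x leb)%E D f mD; apply: H.
  rewrite (_ : f = EFin \o (fine \o f))//; refine (@measurable_bounded_integrable _ _ R (leb \x leb)%E (fine \o f) D mD _ _ _).
  - have E : ((leb \x leb)%E D < +oo)%E.
      rewrite /D product_measure1E//.
      rewrite (_ : (_ * _)%E = ((2 * K)%:E * (2 * K)%:E)%E); last by congr (_ * _)%E; exact: leb_box.
      by rewrite -EFinM; exact: ltry.
    exact: E.
  - apply: measurable_funTS; apply/measurable_EFinP; exact: mf.
  - exists C; split; first exact: num_real.
    by move=> x Cx p _ /=; apply: le_trans (ltW Cx); exact: FC.
have FE x : f x = (fine (f x))%:E by [].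
have H1 s : (\int[leb]_t f (s, t))%E = (coord_int j F (upd i s g))%:E.
  rewrite /coord_int /Rintegral fineK.
    by apply: eq_integral => t _; rewrite /f/= upd_comm.
  by apply: integrable_fin_num => //; exact: bounded_supp_fiber bF jm.
have H2 t : (\int[leb]_s f (s, t))%E = (coord_int i F (upd j t g))%:E.
  rewrite /coord_int /Rintegral fineK//.
  by apply: integrable_fin_num => //; exact: bounded_supp_fiber bF im.
have := Fubini If.
under eq_integral do rewrite H1.
under [in X in _ = X -> _]eq_integral do rewrite H2.
by move=> /(congr1 fine).
Qed.

End Cylinder.

(** * Shears and invariance under plane rotations *)

Section CoordInts.
Variable R : realType.
Implicit Types (F G : (nat -> R) -> R) (g : nat -> R) (i j k m n d : nat).
Notation M := (g_sigma_algebraType (@cylinders R)).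
Local Notation leb := (@lebesgue_measure R).

Lemma bounded_suppD m d F G : bounded_supp m d F -> bounded_supp m d G ->
  bounded_supp m d (fun g => F g + G g).
Proof.
move=> [mF [C [K [C0 K0 FC FK]]]] [mG [C' [K' [C'0 K'0 GC GK]]]]; split.
  exact: measurable_funD.
exists (C + C'), (Num.max K K'); split.
- exact: addr_ge0.
- by rewrite le_max K0.
- by move=> g; rewrite (le_trans (ler_normD _ _))// lerD.
- move=> g FG0 i im; rewrite le_max.
  have [F0|/FK/(_ _ im)->//] := eqVneq (F g) 0.
  by rewrite GK ?orbT//; move: FG0; rewrite F0 add0r.
Qed.

Lemma bounded_suppZ m d F c : bounded_supp m d F -> bounded_supp m d (fun g => c * F g).
Proof.
move=> [mF [C [K [C0 K0 FC FK]]]]; split.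
  by apply: measurable_funM => //; exact: measurable_cst.
exists (`|c| * C), K; split => //.
- exact: mulr_ge0.
- by move=> g; rewrite normrM ler_wpM2l.
- by move=> g FG0 i im; apply: FK => //; apply: contra_neq FG0 => ->; rewrite mulr0.
Qed.

Lemma coord_intsD n d F G : bounded_supp 0 d F -> bounded_supp 0 d G -> (n <= d)%N ->
  coord_ints n (fun g => F g + G g) = fun g => coord_ints n F g + coord_ints n G g.
Proof.
move=> bF bG; elim: n => [//|n IH] nd /=.
rewrite IH ?(ltnW nd)//; apply/funext => g; rewrite /coord_int.
have nn : (n <= n < d)%N by rewrite leqnn.
by rewrite RintegralD//; apply: (@bounded_supp_fiber _ n d) => //;
  apply: coord_ints_bounded_supp => //; exact: ltnW.
Qed.

Lemma coord_intsZ n d F c : bounded_supp 0 d F -> (n <= d)%N ->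
  coord_ints n (fun g => c * F g) = fun g => c * coord_ints n F g.
Proof.
move=> bF; elim: n => [//|n IH] nd /=.
rewrite IH ?(ltnW nd)//; apply/funext => g; rewrite /coord_int.
have nn : (n <= n < d)%N by rewrite leqnn.
by rewrite RintegralZl//; apply: (@bounded_supp_fiber _ n d) => //;
  apply: coord_ints_bounded_supp => //; exact: ltnW.
Qed.

Lemma ler_norm_coord_ints n d F G : bounded_supp 0 d F -> bounded_supp 0 d G ->
  (n <= d)%N -> (forall g, `|F g| <= G g) -> forall g, `|coord_ints n F g| <= coord_ints n G g.
Proof.
move=> bF bG + FG; elim: n => [//|n IH] nd g /=.
have nn : (n <= n < d)%N by rewrite leqnn.
have IF := @bounded_supp_fiber _ n d _ n g (coord_ints_bounded_supp bF (ltnW nd)) nn.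
have IG := @bounded_supp_fiber _ n d _ n g (coord_ints_bounded_supp bG (ltnW nd)) nn.
apply: (le_trans (le_normr_Rintegral measurableT IF)).
apply: le_Rintegral => //; first exact: integrable_norm IF.
by move=> t _; apply: IH; exact: ltnW.
Qed.

(** Integrates all coordinates below [n] except [i]; through [coord_intsE] any chosen coordinate can
    be made the innermost one. *)
Fixpoint coord_ints_skip i n F : (nat -> R) -> R :=
  if n is n'.+1 then
    if n' == i then coord_ints_skip i n' F else coord_int n' (coord_ints_skip i n' F)
  else F.

Lemma coord_ints_skip_ge i n F : (n <= i)%N -> coord_ints_skip i n F = coord_ints n F.
Proof.
by elim: n => [//|n IH] ni /=; rewrite IH ?(ltnW ni)// ltn_eqF.
Qed.

Lemma coord_int_coord_ints i n d F : bounded_supp 0 d F -> (i < d)%N -> (n <= i)%N ->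
  coord_int i (coord_ints n F) = coord_ints n (coord_int i F).
Proof.
move=> bF id; elim: n => [//|n IH] ni /=.
rewrite -IH; last exact: ltnW.
have nd : (n < d)%N by apply: ltn_trans id.
apply: (@coord_int_comm _ n d); rewrite ?leqnn ?id ?nd ?(ltnW ni) ?gtn_eqF//.
by apply: coord_ints_bounded_supp => //; exact: ltnW.
Qed.

Lemma coord_intsE i n d F : bounded_supp 0 d F -> (i < n <= d)%N ->
  coord_ints n F = coord_ints_skip i n (coord_int i F).
Proof.
move=> bF; elim: n => [//|n IH] /andP[/[!ltnS] ni nd] /=.
case: eqP => [->|/eqP ne].
  by rewrite coord_ints_skip_ge// -(coord_int_coord_ints bF)// ?(leq_ltn_trans ni).
by rewrite IH// ltn_neqAle ni eq_sym ne (ltnW nd).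
Qed.

Lemma measurable_addr_leb (c : R) (A : set R) : measurable A ->
  pushforward leb ((fun t : R => t + c) : R -> measurableTypeR R) A = leb A.
Proof.
have mc : measurable_fun setT ((fun t : R => t + c) : R -> measurableTypeR R).
  by apply: measurable_funD => //; exact: measurable_cst.
pose mu' := [the {measure set (measurableTypeR R) -> \bar R} of pushforward leb ((fun t : R => t + c) : R -> measurableTypeR R)].
move=> mA; apply/esym/lebesgue_measure_unique => //= _ [[a b]] _ <-.
rewrite /pushforward/=.
rewrite (_ : _ @^-1` _ = `]a - c, b - c]%classic); last first.
  by apply/seteqP; split => t /=; rewrite !in_itv/= ltrBlDr lerBrDr.
rewrite !lebesgue_measure_itv/= !lte_fin ltrD2r.
by case: ifP => // _; rewrite -!EFinD; congr EFin; ring.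
Qed.

Lemma Rintegral_addr (f : R -> R) (c : R) : measurable_fun setT f ->
  Rintegral leb setT (fun t => f (t + c)) = Rintegral leb setT f.
Proof.
move=> mf; have mc : measurable_fun setT ((fun t : R => t + c) : R -> measurableTypeR R).
  by apply: measurable_funD => //; exact: measurable_cst.
pose ph : R -> measurableTypeR R := fun t => t + c.
have H (h : R -> \bar R) : measurable_fun setT h -> (forall x, 0 <= h x)%E ->
   (\int[leb]_t h (t + c)%R = \int[leb]_t h t)%E.
  move=> mh h0.
  transitivity (\int[leb]_(t in ph @^-1` setT) (h \o ph) t)%E; first by rewrite preimage_setT.
  rewrite -ge0_integral_pushforward//.
  by apply: eq_measure_integral => A mA _; exact: measurable_addr_leb.
have mEf : measurable_fun setT (EFin \o f) by exact/measurable_EFinP.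
have Hp := H _ (measurable_funepos mEf) (funepos_ge0 _).
have Hn := H _ (measurable_funeneg mEf) (funeneg_ge0 _).
rewrite /Rintegral integralE [in RHS]integralE; congr (fine (_ - _)%E).
  by rewrite -[RHS]Hp; apply: eq_integral => x _; rewrite !funeposE.
by rewrite -[RHS]Hn; apply: eq_integral => x _; rewrite !funenegE.
Qed.

Definition shear i j (a : R) g : nat -> R := upd i (g i + a * g j) g.

Lemma measurable_shear i j a : measurable_fun setT (shear i j a : M -> M).
Proof.
apply: measurable_to_cyl => k; rewrite /shear /upd; case: eqP => _; last exact: measurable_coord.
apply: measurable_funD; first exact: measurable_coord.
by apply: measurable_funM; [exact: measurable_cst|exact: measurable_coord].
Qed.

Lemma bounded_supp_shear d F i j a : bounded_supp 0 d F -> (i < d)%N -> (j < d)%N -> i != j ->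
  bounded_supp 0 d (fun g => F (shear i j a g)).
Proof.
move=> [mF [C [K [C0 K0 FC FK]]]] id jd ij; split.
  exact: (measurableT_comp mF (measurable_shear i j a)).
exists C, (K + `|a| * K); split => //.
- by rewrite addr_ge0// mulr_ge0.
- move=> g F0 k kd; have [->|ki] := eqVneq k i.
    have := FK _ F0 i id; have := FK _ F0 j jd.
    rewrite /shear upd_same upd_neq 1?eq_sym// => jK iK.
    rewrite -[g i](addrK (a * g j)) (le_trans (ler_normB _ _))// lerD//.
    by rewrite normrM ler_wpM2l.
  have := FK _ F0 k kd; rewrite /shear upd_neq// => /le_trans; apply.
  by rewrite lerDl mulr_ge0.
Qed.

(** With coordinate [i] innermost, coordinate [j] is frozen and the shear is a translation by the
    constant [a * g j]. *)
Lemma coord_ints_shear d F i j a : bounded_supp 0 d F -> (i < d)%N -> (j < d)%N -> i != j ->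
  coord_ints d (fun g => F (shear i j a g)) = coord_ints d F.
Proof.
move=> bF id jd ij.
rewrite (coord_intsE (bounded_supp_shear a bF id jd ij) (i := i)) ?id ?leqnn//.
rewrite [RHS](coord_intsE bF (i := i)) ?id ?leqnn//; congr coord_ints_skip.
apply/funext => g; rewrite /coord_int.
have mF : measurable_fun setT (fun t => F (upd i t g)).
  by have /measurable_int/measurable_EFinP := bounded_supp_fiber g bF (i := i) id.
rewrite -[RHS](Rintegral_addr (a * g j) mF); congr (Rintegral _ _ _).
apply/funext => t; congr F; apply/funext => k; rewrite /shear /upd.
by case: (k == i); rewrite ?eqxx//= eq_sym (negbTE ij).
Qed.

(** Rotation in the plane of coordinates [i], [j] by the angle with tangent of the half-angle [u]. *)
Definition plane_rot i j (u : R) g : nat -> R := fun k =>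
  if k == i then (1 - u ^+ 2) / (1 + u ^+ 2) * g i - 2 * u / (1 + u ^+ 2) * g j
  else if k == j then 2 * u / (1 + u ^+ 2) * g i + (1 - u ^+ 2) / (1 + u ^+ 2) * g j
  else g k.

(** For [u = tan (theta / 2)] this is the factorisation of a rotation into shears by
    [- tan (theta / 2)], [sin theta] and [- tan (theta / 2)]. The half-angle parameter keeps all
    entries rational. *)
Lemma plane_rot_shears i j u g : i != j ->
  plane_rot i j u g = shear i j (- u) (shear j i (2 * u / (1 + u ^+ 2)) (shear i j (- u) g)).
Proof.
move=> ij; have u0 : 1 + u ^+ 2 != 0 by rewrite gt_eqF// ltr_pwDl// sqr_ge0.
apply/funext => k; rewrite /plane_rot /shear /upd !eqxx (negbTE ij).
have ji : (j == i) = false by rewrite eq_sym (negbTE ij).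
rewrite ji; have [ki|ki] := eqVneq k i; first by field.
by have [kj|kj] := eqVneq k j => //; field.
Qed.

Lemma coord_ints_rot d F i j u : bounded_supp 0 d F -> (i < d)%N -> (j < d)%N -> i != j ->
  bounded_supp 0 d (fun g => F (plane_rot i j u g)) /\
  coord_ints d (fun g => F (plane_rot i j u g)) = coord_ints d F.
Proof.
move=> bF id jd ij; have ji : j != i by rewrite eq_sym.
have b1 := bounded_supp_shear (- u) bF id jd ij.
have b2 := bounded_supp_shear (2 * u / (1 + u ^+ 2)) b1 jd id ji.
have b3 := bounded_supp_shear (- u) b2 id jd ij.
rewrite (_ : (fun g => _) = (fun g => F (shear i j (- u) (shear j i (2 * u / (1 + u ^+ 2)) (shear i j (- u) g))))).
  split => //; rewrite (coord_ints_shear (- u) b2 id jd ij).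
  by rewrite (coord_ints_shear _ b1 jd id ji) (coord_ints_shear _ bF id jd ij).
by apply/funext => g; rewrite plane_rot_shears.
Qed.

End CoordInts.

Lemma mpoly_ring_ind (R : nzRingType) n (P : mpoly n R -> Prop) :
  (forall c, P (mpolyC n c)) -> (forall i, P (mpolyX R (mnm1 i))) ->
  (forall p q, P p -> P q -> P (p + q)) -> (forall p q, P p -> P q -> P (p * q)) ->
  forall p, P p.
Proof.
move=> PC PX PD PM; elim/mpolyind => [|c m p _ _ Pp]; first by rewrite -mpolyC0.
apply: (PD _ _ _ Pp); rewrite -mul_mpolyC; apply: (PM _ _ (PC c)).
rewrite mpolyXE_id; apply: (big_ind P); [by rewrite -mpolyC1|exact: PM|].
move=> k _; elim: (m k) => [|e IH]; first by rewrite expr0 -mpolyC1.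
by rewrite exprS; apply: PM.
Qed.

(** * The surface integral: linearity, rotation invariance, integration by parts *)

Section SphereIntegral.
Variables (R : realType) (d : nat).
Notation V := 'rV[R]_d.
Notation M := (g_sigma_algebraType (@cylinders R)).
Implicit Types (g : nat -> R) (f : V -> R) (x y : V) (p q : mpoly d R).

Lemma dotpC x y : dotp x y = dotp y x.
Proof. by apply: eq_bigr => i _; rewrite mulrC. Qed.

Lemma dotpZl a x y : dotp (a *: x) y = a * dotp x y.
Proof. by rewrite /dotp mulr_sumr; apply: eq_bigr => i _; rewrite !mxE mulrA. Qed.

Lemma dotpZr a x y : dotp x (a *: y) = a * dotp x y.
Proof. by rewrite dotpC dotpZl dotpC. Qed.

Lemma dotp_ge0 x : 0 <= dotp x x.
Proof. by apply: sumr_ge0 => i _; rewrite -expr2 sqr_ge0. Qed.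

Lemma dotp_eq0 x : (dotp x x == 0) = (x == 0).
Proof.
apply/idP/idP => [|/eqP->]; last first.
  by rewrite /dotp big1// => i _; rewrite mxE mul0r.
rewrite /dotp psumr_eq0 => [/allP h|i _]; last by rewrite -expr2 sqr_ge0.
apply/eqP/rowP => i; have := h i; rewrite mem_index_enum => /(_ isT).
by rewrite mulf_eq0 orbb => /eqP ->; rewrite mxE.
Qed.

Lemma dotp_gt0 x : (0 < dotp x x) = (x != 0).
Proof. by rewrite lt_neqAle dotp_ge0 andbT eq_sym dotp_eq0. Qed.

Lemma eucl_gt0 x : x != 0 -> 0 < eucl x.
Proof. by rewrite /eucl sqrtr_gt0 dotp_gt0. Qed.

Lemma sqr_eucl x : eucl x ^+ 2 = dotp x x.
Proof. by rewrite sqr_sqrtr// dotp_ge0. Qed.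

Lemma sphere_normalize x : x != 0 -> sphere ((eucl x)^-1 *: x).
Proof.
move=> x0; rewrite /sphere/= dotpZl dotpZr -sqr_eucl mulrA -expr2 -exprMn mulVf ?expr1n//.
by rewrite gt_eqF// eucl_gt0.
Qed.

Lemma sphere_neq0 x : sphere x -> x != 0.
Proof. by move=> /= x1; rewrite -dotp_eq0 x1 oner_eq0. Qed.

Lemma sphere_eucl x : sphere x -> eucl x = 1.
Proof. by move=> /= x1; rewrite /eucl x1 sqrtr1. Qed.

Lemma ler_coord_eucl x i : `|x ord0 i| <= eucl x.
Proof.
rewrite -(@ler_pXn2r _ 2)// ?nnegrE ?sqrtr_ge0// sqr_eucl real_normK ?num_real//.
rewrite /dotp (bigD1 i)//= -expr2 lerDl; apply: sumr_ge0 => j _; by rewrite -expr2 sqr_ge0.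
Qed.

Lemma eucl_le1 x : (eucl x <= 1) = (dotp x x <= 1).
Proof. by rewrite -{1}sqrtr1 /eucl ler_sqrt. Qed.

Definition row_of g : V := \row_(i < d) g i.

(** The integrand of [sphere_int] read on sequences: the 0-homogeneous extension of [f], cut to the
    punctured unit ball. *)
Definition cone f g : R := let x := row_of g in
  if (x != 0) && (eucl x <= 1) then f ((eucl x)^-1 *: x) else 0.

Lemma sphere_intE f : sphere_int f = d%:R * coord_ints d (cone f) (fun=> 0).
Proof. by rewrite /sphere_int /leb_int iint_coord_ints. Qed.

Definition sphere_reg f := bounded_supp 0 d (cone f).

Lemma measurable_dotp_row : measurable_fun setT (fun g : M => dotp (row_of g) (row_of g)).
Proof.
apply: measurable_sum => i; 
rewrite (_ : (fun x : M => _) = (fun x : M => x i * x i)); last by apply/funext => x; rewrite !mxE.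
by apply: measurable_funM; exact: measurable_coord.
Qed.

Lemma measurable_inv_eucl : measurable_fun setT (fun g : M => (eucl (row_of g))^-1).
Proof.
rewrite (_ : (fun g => _) = (fun g => powR (powR (dotp (row_of g) (row_of g)) 2^-1) (-1))).
  apply: (measurableT_comp (measurable_powR _)); apply: (measurableT_comp (measurable_powR _)).
  exact: measurable_dotp_row.
by apply/funext => g; rewrite powR_inv1 ?powR_ge0// powR12_sqrt// dotp_ge0.
Qed.

Lemma sphere_reg_intro f (C : R) :
  measurable_fun setT (fun g : M => f ((eucl (row_of g))^-1 *: row_of g)) ->
  (forall x, sphere x -> `|f x| <= C) -> sphere_reg f.
Proof.
move=> mf fC; split.
  rewrite (_ : cone f = fun g => if (0 < dotp (row_of g) (row_of g)) && (dotp (row_of g) (row_of g) <= 1)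
     then f ((eucl (row_of g))^-1 *: row_of g) else 0); last first.
    by apply/funext => g; rewrite /cone dotp_gt0 eucl_le1.
  apply: measurable_fun_ifT => //; apply: measurable_and.
    apply: measurable_fun_ltr; [exact: measurable_cst|exact: measurable_dotp_row].
  apply: measurable_fun_ler; [exact: measurable_dotp_row|exact: measurable_cst].
exists (Num.max C 0), 1; split => //; first by rewrite le_max lexx orbT.
  move=> g; rewrite /cone; case: ifP => [/andP[x0 _]|]; last by rewrite normr0 le_max lexx orbT.
  by rewrite le_max fC//; exact: sphere_normalize.
move=> g; rewrite /cone; case: ifP => [/andP[x0 x1] _ i id|]; last by rewrite eqxx.
by rewrite (le_trans _ x1)// (le_trans _ (ler_coord_eucl _ (Ordinal id)))// mxE.
Qed.

Definition pev p x : R := meval (fun i => x ord0 i) p.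

Lemma pevD p q x : pev (p + q) x = pev p x + pev q x. Proof. exact: mevalD. Qed.
Lemma pevM p q x : pev (p * q) x = pev p x * pev q x. Proof. exact: mevalM. Qed.

Lemma sphere_reg_pev p : sphere_reg (pev p).
Proof.
apply: (@sphere_reg_intro _ (\sum_(m <- msupp p) `|mcoeff m p|)).
  rewrite (_ : (fun g : M => _) = (fun g : M => \sum_(m <- msupp p) mcoeff m p *
      \prod_(i < d) ((eucl (row_of g))^-1 * g i) ^+ m i)); last first.
    apply/funext => g; rewrite /pev mevalE; apply: eq_bigr => m _; congr (_ * _).
    by apply: eq_bigr => i _; rewrite !mxE.
  apply: measurable_sum => m; apply: measurable_funM; first exact: measurable_cst.
  apply: measurable_prod => i _; apply: measurable_funX.
  by apply: measurable_funM; [exact: measurable_inv_eucl|exact: measurable_coord].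
move=> x x1; rewrite /pev mevalE (le_trans (ler_norm_sum _ _ _))//.
apply: ler_sum => m _; rewrite normrM ler_piMr// normr_prod.
rewrite [leRHS](_ : 1 = \prod_(i < d) (1 : R)); last by rewrite big1.
apply: ler_prod => i _; rewrite normr_ge0/= normrX exprn_ile1//.
by rewrite (le_trans (ler_coord_eucl _ _))// sphere_eucl.
Qed.

Lemma eq_sphere_int f f' : (forall x, sphere x -> f x = f' x) -> sphere_int f = sphere_int f'.
Proof.
move=> ff; rewrite !sphere_intE; congr (_ * coord_ints _ _ _); apply/funext => g.
by rewrite /cone; case: ifP => // /andP[x0 _]; apply: ff; exact: sphere_normalize.
Qed.

Lemma sphere_intD f f' : sphere_reg f -> sphere_reg f' ->
  sphere_int (fun x => f x + f' x) = sphere_int f + sphere_int f'.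
Proof.
move=> rf rf'; rewrite !sphere_intE -mulrDr; congr (_ * _).
rewrite -[RHS]/((fun g => coord_ints d (cone f) g + coord_ints d (cone f') g) _).
rewrite -(coord_intsD rf rf') ?leqnn//; congr coord_ints; apply/funext => g.
by rewrite /cone; case: ifP => // _; rewrite addr0.
Qed.

Lemma sphere_intZ c f : sphere_reg f -> sphere_int (fun x => c * f x) = c * sphere_int f.
Proof.
move=> rf; rewrite !sphere_intE mulrCA; congr (_ * _).
rewrite -[RHS]/((fun g => c * coord_ints d (cone f) g) _).
rewrite -(coord_intsZ c rf) ?leqnn//; congr coord_ints; apply/funext => g.
by rewrite /cone; case: ifP => // _; rewrite mulr0.
Qed.

Lemma sphere_regD f f' : sphere_reg f -> sphere_reg f' -> sphere_reg (fun x => f x + f' x).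
Proof.
move=> rf rf'; have := bounded_suppD rf rf'; congr (bounded_supp _ _ _).
by apply/funext => g; rewrite /cone; case: ifP => // _; rewrite addr0.
Qed.

Lemma sphere_regZ c f : sphere_reg f -> sphere_reg (fun x => c * f x).
Proof.
move=> rf; have := bounded_suppZ c rf; congr (bounded_supp _ _ _).
by apply/funext => g; rewrite /cone; case: ifP => // _; rewrite mulr0.
Qed.

Lemma sphere_reg_cst c : sphere_reg (fun=> c).
Proof. by apply: (@sphere_reg_intro _ `|c|) => //; exact: measurable_cst. Qed.

Lemma ler_norm_sphere_int f C : sphere_reg f -> (forall x, sphere x -> `|f x| <= C) ->
  `|sphere_int f| <= C * sphere_int (fun _ : V => 1 : R).
Proof.
move=> rf fC; rewrite -sphere_intZ; last exact: sphere_reg_cst.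
rewrite !sphere_intE normrM normr_nat ler_wpM2l//.
apply: (ler_norm_coord_ints rf); rewrite ?leqnn//; first exact: sphere_reg_cst.
move=> g; rewrite /cone; case: ifP => [/andP[x0 _]|]; last by rewrite normr0.
by rewrite mulr1; apply: fC; exact: sphere_normalize.
Qed.

Section Rotation.
Variables (i j : 'I_d) (ij : i != j).

Definition rotv (u : R) x : V := \row_k
  if k == i then (1 - u ^+ 2) / (1 + u ^+ 2) * x ord0 i - 2 * u / (1 + u ^+ 2) * x ord0 j
  else if k == j then 2 * u / (1 + u ^+ 2) * x ord0 i + (1 - u ^+ 2) / (1 + u ^+ 2) * x ord0 j
  else x ord0 k.

Lemma row_of_rot u g : row_of (plane_rot i j u g) = rotv u (row_of g).
Proof. by apply/rowP => k; rewrite !mxE /plane_rot !val_eqE. Qed.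

Lemma rotvZ u c x : rotv u (c *: x) = c *: rotv u x.
Proof.
apply/rowP => k; rewrite !mxE; case: ifP => _; first by ring.
by case: ifP => _ //; ring.
Qed.

Lemma dotp_rotv u x : dotp (rotv u x) (rotv u x) = dotp x x.
Proof.
have u0 : 1 + u ^+ 2 != 0 by rewrite gt_eqF// ltr_pwDl// sqr_ge0.
have ji : j != i by rewrite eq_sym.
rewrite /dotp (bigD1 i)//= (bigD1 j)//= [RHS](bigD1 i)//= [X in _ = _ + X](bigD1 j)//=.
rewrite !addrA; congr (_ + _).
  by rewrite !mxE !eqxx (negbTE ji); field.
by apply: eq_bigr => k /andP[/negbTE ki /negbTE kj]; rewrite !mxE ki kj.
Qed.

Lemma sphere_rotv u x : sphere x -> sphere (rotv u x).
Proof. by rewrite /sphere/= dotp_rotv. Qed.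

Lemma cone_rotv u f : cone (fun x => f (rotv u x)) = fun g => cone f (plane_rot i j u g).
Proof.
apply/funext => g; rewrite /cone row_of_rot /eucl dotp_rotv -!dotp_eq0 dotp_rotv.
by rewrite rotvZ.
Qed.

Lemma sphere_int_rotv u f : sphere_reg f ->
  sphere_reg (fun x => f (rotv u x)) /\ sphere_int (fun x => f (rotv u x)) = sphere_int f.
Proof.
move=> rf; have [b e] := coord_ints_rot u rf (ltn_ord i) (ltn_ord j) ij.
by rewrite /sphere_reg !sphere_intE !cone_rotv e.
Qed.

(** Uniform first-order expansion of [f] along the rotation; the factor 2 is the
    angular speed of the half-angle parametrization. *)
Definition rot_derive f f' := exists2 C : R, 0 <= C & forall x, sphere x ->
  [/\ `|f x| <= C, `|f' x| <= C & forall u : R, 0 < u <= 1 ->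
      `|f (rotv u x) - f x - 2 * u * f' x| <= C * u ^+ 2].

Lemma rot_derive_cst c : rot_derive (fun=> c) (fun=> 0).
Proof.
exists `|c| => // x _; split; rewrite ?normr0// => u u1.
by rewrite subrr mulr0 subr0 normr0 mulr_ge0// sqr_ge0.
Qed.

Lemma rot_deriveD f f' h h' : rot_derive f f' -> rot_derive h h' ->
  rot_derive (fun x => f x + h x) (fun x => f' x + h' x).
Proof.
move=> [C C0 HC] [D D0 HD]; exists (C + D); first exact: addr_ge0.
move=> x x1; have [f1 f2 f3] := HC x x1; have [h1 h2 h3] := HD x x1; split.
- by rewrite (le_trans (ler_normD _ _))// lerD.
- by rewrite (le_trans (ler_normD _ _))// lerD.
- move=> u u1.
  rewrite (_ : _ - _ = (f (rotv u x) - f x - 2 * u * f' x) + (h (rotv u x) - h x - 2 * u * h' x)); last by ring.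
  by rewrite [leRHS]mulrDl; apply: (le_trans (ler_normD _ _)); apply: lerD; [exact: f3|exact: h3].
Qed.

Lemma rot_deriveM f f' h h' : rot_derive f f' -> rot_derive h h' ->
  rot_derive (fun x => f x * h x) (fun x => f' x * h x + f x * h' x).
Proof.
(* The expansion of the product leaves four error terms, which contribute 4 + 1 + 1 + 2 times
   [C * D * u ^ 2]. *)
move=> [C C0 HC] [D D0 HD]; exists (8 * (C * D)); first by rewrite !mulr_ge0.
move=> x x1; have [f1 f2 f3] := HC x x1; have [h1 h2 h3] := HD x x1.
have CD : 0 <= C * D by rewrite mulr_ge0.
split.
- rewrite normrM (le_trans (ler_pM _ _ f1 h1))//; lra.
- rewrite (le_trans (ler_normD _ _))// !normrM (le_trans (lerD (ler_pM _ _ f2 h1) (ler_pM _ _ f1 h2)))//; lra.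
- move=> u u1; have [u0 u1'] := andP u1.
  have [_ _ _] := HC _ (sphere_rotv u x1); have [h4 _ _] := HD _ (sphere_rotv u x1).
  have := f3 u u1; have := h3 u u1.
  set a := f (rotv u x) - _ - _; set b := h (rotv u x) - _ - _ => b1 a1.
  have -> : f (rotv u x) * h (rotv u x) - f x * h x - 2 * u * (f' x * h x + f x * h' x) =
     4 * u ^+ 2 * (f' x * h' x) + a * h (rotv u x) + f x * b + 2 * u * (f' x * b).
    by rewrite /a /b; ring.
  have u2 : 0 <= u ^+ 2 by rewrite sqr_ge0.
  have t1 : `|4 * u ^+ 2 * (f' x * h' x)| <= 4 * u ^+ 2 * (C * D).
    rewrite normrM (ger0_norm (mulr_ge0 _ u2))//; apply: ler_wpM2l; first by rewrite mulr_ge0.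
    by rewrite normrM ler_pM.
  have t2 : `|a * h (rotv u x)| <= C * u ^+ 2 * D by rewrite normrM ler_pM.
  have t3 : `|f x * b| <= C * (D * u ^+ 2) by rewrite normrM ler_pM.
  have t4 : `|2 * u * (f' x * b)| <= 2 * 1 * (C * (D * u ^+ 2)).
    rewrite normrM (ger0_norm (mulr_ge0 _ (ltW u0)))//; apply: ler_pM => //.
    - by rewrite mulr_ge0// ltW.
    - by rewrite ler_wpM2l.
    - by rewrite normrM ler_pM.
  apply: (le_trans (ler_normD _ _)); apply: (le_trans (lerD (ler_normD _ _) t4)).
  apply: (le_trans (lerD (lerD (ler_normD _ _) t3) (lexx _))).
  apply: (le_trans (lerD (lerD (lerD t1 t2) (lexx _)) (lexx _))).
  by rewrite le_eqVlt; apply/orP; left; apply/eqP; ring.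
Qed.

(** The rotation at angle zero generates the field [x_i d_j - x_j d_i]. The exact remainder is
    [2 u^2 (a + u b) / (1 + u^2)] with [|a|, |b| <= 1], whence the constant 4. *)
Lemma rot_derive_coord k : rot_derive (fun x => x ord0 k)
  (fun x => (k == j)%:R * x ord0 i - (k == i)%:R * x ord0 j).
Proof.
exists 4 => // x x1.
have B l : `|x ord0 l| <= 1 by rewrite (le_trans (ler_coord_eucl _ _))// sphere_eucl.
have ji : (j == i) = false by rewrite eq_sym (negbTE ij).
split.
- by rewrite (le_trans (B _))// ler1n.
- rewrite (le_trans (ler_normB _ _))// !normrM !normr_nat.
  have := B i; have := B j; case: (k == j); case: (k == i); rewrite ?mul1r ?mul0r; lra.
- move=> u /andP[u0 u1]; have u2 : 0 < 1 + u ^+ 2 by rewrite ltr_pwDl// sqr_ge0.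
  have un : 1 + u ^+ 2 != 0 by rewrite gt_eqF.
  have iu : 0 <= (1 + u ^+ 2)^-1 <= 1.
    by rewrite invr_ge0 ltW//= invf_le1// lerDl sqr_ge0.
  have uu : 0 <= u ^+ 2 by rewrite sqr_ge0.
  have K (a b : R) : `|a| <= 1 -> `|b| <= 1 ->
     `|(2 * u ^+ 2 * a + 2 * u ^+ 2 * (u * b)) * (1 + u ^+ 2)^-1| <= 4 * u ^+ 2.
    move=> a1 b1; have [i0 i1] := andP iu; rewrite normrM (ger0_norm i0).
    have N : `|2 * u ^+ 2 * a + 2 * u ^+ 2 * (u * b)| <= 4 * u ^+ 2.
      rewrite -mulrDr normrM ger0_norm; last by rewrite mulr_ge0.
      rewrite [leRHS](_ : _ = 2 * u ^+ 2 * (1 + 1)); last by ring.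
      apply: ler_wpM2l; first by rewrite mulr_ge0.
      rewrite (le_trans (ler_normD _ _))// lerD// normrM mulr_ile1// ger0_norm// ltW//.
    by rewrite (le_trans _ N)// ler_piMr.
  rewrite mxE; have [->|ki] := eqVneq k i.
    rewrite eq_sym ji mul0r sub0r mul1r.
    rewrite (_ : _ - _ = (2 * u ^+ 2 * (- x ord0 i) + 2 * u ^+ 2 * (u * x ord0 j)) * (1 + u ^+ 2)^-1).
      by apply: K; rewrite ?normrN.
    by field.
  have [->|kj] := eqVneq k j.
    rewrite mul0r subr0 mul1r.
    rewrite (_ : _ - _ = (2 * u ^+ 2 * (- x ord0 j) + 2 * u ^+ 2 * (u * (- x ord0 i))) * (1 + u ^+ 2)^-1).
      by apply: K; rewrite ?normrN.
    by field.
  by rewrite !mul0r subrr subr0 mulr0 subr0 normr0 mulr_ge0.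
Qed.

(** By invariance the increment of [f] integrates to zero, so twice [u] times the absolute value of
    the integral is at most [C u^2] times the area; divide by [u] and let it tend to 0. *)
Lemma rot_derive_int0 f f' : sphere_reg f -> sphere_reg f' -> rot_derive f f' -> sphere_int f' = 0.
Proof.
move=> rf rf' [C C0 H].
have B (u : R) : 0 < u <= 1 -> `|sphere_int f'| <= u * (C * sphere_int (fun _ : V => 1 : R)).
  move=> u1; have [u0 _] := andP u1; have [rr er] := sphere_int_rotv u rf.
  have rm : sphere_reg (fun x => f (rotv u x) + (-1) * f x + (- (2 * u)) * f' x).
    by apply: sphere_regD; [apply: sphere_regD => //|]; exact: sphere_regZ.
  have bnd x : sphere x -> `|f (rotv u x) + (-1) * f x + (- (2 * u)) * f' x| <= C * u ^+ 2.
    by move=> x1; have [_ _ /(_ u u1)] := H x x1; rewrite mulN1r mulNr.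
  have := ler_norm_sphere_int rm bnd.
  rewrite sphere_intD; [|by apply: sphere_regD => //; exact: sphere_regZ|exact: sphere_regZ].
  rewrite sphere_intD//; last exact: sphere_regZ.
  rewrite !sphere_intZ// er mulN1r subrr add0r normrM normrN (ger0_norm (mulr_ge0 _ (ltW u0)))// => h.
  have h2 : u * `|sphere_int f'| <= u * (u * (C * sphere_int (fun _ : V => 1 : R))).
    rewrite (le_trans _ (le_trans h _))//; last by rewrite le_eqVlt; apply/orP; left; apply/eqP; ring.
    have : 0 <= u * `|sphere_int f'| by rewrite mulr_ge0// ltW.
    lra.
  by rewrite -(ler_pM2l u0).
apply/eqP; rewrite -normr_le0; apply/ler_addgt0Pl => e e0; rewrite addr0.
have [K0|K0] := leP (C * sphere_int (fun _ : V => 1 : R)) 0.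
  by have := B 1; rewrite ltr01 lexx mul1r => /(_ isT)/le_trans; apply; rewrite (le_trans K0) ?ltW.
pose u := Num.min 1 (e / (C * sphere_int (fun _ : V => 1 : R))).
have u0 : 0 < u by rewrite lt_min ltr01/= divr_gt0.
have := B u; rewrite u0 ge_min lexx => /(_ isT)/le_trans; apply.
by rewrite -ler_pdivlMr// ge_min lexx orbT.
Qed.

Definition plane_derive p : mpoly d R :=
  mpolyX R (mnm1 i) * mderiv j p - mpolyX R (mnm1 j) * mderiv i p.

Lemma pev_X k x : pev (mpolyX R (mnm1 k)) x = x ord0 k.
Proof. by rewrite /pev mevalXU. Qed.

Lemma plane_deriveM p q : plane_derive (p * q) = plane_derive p * q + p * plane_derive q.
Proof. by rewrite /plane_derive !mderivM; ring. Qed.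

Lemma plane_deriveD p q : plane_derive (p + q) = plane_derive p + plane_derive q.
Proof. by rewrite /plane_derive !mderivD; ring. Qed.

Lemma rot_derive_pev p : rot_derive (pev p) (pev (plane_derive p)).
Proof.
pose P p := rot_derive (pev p) (pev (plane_derive p)).
have PD a b : P a -> P b -> P (a + b).
  move=> Pa Pb; have := rot_deriveD Pa Pb; rewrite /P plane_deriveD.
  by congr rot_derive; apply/funext => x; rewrite pevD.
have PM a b : P a -> P b -> P (a * b).
  move=> Pa Pb; have := rot_deriveM Pa Pb; rewrite /P plane_deriveM.
  by congr rot_derive; apply/funext => x; rewrite ?pevM// [RHS]pevD !pevM.
have PC c : P (mpolyC d c).
  have := rot_derive_cst c; congr rot_derive; apply/funext => x; first by rewrite /pev mevalC.
  by rewrite /plane_derive !mderivC !mulr0 subr0 /pev meval0.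
have Pd (a b : 'I_d) x : pev (mderiv a (mpolyX R (mnm1 b))) x = (b == a)%:R.
  rewrite mderivX mnm1E; case: eqP => [->|_]; last by rewrite scale0r /pev meval0.
  have -> : mnm_sub (mnm1 a) (mnm1 a) = mnm0 by apply/mnmP => k; rewrite mnmBE mnm0E subnn.
  by rewrite scale1r mpolyX0 /pev meval1.
have PX k : P (mpolyX R (mnm1 k)).
  have := rot_derive_coord k; congr rot_derive; apply/funext => x; first by rewrite pev_X.
  by rewrite /plane_derive /pev mevalB !mevalM !mevalXU -!/(pev _ _) !Pd mulrC [X in _ = _ - X]mulrC.
exact: (mpoly_ring_ind PC PX PD PM).
Qed.

(** Applied to a product, this says that the rotation fields are antisymmetric for the surface
    integral. *)
Lemma sphere_int_plane_derive p : sphere_int (pev (plane_derive p)) = 0.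
Proof.
by apply: (rot_derive_int0 _ _ (rot_derive_pev p)); exact: sphere_reg_pev.
Qed.

End Rotation.
End SphereIntegral.

(** * Harmonic polynomials *)

Section HarmonicPolynomials.
Variables (R : realType) (d : nat).
Implicit Types (p q : mpoly d R) (i j k : 'I_d) (l : nat) (m : multinom d).
Local Notation "'X_ i" := (mpolyX R (mnm1 i)) (at level 8, i at level 2).
Local Notation D := mderiv.

Definition mlap p := \sum_k D k (D k p).
Definition euler p := \sum_k 'X_k * D k p.

(** Homogeneity of degree [l] is expressed by Euler's identity. *)
Definition hharm l p := euler p = l%:R *: p /\ mlap p = 0.

Lemma mderiv_sum i (I : Type) (r : seq I) (F : I -> mpoly d R) :
  D i (\sum_(a <- r) F a) = \sum_(a <- r) D i (F a).
Proof. by elim/big_rec2: _ => [|a x y _ <-]; rewrite ?mderiv0 ?mderivD. Qed.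

Lemma mcoeff_sum m (I : Type) (r : seq I) (F : I -> mpoly d R) :
  mcoeff m (\sum_(a <- r) F a) = \sum_(a <- r) mcoeff m (F a).
Proof. by elim/big_rec2: _ => [|a x y _ <-]; rewrite ?mcoeff0 ?mcoeffD. Qed.

Lemma mderivXU i j : D i 'X_j = (j == i)%:R.
Proof.
rewrite mderivX mnm1E; case: eqP => [->|_]; last by rewrite scale0r.
by rewrite scale1r (_ : mnm_sub _ _ = mnm0) ?mpolyX0//; apply/mnmP => k; rewrite mnmBE mnm0E subnn.
Qed.

Lemma mlapD p q : mlap (p + q) = mlap p + mlap q.
Proof. by rewrite /mlap -big_split/=; apply: eq_bigr => k _; rewrite !mderivD. Qed.
Lemma mlapN p : mlap (- p) = - mlap p.
Proof. by rewrite /mlap -sumrN; apply: eq_bigr => k _; rewrite !mderivN. Qed.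
Lemma mlapZ c p : mlap (c *: p) = c *: mlap p.
Proof. by rewrite /mlap scaler_sumr; apply: eq_bigr => k _; rewrite !mderivZ. Qed.
Lemma eulerD p q : euler (p + q) = euler p + euler q.
Proof. by rewrite /euler -big_split/=; apply: eq_bigr => k _; rewrite mderivD mulrDr. Qed.
Lemma eulerN p : euler (- p) = - euler p.
Proof. by rewrite /euler -sumrN; apply: eq_bigr => k _; rewrite mderivN mulrN. Qed.
Lemma eulerZ c p : euler (c *: p) = c *: euler p.
Proof. by rewrite /euler scaler_sumr; apply: eq_bigr => k _; rewrite mderivZ scalerAr. Qed.

Lemma mlap_deriv i p : mlap (D i p) = D i (mlap p).
Proof.
rewrite /mlap mderiv_sum; apply: eq_bigr => k _.
by rewrite (mderiv_comm i k p) (mderiv_comm i k (D k p)).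
Qed.

Lemma sum_delta i (F : 'I_d -> mpoly d R) : \sum_k (i == k)%:R * F k = F i.
Proof.
rewrite (bigD1 i)//= eqxx mul1r big1 ?addr0// => k ki.
by rewrite eq_sym (negbTE ki) mul0r.
Qed.

Lemma mlapX i p : mlap ('X_i * p) = 'X_i * mlap p + 2%:R *: D i p.
Proof.
rewrite -[D i p](sum_delta i (fun k => D k p)) scaler_sumr /mlap mulr_sumr -big_split/=.
apply: eq_bigr => k _; rewrite mderivM mderivXU mderivD [X in _ + X]mderivM mderivXU.
have -> : D k ((i == k)%:R * p) = (i == k)%:R * D k p.
  by case: (i == k); rewrite ?mul1r ?mul0r ?mderiv0.
by rewrite scaler_nat mulr2n; ring.
Qed.

Lemma euler_deriv i p : euler (D i p) = D i (euler p) - D i p.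
Proof.
rewrite -[X in _ = _ - X](sum_delta i (fun k => D k p)) /euler mderiv_sum -sumrB.
apply: eq_bigr => k _; rewrite mderivM mderivXU [k == i]eq_sym mderiv_comm.
by rewrite addrC addKr.
Qed.

Lemma eulerX i p : euler ('X_i * p) = 'X_i * euler p + 'X_i * p.
Proof.
rewrite -[X in _ = _ + X](sum_delta i (fun k => 'X_k * p)) /euler mulr_sumr -big_split/=.
by apply: eq_bigr => k _; rewrite mderivM mderivXU; ring.
Qed.

Lemma hharmD l p q : hharm l p -> hharm l q -> hharm l (p + q).
Proof. by move=> [e1 l1] [e2 l2]; split; rewrite ?eulerD ?mlapD ?e1 ?e2 ?l1 ?l2 ?addr0 ?scalerDr. Qed.

Lemma hharmZ l c p : hharm l p -> hharm l (c *: p).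
Proof. by move=> [e1 l1]; split; rewrite ?eulerZ ?mlapZ ?e1 ?l1 ?scaler0// scalerA mulrC -scalerA. Qed.

Lemma hharm0 l : hharm l 0.
Proof. by have := hharmZ 0; split; rewrite /euler /mlap big1 ?scaler0// => k _; rewrite ?mderiv0 ?mulr0. Qed.

(** Multiplication by a variable restores the degree lost by differentiation, and the extra terms
    [2 D_i D_j p] in the Laplacian cancel by symmetry of second derivatives. *)
Lemma hharm_plane_derive i j l p : hharm l p -> hharm l (plane_derive i j p).
Proof.
move=> [ep lp]; rewrite /plane_derive; split.
  rewrite eulerD eulerN !eulerX !euler_deriv ep !mderivZ scalerBr.
  by rewrite !mulrBr !subrK !scalerAr.
by rewrite mlapD mlapN !mlapX !mlap_deriv lp !mderiv0 !mulr0 !add0r mderiv_comm subrr.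
Qed.

(** The sum runs over ordered pairs, so every plane counts twice and the eigenvalue is twice
    [- l (l + d - 2)]. Antisymmetry in the indices reduces the squares to twice the sum of
    [x_i d_j L_ij p]; harmonicity and Euler's identity for [p] and [D i p] do the rest. *)
Lemma casimir l p : hharm l p ->
  \sum_i \sum_j plane_derive i j (plane_derive i j p) = - (2 * (l%:R * (l%:R + d%:R - 2))) *: p.
Proof.
move=> [ep lp].
pose q i j := 'X_i * D j (plane_derive i j p).
have E1 : \sum_i \sum_j plane_derive i j (plane_derive i j p) = 2 *: \sum_i \sum_j q i j.
  rewrite scaler_nat mulr2n.
  rewrite [X in _ = _ + X]exchange_big -big_split/=; apply: eq_bigr => i _.
  rewrite -big_split/=; apply: eq_bigr => j _.
  rewrite /q (_ : plane_derive j i p = - plane_derive i j p); last by rewrite /plane_derive opprB.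
  by rewrite mderivN mulrN.
have E2 i : \sum_j q i j = 'X_i * D i p - d%:R *: ('X_i * D i p) - (l%:R - 1) *: ('X_i * D i p).
  have lpi : \sum_j 'X_i * ('X_i * D j (D j p)) = 0.
    by rewrite -!mulr_sumr -/(mlap p) lp !mulr0.
  have epi : \sum_j 'X_i * ('X_j * D j (D i p)) = (l%:R - 1) *: ('X_i * D i p).
    rewrite -mulr_sumr -/(euler (D i p)) euler_deriv ep mderivZ.
    by rewrite mulrBr -scalerAr scalerBl scale1r.
  have ci : \sum_(j < d) 'X_i * D i p = d%:R *: ('X_i * D i p).
    by rewrite sumr_const card_ord scaler_nat.
  have di : \sum_j (i == j)%:R * ('X_i * D j p) = 'X_i * D i p by rewrite sum_delta.
  transitivity (\sum_j ((i == j)%:R * ('X_i * D j p) + 'X_i * ('X_i * D j (D j p))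
      - 'X_i * D i p - 'X_i * ('X_j * D j (D i p)))); last first.
    by rewrite !sumrB big_split/= di lpi addr0 ci epi.
  apply: eq_bigr => j _; rewrite /q /plane_derive mderivB !mderivM !mderivXU eqxx /= mulr1n; ring.
rewrite E1 (eq_bigr _ (fun i _ => E2 i)) !sumrB -!scaler_sumr -/(euler p) ep !scalerA -!scalerBl scalerA.
by congr (_ *: _); ring.
Qed.

Lemma mcoeff_euler m p : mcoeff m (euler p) = (mdeg m)%:R * mcoeff m p.
Proof.
have [->|/eqP] := eqVneq p 0; first by rewrite /euler big1 ?mcoeff0 ?mulr0// => k _; rewrite mderiv0 mulr0.
move=> _; rewrite {1}(mpolyE p).
rewrite (_ : euler _ = \sum_(m' <- msupp p) mcoeff m' p *: ((mdeg m')%:R *: mpolyX R m')).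
  transitivity ((mdeg m)%:R * mcoeff m (\sum_(m' <- msupp p) mcoeff m' p *: mpolyX R m')); last by rewrite -mpolyE.
  rewrite !mcoeff_sum mulr_sumr; apply: eq_bigr => m' _.
  rewrite !mcoeffZ mcoeffX; case: eqP => [->|_]; last by rewrite !mulr0.
  by rewrite !mulr1 mulrC.
rewrite /euler; under eq_bigr => k _ do rewrite mderiv_sum mulr_sumr.
rewrite exchange_big/=; apply: eq_bigr => m' _.
under eq_bigr => k _ do rewrite mderivZ -scalerAr mderivX -scalerAr -mpolyXD.
rewrite -scaler_sumr; congr (_ *: _).
rewrite mdegE natr_sum scaler_suml; apply: eq_bigr => k _.
have [->|mk] := posnP (m' k); first by rewrite !scale0r.
congr (_ *: mpolyX R _); apply/mnmP => a; rewrite mnmDE mnmBE mnm1E.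
by case: eqP => [<-|_]; rewrite ?add0n ?subn0// add1n subn1 prednK.
Qed.

Lemma hharm_mcoeff0 l p m : hharm l p -> mdeg m != l -> mcoeff m p = 0.
Proof.
move=> [ep _] ml; have := mcoeff_euler m p; rewrite ep mcoeffZ => /eqP.
by rewrite -subr_eq0 -mulrBl mulf_eq0 subr_eq0 eqr_nat eq_sym (negbTE ml) => /eqP.
Qed.

(** Laplace's equation expresses the coefficients of degree [a + 2] in ['X_k]
    through those of degree [a]. *)
Lemma hharm_eq0 l p k : hharm l p -> (forall m, mdeg m = l -> (m k <= 1)%N -> mcoeff m p = 0) -> p = 0.
Proof.
move=> hp p01; apply/mpolyP => m; rewrite mcoeff0.
have [ml|/(hharm_mcoeff0 hp)//] := eqVneq (mdeg m) l.
have [N] := ubnP (m k); elim: N m ml => [//|N IH] m ml; rewrite ltnS => mN.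
have [m1|m2] := leqP (m k) 1; first exact: p01.
have [_ lp] := hp.
pose m' : multinom d := mnm_sub m (mnm_muln (mnm1 k) 2).
have mE : m = mnm_add (mnm_add m' (mnm1 k)) (mnm1 k).
  apply/mnmP => a; rewrite !mnmDE mnmBE mulmnE mnm1E.
  by case: eqP => [<-|_]; lia.
have m'k : m' k = (m k - 2)%N by rewrite mnmBE mulmnE mnm1E eqxx mul1n.
have := congr1 (mcoeff m') lp; rewrite mcoeff0 /mlap mcoeff_sum (bigD1 k)//= big1 ?addr0.
  by rewrite !mcoeff_deriv -mE -mulrnA => /eqP; rewrite mulrn_eq0 => /orP[//|/eqP].
move=> i ik; rewrite !mcoeff_deriv IH ?mul0rn//.
  by rewrite -ml mE !mdegD !mdeg1.
by rewrite !mnmDE !mnm1E (negbTE ik) m'k; lia.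
Qed.

End HarmonicPolynomials.

(** * Dimension of the harmonic polynomials and expansion in an orthonormal basis *)

Section HarmonicBasis.
Variables (R : realType) (e : nat).
Local Notation d := e.+2.
Implicit Types (p q : mpoly d R) (l : nat).

Definition ext_mnm n (b : nat) (t : e.+1.-tuple 'I_n) : multinom d :=
  Multinom [tuple of rcons (map val t) b].

(** The monomials of degree [l] with last exponent 0 or 1, whose coefficients determine a harmonic
    polynomial by [hharm_eq0]. The tuple encoding lets [card_ord_partitions] count them. *)
Definition low_mnms l : seq (multinom d) :=
  [seq ext_mnm 0 t | t <- enum [set t : e.+1.-tuple 'I_l.+1 | (\sum_(i <- t) i)%N == l]%SET] ++
  (if l is n.+1 then [seq ext_mnm 1 t | t <- enum [set t : e.+1.-tuple 'I_n.+1 | (\sum_(i <- t) i)%N == n]%SET]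
   else [::]).

Lemma ext_mnmE n (m : multinom d) : (\sum_(i < e.+1) m (widen_ord (leqnSn _) i) <= n)%N ->
  exists2 t : e.+1.-tuple 'I_n.+1, m = ext_mnm (m ord_max) t &
    (\sum_(i <- t) i = \sum_(i < e.+1) m (widen_ord (leqnSn _) i))%N.
Proof.
move=> mn; have mi i : (m (widen_ord (leqnSn _) i) <= n)%N.
  by rewrite (leq_trans _ mn)// (bigD1 i)//= leq_addr.
have [t tE] : exists t : e.+1.-tuple 'I_n.+1, forall i, val (tnth t i) = m (widen_ord (leqnSn _) i).
  by exists [tuple inord (m (widen_ord (leqnSn _) i)) | i < e.+1]; move=> i; rewrite tnth_mktuple /= inordK// ltnS; exact: mi.
exists t; last by rewrite big_tuple; apply: eq_bigr => i _; exact: tE.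
apply/mnmP => i; rewrite [RHS]mnm_tnth (tnth_nth 0%N)/= nth_rcons size_map size_tuple.
case: ltngtP => [ie|ei|ie].
- rewrite (nth_map ord0) ?size_tuple//; have := tE (Ordinal ie); rewrite (tnth_nth ord0)/= => ->.
  by congr (m _); apply: val_inj.
- by have := ltn_ord i; rewrite ltnNge ei.
- by congr (m _); apply: val_inj.
Qed.

Lemma hharm_low_mnms l p : hharm l p -> (forall m, m \in low_mnms l -> mcoeff m p = 0) -> p = 0.
Proof.
move=> hp h0; apply: (hharm_eq0 (k := ord_max) hp) => m ml m1.
have mE : (\sum_(i < e.+1) m (widen_ord (leqnSn _) i) + m ord_max = l)%N.
  by rewrite -ml mdegE [RHS]big_ord_recr.
apply: h0; rewrite /low_mnms mem_cat; move: m1; rewrite leq_eqVlt => /orP[/eqP m1|m1].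
  apply/orP; right; case: l hp ml mE => [|n] hp ml mE; first by rewrite m1 addn1 in mE.
  have sn : (\sum_(i < e.+1) m (widen_ord (leqnSn _) i) = n)%N by move: mE; rewrite m1 addn1 => -[].
  have [|t mt ts] := @ext_mnmE n m; first by rewrite sn.
  by rewrite mt m1; apply: map_f; rewrite mem_enum inE ts sn.
apply/orP; left; have m0 : m ord_max = 0%N by case: (m ord_max) m1.
have sn : (\sum_(i < e.+1) m (widen_ord (leqnSn _) i) = l)%N by move: mE; rewrite m0 addn0.
have [|t mt ts] := @ext_mnmE l m; first by rewrite sn.
by rewrite mt m0; apply: map_f; rewrite mem_enum inE ts sn.
Qed.

(** The two families have [C(l + d - 2, d - 2)] and [C(l + d - 3, d - 2)] elements, the second being
    empty for [l = 0]. *)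
Lemma size_low_mnms l : (0 < e)%N -> size (low_mnms l) = hdim l d.
Proof.
move=> e0; rewrite /low_mnms size_cat size_map -cardE card_ord_partitions /hdim.
rewrite (_ : 2 * l + d - 2 = l + (e + l))%N; last by lia.
rewrite (_ : l + d - 3 = (l + e).-1)%N; last by lia.
rewrite (_ : d - 2 = e)%N; last by lia.
have b1 : ('C(e + l, e) * (e`! * l`!) = (e + l) * ((l + e).-1)`!)%N.
  rewrite -[X in (_ * (_ * X`!))%N](addKn e) bin_fact ?leq_addr// addnC.
  by case: (l + e)%N (leq_addl l e) => [|n]; [lia|rewrite factS].
have pos : (0 < e`! * l`!)%N by rewrite muln_gt0 !fact_gt0.
case: l b1 pos => [|n] b1 pos; first by rewrite /= [LHS]addn0 -[LHS](mulnK _ pos) b1 add0n.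
rewrite size_map -cardE card_ord_partitions.
have b2 : ('C(e + n, e) * (e`! * n.+1`!) = n.+1 * ((n.+1 + e).-1)`!)%N.
  rewrite factS [(e`! * _)%N]mulnCA mulnCA; congr (_ * _)%N.
  by rewrite -[X in (_ * (_ * X`!))%N](addKn e) bin_fact ?leq_addr// addnC addSn.
by rewrite -[LHS](mulnK _ pos) mulnDl b1 b2 -mulnDl addnC.
Qed.

Lemma hharm_sum l (I : finType) (v : I -> R) (q : I -> mpoly d R) :
  (forall a, hharm l (q a)) -> hharm l (\sum_a v a *: q a).
Proof.
move=> hq; apply: big_ind => [|x y|a _]; [exact: hharm0|exact: hharmD|exact: hharmZ].
Qed.

(** The matrix of coefficients on [low_mnms l] has more rows than columns, hence a nonzero vector in
    its left kernel. *)
Lemma hharm_dependent l N (q : 'I_N -> mpoly d R) : (size (low_mnms l) < N)%N ->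
  (forall a, hharm l (q a)) -> exists2 v : 'rV[R]_N, v != 0 & \sum_a v ord0 a *: q a = 0.
Proof.
move=> sN hq; pose M := \matrix_(a < N, b < size (low_mnms l)) mcoeff (nth mnm0 (low_mnms l) b) (q a).
have kM : kermx M != 0.
  rewrite kermx_eq0 /row_free neq_ltn; apply/orP; left.
  by rewrite (leq_ltn_trans _ sN)// rank_leq_col.
exists (nz_row (kermx M)); first by rewrite nz_row_eq0.
have /sub_kermxP vM := nz_row_sub (kermx M).
apply: (hharm_low_mnms (l := l)); first exact: hharm_sum.
move=> m /(nthP mnm0)[b bs <-]; rewrite mcoeff_sum.
have /matrixP/(_ ord0 (Ordinal bs)) := vM; rewrite !mxE => vM0.
by rewrite -[RHS]vM0; apply: eq_bigr => a _; rewrite mcoeffZ !mxE.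
Qed.

Definition poly_int p : R := sphere_int (pev p).

Lemma poly_intD p q : poly_int (p + q) = poly_int p + poly_int q.
Proof.
rewrite /poly_int -sphere_intD; [|exact: sphere_reg_pev|exact: sphere_reg_pev].
by apply: eq_sphere_int => x _; rewrite pevD.
Qed.

Lemma poly_intZ c p : poly_int (c *: p) = c * poly_int p.
Proof.
rewrite /poly_int -sphere_intZ; last exact: sphere_reg_pev.
by apply: eq_sphere_int => x _; rewrite /pev mevalZ.
Qed.

Lemma poly_int0 : poly_int 0 = 0.
Proof. by rewrite -(scale0r (0 : mpoly d R)) poly_intZ mul0r. Qed.

Lemma poly_int_sum (I : Type) (r : seq I) (F : I -> mpoly d R) :
  poly_int (\sum_(a <- r) F a) = \sum_(a <- r) poly_int (F a).
Proof. by elim/big_rec2: _ => [|a x y _ <-]; rewrite ?poly_int0 ?poly_intD. Qed.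

Lemma plane_deriveZ (i j : 'I_d) c p : plane_derive i j (c *: p) = c *: plane_derive i j p.
Proof. by rewrite /plane_derive !mderivZ -!scalerAr scalerBr. Qed.

Lemma plane_derive_sum (i j : 'I_d) (I : Type) (r : seq I) (F : I -> mpoly d R) :
  plane_derive i j (\sum_(a <- r) F a) = \sum_(a <- r) plane_derive i j (F a).
Proof.
elim/big_rec2: _ => [|a x y _ <-]; last by rewrite plane_deriveD.
by rewrite /plane_derive !mderiv0 !mulr0 subrr.
Qed.

Variables (l h : nat) (p_ : 'I_h -> mpoly d R).
Hypothesis hsize : size (low_mnms l) = h.
Hypothesis hp : forall a, hharm l (p_ a).
Hypothesis ortho : forall a b, poly_int (p_ a * p_ b) = (a == b)%:R.

Lemma poly_int_lin (v : 'I_h -> R) b : poly_int ((\sum_a v a *: p_ a) * p_ b) = v b.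
Proof.
rewrite mulr_suml poly_int_sum (bigD1 b)//= -scalerAl poly_intZ ortho eqxx mulr1.
by rewrite big1 ?addr0// => a /negbTE ab; rewrite -scalerAl poly_intZ ortho ab mulr0.
Qed.

(** Together with [q] the [h] orthonormal harmonics exceed the dimension bound. In the resulting
    relation [q] must occur, for otherwise pairing with each [p_ b] kills every coefficient; pairing
    again identifies the expansion. *)
Lemma hharm_expand q : hharm l q -> q = \sum_a poly_int (q * p_ a) *: p_ a.
Proof.
move=> hq; pose Q (a : 'I_h.+1) := if unlift ord0 a is Some b then p_ b else q.
have [||v v0 vQ] := @hharm_dependent l h.+1 Q; first by rewrite hsize.
  by move=> a; rewrite /Q; case: unliftP => [b _|_]; [exact: hp|exact: hq].
have {}vQ : v ord0 ord0 *: q + \sum_b v ord0 (lift ord0 b) *: p_ b = 0.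
  rewrite -[RHS]vQ big_ord_recl /Q unlift_none; congr (_ + _).
  by apply: eq_bigr => b _; rewrite liftK.
have [v00|v00] := eqVneq (v ord0 ord0) 0.
  exfalso; move: v0; rewrite v00 scale0r add0r in vQ; move/eqP; apply.
  apply/rowP => a; rewrite mxE; case: (unliftP ord0 a) => [b ->|->//].
  by rewrite -(poly_int_lin (fun b => v ord0 (lift ord0 b)) b) vQ mul0r poly_int0.
have qE : q = \sum_b (- (v ord0 ord0)^-1 * v ord0 (lift ord0 b)) *: p_ b.
  apply: (scalerI v00); rewrite scaler_sumr.
  under eq_bigr do rewrite scalerA mulrA mulrN divff// mulN1r scaleNr.
  by rewrite sumrN; apply/eqP; rewrite -subr_eq0 opprK vQ.
rewrite {1}qE; apply: eq_bigr => b _; congr (_ *: _).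
by rewrite [in RHS]qE poly_int_lin.
Qed.

(** The matrices of the rotation fields in the basis [p_]. Integration by parts for [p_ a * p_ b]
    gives antisymmetry; the Casimir identity gives the sum of the squares [A *m A], hence that of
    [A *m A^T] after a change of sign. *)
Lemma plane_derive_matrix : exists A : 'I_d -> 'I_d -> 'M[R]_h,
  [/\ forall i j, (A i j)^T = - A i j,
      \sum_i \sum_j A i j *m (A i j)^T = (2 * (l%:R * (l%:R + d%:R - 2)))%:M &
      forall i j a, plane_derive i j (p_ a) = \sum_b A i j a b *: p_ b].
Proof.
pose A i j : 'M[R]_h := \matrix_(a, b) poly_int (plane_derive i j (p_ a) * p_ b).
have AL i j a : plane_derive i j (p_ a) = \sum_b A i j a b *: p_ b.
  rewrite {1}(hharm_expand (hharm_plane_derive i j (hp a))).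
  by apply: eq_bigr => b _; rewrite mxE.
have AT i j : (A i j)^T = - A i j.
  apply/matrixP => a b; rewrite !mxE; apply/eqP; rewrite -addr_eq0 -poly_intD.
  rewrite [X in _ + X]mulrC -plane_deriveM.
  have [->|ij] := eqVneq i j; first by rewrite /plane_derive subrr poly_int0.
  by rewrite /poly_int sphere_int_plane_derive.
exists A; split => //.
have AA : \sum_i \sum_j A i j *m A i j = (- (2 * (l%:R * (l%:R + d%:R - 2))))%:M.
  apply/matrixP => a b.
  have := congr1 (fun q => poly_int (q * p_ b)) (casimir (hp a)).
  rewrite -scalerAl poly_intZ ortho [X in _ = X -> _]mulr_natr => H.
  rewrite [RHS]mxE -[RHS]H mulr_suml poly_int_sum summxE; apply: eq_bigr => i _.
  rewrite mulr_suml poly_int_sum summxE; apply: eq_bigr => j _.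
  have -> : plane_derive i j (plane_derive i j (p_ a)) =
      \sum_c (\sum_b A i j a b * A i j b c) *: p_ c; last by rewrite poly_int_lin mxE.
  rewrite AL plane_derive_sum; under eq_bigr do rewrite plane_deriveZ AL scaler_sumr.
  rewrite exchange_big; apply: eq_bigr => c _; rewrite scaler_suml.
  by apply: eq_bigr => b' _; rewrite scalerA.
under eq_bigr do under eq_bigr do rewrite AT mulmxN.
under eq_bigr do rewrite sumrN.
by rewrite sumrN AA -raddfN opprK.
Qed.

End HarmonicBasis.

(** * Derivatives of homogeneous functions *)

Section Gradients.
Variables (R : realType) (d : nat).
Notation V := 'rV[R]_d.
Implicit Types (x y z v : V) (f g : V -> R) (i j k : 'I_d).

Lemma is_derive_line f z v (t df : R) :
  is_derive (z + t *: v) v f df <-> is_derive t 1 (fun s : R => f (z + s *: v)) df.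
Proof.
have E : (fun h : R => h^-1 *: ((f \o shift (z + t *: v)) (h *: v) - f (z + t *: v))) =
         (fun h : R => h^-1 *: (((fun s : R => f (z + s *: v)) \o shift t) (h *: 1) - f (z + t *: v))).
  apply/funext => h /=; congr (_ *: (f _ - _)).
  by apply/rowP => k; rewrite !mxE [h *: 1]mulr1; ring.
split => -[ex val]; split.
- by rewrite /derivable -E.
- by rewrite /derive -E.
- by rewrite /derivable E.
- by rewrite /derive E.
Qed.

(** Directional derivatives in all directions, linear in the direction: weaker than Fréchet
    differentiability, and all that the mean value theorem on segments requires. *)
Definition grad_at f (df : 'I_d -> R) x := forall v, is_derive x v f (\sum_i v ord0 i * df i).

Lemma grad_at_ext f df df' x : df =1 df' -> grad_at f df x -> grad_at f df' x.
Proof. by move=> e H v; rewrite -(eq_bigr _ (fun i _ => congr1 (fun r => v ord0 i * r) (e i))). Qed.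

Lemma grad_at_near f g df x : (\near x, f x = g x) -> grad_at f df x -> grad_at g df x.
Proof. by move=> e H v; apply: near_eq_is_derive e _. Qed.

Lemma grad_at_cst (c : R) x : grad_at (fun=> c) (fun=> 0) x.
Proof. by move=> v; rewrite big1 => [|i _]; [exact: is_derive_cst|rewrite mulr0]. Qed.

Lemma grad_at_coord k x : grad_at (fun y => y ord0 k) (fun i => (k == i)%:R) x.
Proof.
move=> v; rewrite (bigD1 k)//= eqxx mulr1 big1 ?addr0; last first.
  by move=> i ik; rewrite eq_sym (negbTE ik) mulr0.
rewrite -[x]addr0 -(scale0r v); apply/is_derive_line.
rewrite (_ : (fun s : R => _) = cst (x ord0 k) + (@id R * cst (v ord0 k))); last first.
  by apply/funext => s; rewrite !mxE.
have D1 := is_deriveM (is_derive_id (0 : R) (1 : R)) (is_derive_cst (v ord0 k) (0 : R) (1 : R)).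
have D2 : is_derive (0 : R) (1 : R) (cst (x ord0 k)) (0 : R) by exact: is_derive_cst.
apply: (is_derive_eq (is_deriveD D2 D1)).
by rewrite scaler0 !add0r /cst/= [_ *: _]mulr1.
Qed.

Lemma grad_atD f g df dg x : grad_at f df x -> grad_at g dg x ->
  grad_at (fun y => f y + g y) (fun i => df i + dg i) x.
Proof.
move=> F G v; apply: (is_derive_eq (is_deriveD (F v) (G v))).
by rewrite -big_split/=; apply: eq_bigr => i _; rewrite mulrDr.
Qed.

Lemma grad_atM f g df dg x : grad_at f df x -> grad_at g dg x ->
  grad_at (fun y => f y * g y) (fun i => df i * g x + f x * dg i) x.
Proof.
move=> F G v; apply: (is_derive_eq (is_deriveM (F v) (G v))).
rewrite [_ *: _]mulr_sumr [X in _ + X]mulr_sumr -big_split/=; apply: eq_bigr => i _; ring.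
Qed.

Lemma grad_atZ c f df x : grad_at f df x -> grad_at (fun y => c * f y) (fun i => c * df i) x.
Proof.
move=> F; apply: grad_at_ext (grad_atM (grad_at_cst c x) F) => i.
by rewrite mul0r add0r.
Qed.

Lemma grad_at_sum (I : Type) (r : seq I) (f : I -> V -> R) (df : I -> 'I_d -> R) x :
  (forall a, grad_at (f a) (df a) x) ->
  grad_at (fun y => \sum_(a <- r) f a y) (fun i => \sum_(a <- r) df a i) x.
Proof.
move=> F; elim: r => [|a r IH].
  rewrite (_ : (fun y => _) = fun=> 0); last by apply/funext => y; rewrite big_nil.
  by apply: grad_at_ext (grad_at_cst 0 x) => i; rewrite big_nil.
rewrite (_ : (fun y => _) = fun y => f a y + \sum_(a <- r) f a y); last first.
  by apply/funext => y; rewrite big_cons.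
by apply: grad_at_ext (grad_atD (F a) IH) => i; rewrite big_cons.
Qed.

Lemma grad_at_comp (h : R -> R) (dh : R) f df x : is_derive (f x) 1 h dh -> grad_at f df x ->
  grad_at (fun y => h (f y)) (fun i => dh * df i) x.
Proof.
move=> Hh F v; rewrite -[x]addr0 -(scale0r v); apply/is_derive_line.
have -> : \sum_i v ord0 i * (dh * df i) = dh * \sum_i v ord0 i * df i.
  by rewrite mulr_sumr; apply: eq_bigr => i _; rewrite mulrCA.
apply: (@is_derive1_comp _ h (fun s : R => f (x + s *: v))); first by rewrite scale0r addr0.
by apply/is_derive_line; rewrite scale0r addr0.
Qed.

Lemma grad_at_partial f df x i : grad_at f df x -> is_derive x (evec R i) f (df i).
Proof.
move=> /(_ (evec R i)); rewrite (bigD1 i)//= mxE !eqxx mul1r big1 ?addr0// => j ji.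
by rewrite mxE (negbTE ji) andbF mul0r.
Qed.

Lemma mean_value_segment f (df : V -> 'I_d -> R) x v :
  (forall t : R, 0 <= t <= 1 -> grad_at f (df (x + t *: v)) (x + t *: v)) ->
  exists2 c : R, 0 <= c <= 1 & f (x + v) - f x = \sum_i v ord0 i * df (x + c *: v) i.
Proof.
move=> F.
have Fl (t : R) : 0 <= t <= 1 -> is_derive t 1 (fun s : R => f (x + s *: v)) (\sum_i v ord0 i * df (x + t *: v) i).
  by move=> /F /(_ v) /is_derive_line.
have [|| c c01] := @MVT_segment R (fun s : R => f (x + s *: v))
    (fun t => \sum_i v ord0 i * df (x + t *: v) i) 0 1 ler01.
- by move=> t; rewrite in_itv/= => /andP[t0 t1]; apply: Fl; rewrite !ltW.
- apply: derivable_within_continuous => t; rewrite in_itv/= => /Fl H; exact: ex_derive.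
- by rewrite scale1r scale0r addr0 subr0 mulr1 => E; exists c.
Qed.

Lemma grad_at_dotp x : grad_at (fun y => dotp y y) (fun i => 2 * x ord0 i) x.
Proof.
have := grad_at_sum (index_enum 'I_d) (fun k => grad_atM (grad_at_coord k x) (grad_at_coord k x)).
apply: grad_at_ext => i.
rewrite (bigD1 i)//= eqxx big1 ?addr0; first by rewrite mulr1 mul1r; ring.
by move=> k ki; rewrite (negbTE ki) mul0r mulr0 addr0.
Qed.

Lemma grad_at_pev (p : mpoly d R) x : grad_at (pev p) (fun i => pev (mderiv i p) x) x.
Proof.
move: p; apply: mpoly_ring_ind => [c|k|p q Hp Hq|p q Hp Hq].
- rewrite (_ : pev _ = fun=> c); last by apply/funext => y; rewrite /pev mevalC.
  by apply: grad_at_ext (grad_at_cst c x) => i; rewrite mderivC /pev meval0.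
- rewrite (_ : pev _ = fun y => y ord0 k); last by apply/funext => y; rewrite pev_X.
  apply: grad_at_ext (grad_at_coord k x) => i; rewrite mderivXU.
  by case: (k == i); rewrite /pev ?meval1 ?meval0.
- rewrite (_ : pev _ = fun y => pev p y + pev q y); last by apply/funext => y; rewrite pevD.
  by apply: grad_at_ext (grad_atD Hp Hq) => i; rewrite mderivD pevD.
- rewrite (_ : pev _ = fun y => pev p y * pev q y); last by apply/funext => y; rewrite pevM.
  by apply: grad_at_ext (grad_atM Hp Hq) => i; rewrite mderivM [RHS]pevD !pevM.
Qed.

(** Evaluation at 0 isolates the constant coefficient, and the partial derivatives of [p] vanish
    identically too; the other coefficients follow by induction on the degree of the monomial. *)
Lemma pev_eq0 (p : mpoly d R) : (forall x, pev p x = 0) -> p = 0.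
Proof.
move=> p0; apply/mpolyP => m; rewrite mcoeff0.
have pos (m' : multinom d) : m' != mnm0 -> exists i, (0 < m' i)%N.
  move=> m0; apply/not_existsP => H; move/eqP: m0; apply; apply/mnmP => i; rewrite mnm0E.
  by apply/eqP; rewrite -leqn0 leqNgt; apply/negP; exact: H.
have [n mn] : exists n, mdeg m = n by eexists.
elim: n m mn p p0 => [|n IH] m mn p p0.
  move/eqP: mn; rewrite mdeg_eq0 => /eqP ->.
  rewrite -[RHS](p0 0) /pev mevalE {1}(mpolyE p) mcoeff_sum; apply: eq_bigr => m' _.
  rewrite mcoeffZ mcoeffX; congr (_ * _).
  have [->|/pos[i mi]] := eqVneq m' mnm0; first by rewrite big1// => i _; rewrite mnm0E expr0.
  by rewrite (bigD1 i)//= mxE expr0n eqn0Ngt mi mul0r.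
have [i mi] : exists i, (0 < m i)%N.
  by apply: pos; rewrite -mdeg_eq0 mn.
have mE : m = mnm_add (mnm_sub m (mnm1 i)) (mnm1 i).
  by rewrite submK//; apply/mnm_lepP => k; rewrite mnm1E; case: eqP => [<-|].
have := IH (mnm_sub m (mnm1 i)) _ (mderiv i p).
rewrite mcoeff_deriv -mE => H; apply/eqP; have /eqP : mcoeff m p *+ (mnm_sub m (mnm1 i) i).+1 = 0.
  apply: H.
    by apply/eqP; rewrite -eqSS -mn [in X in _ == X]mE mdegD mdeg1 addn1.
  move=> x; have [_ <-] := grad_at_partial i (grad_at_pev p x).
  by rewrite (_ : pev p = cst 0) ?derive_cst//; apply/funext => y; rewrite p0.
by rewrite mulrn_eq0.
Qed.

End Gradients.

(** Scalar coefficient functions on [R^d \ {0}]: polynomials in the coordinates and [|x|^-2]. *)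
Inductive coefx (R : realType) (d : nat) :=
| CCst of R | CVar of 'I_d | CInv | CAdd of coefx R d & coefx R d | CMul of coefx R d & coefx R d.
Arguments CInv {R d}.

Section Coefficients.
Variables (R : realType) (d : nat).
Notation V := 'rV[R]_d.
Implicit Types (x : V) (c : coefx R d) (i j : 'I_d).

Fixpoint ceval c x : R := match c with
  | CCst r => r | CVar i => x ord0 i | CInv => (dotp x x)^-1
  | CAdd c1 c2 => ceval c1 x + ceval c2 x | CMul c1 c2 => ceval c1 x * ceval c2 x end.

Fixpoint cderiv i c : coefx R d := match c with
  | CCst _ => CCst d 0 | CVar j => CCst d (j == i)%:R
  | CInv => CMul (CCst d (-2)) (CMul (CVar R i) (CMul CInv CInv))
  | CAdd c1 c2 => CAdd (cderiv i c1) (cderiv i c2)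
  | CMul c1 c2 => CAdd (CMul (cderiv i c1) c2) (CMul c1 (cderiv i c2)) end.

Lemma grad_at_ceval c x : x != 0 -> grad_at (ceval c) (fun i => ceval (cderiv i c) x) x.
Proof.
move=> x0; have r0 : dotp x x != 0 by rewrite dotp_eq0.
elim: c => [r|j||c1 H1 c2 H2|c1 H1 c2 H2] /=.
- exact: grad_at_cst.
- exact: grad_at_coord.
- have D : is_derive (dotp x x) 1 (fun s : R => s^-1) (- (dotp x x) ^- 2).
    by apply: (is_derive_eq (@is_deriveV _ id (dotp x x) 1 1 r0 (is_derive_id _ _))); rewrite [_ *: _]mulr1.
  apply: (grad_at_ext _ (grad_at_comp (f := fun y => dotp y y) D (grad_at_dotp x))) => i /=.
  by field.
- exact: grad_atD.
- exact: grad_atM.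
Qed.

Lemma ceval_bounded c (a b : R) : 0 < a -> exists2 C, 0 <= C &
  forall x, a <= eucl x <= b -> `|ceval c x| <= C.
Proof.
move=> a0; elim: c => [r|j||c1 [C1 C10 H1] c2 [C2 C20 H2]|c1 [C1 C10 H1] c2 [C2 C20 H2]] /=.
- by exists `|r|.
- exists (Num.max 0 b); first by rewrite le_max lexx.
  by move=> x /andP[_ xb]; rewrite le_max (le_trans (ler_coord_eucl _ _) xb) orbT.
- exists (a ^+ 2)^-1; first by rewrite invr_ge0 sqr_ge0.
  move=> x /andP[ax _]; rewrite ger0_norm ?invr_ge0 ?dotp_ge0// -sqr_eucl lef_pV2 ?posrE.
  + by rewrite ler_pXn2r// nnegrE ?sqrtr_ge0// ltW.
  + by rewrite exprn_gt0// (lt_le_trans a0).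
  + by rewrite exprn_gt0.
- exists (C1 + C2); first exact: addr_ge0.
  by move=> x xab; rewrite (le_trans (ler_normD _ _))// lerD ?H1 ?H2.
- exists (C1 * C2); first exact: mulr_ge0.
  by move=> x xab; rewrite normrM ler_pM ?H1 ?H2.
Qed.

(** [deriv_ops s] lists pairs of a coefficient and a word in the rotation fields;
    their sum represents the iterated partial derivative along [s] on
    0-homogeneous functions, because there
    [d_i = \sum_j x_j |x|^-2 (x_j d_i - x_i d_j)]. *)
Fixpoint deriv_ops (s : seq 'I_d) : seq (coefx R d * seq ('I_d * 'I_d)) :=
  if s is i :: s' then
    flatten [seq (cderiv i cw.1, cw.2) ::
      [seq (CMul cw.1 (CMul (CVar R j) CInv), (j, i) :: cw.2) | j <- enum 'I_d] | cw <- deriv_ops s']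
  else [:: (CCst d 1, [::])].

Lemma deriv_ops_size s : all (fun cw => size cw.2 <= size s)%N (deriv_ops s).
Proof.
elim: s => [//|i s] /=; elim: (deriv_ops s) => [//|cw L IH] /= /andP[cws Ls].
rewrite leqW//= all_cat IH// andbT all_map.
by apply/allP => j _ /=; rewrite ltnS.
Qed.

End Coefficients.

Lemma ler_sum_all (R : realType) (T : Type) (r : seq T) (P : pred T) (F G : T -> R) :
  all P r -> (forall t, P t -> F t <= G t) -> \sum_(t <- r) F t <= \sum_(t <- r) G t.
Proof.
move=> + FG; elim: r => [|t r IH]; first by rewrite !big_nil.
by move=> /= /andP[Pt Pr]; rewrite !big_cons lerD ?FG ?IH.
Qed.

Lemma sqr_sum_le (R : realType) (T : Type) (r : seq T) (F : T -> R) :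
  (\sum_(t <- r) F t) ^+ 2 <= (size r)%:R * \sum_(t <- r) F t ^+ 2.
Proof.
elim: r => [|t r IH]; first by rewrite !big_nil expr0n mulr0.
rewrite !big_cons /= -natr1; set a := F t; set S := \sum_(t <- r) F t in IH *.
set Q := \sum_(t <- r) _ in IH *; set n := (size r)%:R in IH *.
have n0 : 0 <= n by rewrite ler0n.
have [nz|np] := eqVneq n 0.
  rewrite nz mul0r in IH; have S0 : S = 0 by apply/eqP; rewrite -sqrf_eq0 eq_le IH sqr_ge0.
  have Q0 : 0 <= Q by apply: sumr_ge0 => i _; exact: sqr_ge0.
  rewrite S0 nz addr0 add0r mul1r; lra.
have np' : 0 < n by rewrite lt_neqAle eq_sym np.
have K : S ^+ 2 + n * n * a ^+ 2 >= 2 * n * a * S by have := sqr_ge0 (n * a - S); nra.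
have K2 : 2 * a * S <= Q + n * a ^+ 2.
  rewrite -(ler_pM2l np'); nra.
nra.
Qed.

(** * The vector of harmonics of one degree and its derivatives *)

Section HarmonicVector.
Variables (R : realType) (e l h : nat).
Local Notation d := e.+2.
Notation V := 'rV[R]_d.
Variables (p_ : 'I_h -> mpoly d R) (A : 'I_d -> 'I_d -> 'M[R]_h) (lam : R).
Hypothesis hp : forall a, hharm l (p_ a).
Hypothesis AT : forall i j, (A i j)^T = - A i j.
Hypothesis AA : \sum_i \sum_j A i j *m (A i j)^T = lam%:M.
Hypothesis AL : forall i j a, plane_derive i j (p_ a) = \sum_b A i j a b *: p_ b.
Implicit Types (x : V) (i j : 'I_d) (a b : 'I_h).

(** The 0-homogeneous extension [|x|^(-l) p_a(x)]. *)
Definition hvec a x : R := powR (dotp x x) (- (l%:R / 2)) * pev (p_ a) x.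

(** The rotation fields do not see the radial factor and act on [p_a] through [A]. By Euler's
    identity the derivative of the radial factor cancels the radial part of the gradient of
    [p_a]. *)
Lemma grad_hvec a x : x != 0 -> grad_at (hvec a)
  (fun i => \sum_j (x ord0 j * (dotp x x)^-1) * \sum_b A j i a b * hvec b x) x.
Proof.
move=> x0; have r0 : 0 < dotp x x by rewrite dotp_gt0.
have G := grad_atM (grad_at_comp (f := fun y => dotp y y) (is_derive1_powR (- (l%:R / 2)) r0) (grad_at_dotp x)) (grad_at_pev (p_ a) x).
apply: (grad_at_ext _ G) => i.
set r := dotp x x; set P := powR r (- (l%:R / 2)).
have PE : powR r (- (l%:R / 2) - 1) = P * r^-1.
  by rewrite powRD ?powR_inv1 ?ltW// (gt_eqF r0) implybT.
rewrite PE; have E1 j : \sum_b A j i a b * hvec b x =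
    P * (x ord0 j * pev (mderiv i (p_ a)) x - x ord0 i * pev (mderiv j (p_ a)) x).
  rewrite -[x ord0 j]pev_X -[x ord0 i]pev_X /pev -!mevalM -mevalB -/(plane_derive j i (p_ a)) AL.
  rewrite raddf_sum/= mulr_sumr; apply: eq_bigr => b _.
  by rewrite mevalZ mulrCA.
under [RHS]eq_bigr do rewrite E1.
have E2 : \sum_j x ord0 j * pev (mderiv j (p_ a)) x = l%:R * pev (p_ a) x.
  have [ep _] := hp a; rewrite /pev -mevalZ -ep /euler raddf_sum/=; apply: eq_bigr => j _.
  by rewrite mevalM mevalXU.
transitivity (P * r^-1 * (r * pev (mderiv i (p_ a)) x - x ord0 i * (l%:R * pev (p_ a) x))).
  by field; rewrite gt_eqF.
rewrite -E2 {1}/r /dotp mulr_suml mulr_sumr -sumrB mulr_sumr; apply: eq_bigr => j _; ring.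
Qed.

(** The newest letter multiplies on the right: a derivative acts on the functions [hvec b], not on
    the constant matrix in front of them. *)
Fixpoint word_mx (w : seq ('I_d * 'I_d)) : 'M[R]_h :=
  if w is ji :: w' then word_mx w' *m A ji.1 ji.2 else 1%:M.

Definition word_hvec w a x : R := \sum_b word_mx w a b * hvec b x.

Lemma grad_word_hvec w a x : x != 0 -> grad_at (word_hvec w a)
  (fun i => \sum_j (x ord0 j * (dotp x x)^-1) * word_hvec ((j, i) :: w) a x) x.
Proof.
move=> x0; have G := grad_at_sum (index_enum 'I_h) (fun b => grad_atZ (word_mx w a b) (grad_hvec b x0)).
apply: (grad_at_ext _ G) => i.
under eq_bigr do rewrite mulr_sumr.
rewrite exchange_big; apply: eq_bigr => j _.
rewrite /word_hvec /=; under [in RHS]eq_bigr do rewrite mxE mulr_suml.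
rewrite [in RHS]exchange_big/= mulr_sumr; apply: eq_bigr => b _.
by rewrite mulrCA; congr (_ * _); rewrite mulr_sumr; apply: eq_bigr => c _; rewrite mulrA.
Qed.

Lemma near_neq0 x : x != 0 -> \near x, x != 0.
Proof.
move=> x0; apply/nbhs_ballP; exists `|x|; first by rewrite /= normr_gt0.
move=> y /=; rewrite -ball_normE /=; apply: contraTneq => ->.
by rewrite subr0 ltxx.
Qed.

Lemma iter_partial_hvec s a x : x != 0 -> iter_partial s (hvec a) x =
  \sum_(cw <- deriv_ops R s) ceval cw.1 x * word_hvec cw.2 a x.
Proof.
elim: s x => [|i s IH] x x0 /=.
  rewrite big_seq1/= mul1r /word_hvec (bigD1 a)//= mxE eqxx mul1r big1 ?addr0// => b ba.
  by rewrite mxE eq_sym (negbTE ba) mul0r.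
have G := grad_at_sum (deriv_ops R s) (fun cw => grad_atM (grad_at_ceval cw.1 x0) (grad_word_hvec cw.2 a x0)).
have N : \near x, \sum_(cw <- deriv_ops R s) ceval cw.1 x * word_hvec cw.2 a x = iter_partial s (hvec a) x.
  by near=> y; rewrite IH//; near: y; exact: near_neq0.
have G' := grad_at_near N G.
have [_ ->] := grad_at_partial i G'.
rewrite big_flatten big_map; apply: eq_bigr => cw _.
rewrite big_cons big_map big_enum/=; congr (_ + _); rewrite mulr_sumr.
by apply: eq_big => // j _; rewrite !mulrA.
Unshelve. all: by end_near.
Qed.

Lemma grad_iter_partial_hvec s a x : x != 0 ->
  grad_at (iter_partial s (hvec a)) (fun i => iter_partial (i :: s) (hvec a) x) x.
Proof.
move=> x0.
have G := grad_at_sum (deriv_ops R s) (fun cw => grad_atM (grad_at_ceval cw.1 x0) (grad_word_hvec cw.2 a x0)).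
have N : \near x, \sum_(cw <- deriv_ops R s) ceval cw.1 x * word_hvec cw.2 a x = iter_partial s (hvec a) x.
  by near=> y; rewrite iter_partial_hvec//; near: y; exact: near_neq0.
have G' := grad_at_near N G.
by apply: (grad_at_ext _ G') => i /=; have [_ ->] := grad_at_partial i G'.
Unshelve. all: by end_near.
Qed.

Definition sqn (y : 'cV[R]_h) := \sum_b y b ord0 ^+ 2.

Lemma sqn_mx y : sqn y = (y^T *m y) ord0 ord0.
Proof. by rewrite mxE; apply: eq_bigr => b _; rewrite mxE. Qed.

Lemma sqn_ge0 y : 0 <= sqn y.
Proof. by apply: sumr_ge0 => b _; exact: sqr_ge0. Qed.

(** Summed over all pairs the left sides give exactly [lam * sqn y], and every term is
    nonnegative. *)
Lemma sqn_A i j y : sqn (A i j *m y) <= lam * sqn y.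
Proof.
have E i' j' : sqn (A i' j' *m y) = (y^T *m (A i' j' *m (A i' j')^T) *m y) ord0 ord0.
  by rewrite sqn_mx trmx_mul !mulmxA AT mulmxN mulNmx mulmxN mulNmx.
have -> : lam * sqn y = \sum_i \sum_j sqn (A i j *m y).
  under eq_bigr do under eq_bigr do rewrite E.
  under eq_bigr do rewrite -summxE -mulmx_suml -mulmx_sumr.
  by rewrite -summxE -mulmx_suml -mulmx_sumr AA mul_mx_scalar -scalemxAl mxE -sqn_mx.
rewrite (bigD1 i)//= (bigD1 j)//= -addrA lerDl addr_ge0// sumr_ge0// => k _; rewrite ?sqn_ge0//.
by apply: sumr_ge0 => k' _; exact: sqn_ge0.
Qed.

Lemma sqn_word w y : 0 <= lam -> sqn (word_mx w *m y) <= lam ^+ size w * sqn y.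
Proof.
move=> l0; elim: w y => [|ji w IH] y /=; first by rewrite mul1mx expr0 mul1r.
rewrite -mulmxA (le_trans (IH _))// exprSr -mulrA ler_wpM2l ?exprn_ge0//.
exact: sqn_A.
Qed.

(** Antisymmetry of the matrices makes the gradient of the sum of squares vanish. In dimension at
    least two, any two nonzero points are joined through basis vectors by segments that miss the
    origin. *)
Lemma hvec_sum_const x y : x != 0 -> y != 0 -> \sum_a hvec a x ^+ 2 = \sum_a hvec a y ^+ 2.
Proof.
pose F x := \sum_a hvec a x ^+ 2.
have F0 x' : x' != 0 -> grad_at F (fun=> 0) x'.
  move=> x0; have G := grad_at_sum (index_enum 'I_h) (fun a => grad_atM (grad_hvec a x0) (grad_hvec a x0)).
  apply: (grad_at_ext _ G) => i.
  rewrite (eq_bigr (fun a => \sum_j (x' ord0 j / dotp x' x') * (2 * (hvec a x' * \sum_b A j i a b * hvec b x')))); last first.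
    by move=> a _; rewrite mulr_suml mulr_sumr -big_split/=; apply: eq_bigr => j _; ring.
  rewrite exchange_big/= big1// => j _; rewrite -!mulr_sumr.
  have -> : \sum_a hvec a x' * \sum_b A j i a b * hvec b x' = 0; last by rewrite !mulr0.
  set S := \sum_a _; suff : S + S = 0 by lra.
  rewrite /S; under eq_bigr do rewrite mulr_sumr.
  rewrite [X in _ + X]exchange_big/= -big_split/= big1// => a _; rewrite -big_split/= big1// => b _.
  have /matrixP/(_ a b) := AT j i; rewrite !mxE => ->; ring.
have seg x1 x2 : (forall t : R, 0 <= t <= 1 -> x1 + t *: (x2 - x1) != 0) -> F x1 = F x2.
  move=> H; have [t t01] := @mean_value_segment R d F (fun=> fun=> 0) x1 (x2 - x1) (fun t t01 => F0 _ (H t t01)).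
  rewrite big1 => [/eqP|i _]; last by rewrite mulr0.
  by rewrite [x1 + _]addrC subrK subr_eq0 => /eqP ->.
(* Along the segment coordinate [k] vanishes only at the end, where coordinate [j] is 1. *)
have toe x1 k j : x1 ord0 k != 0 -> j != k -> F x1 = F (evec R j).
  move=> xk jk; apply: seg => t t01; apply/negP => /eqP/rowP E.
  have := E k; have := E j; rewrite !mxE !eqxx [k == j]eq_sym (negbTE jk)/= sub0r mulrN => E1 E2.
  have t1 : t = 1.
    by apply: (mulIf xk); rewrite mul1r; apply/eqP; rewrite eq_sym -subr_eq0 E2.
  by move: E1; rewrite t1 mul1r addrC subrK => /eqP; rewrite pnatr_eq0.
have ee j k : F (evec R j) = F (evec R k).
  have [->//|jk] := eqVneq j k.
  by apply: (toe _ j); [rewrite mxE !eqxx oner_eq0|rewrite eq_sym].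
have tof x1 : x1 != 0 -> F x1 = F (evec R ord0).
  move=> x10; have [k xk] : exists k, x1 ord0 k != 0.
    apply/not_existsP => H; move/eqP: x10; apply; apply/rowP => k; rewrite mxE.
    by apply/eqP; apply: contraT => /H.
  have [k0|k0] := eqVneq k ord0.
    by rewrite (toe x1 k ord_max)// k0.
  by apply: (toe x1 k) => //; rewrite eq_sym.
by move=> /tof Fx /tof Fy; rewrite -/(F x) Fx -Fy.
Qed.

(** Cauchy-Schwarz over the terms of [deriv_ops], then [sqn_word] for each. Passing from [lam] to
    [1 + lam] lets all words be treated as having full length. *)
Lemma hvec_deriv_bound s (C : R) x : 0 <= lam -> x != 0 ->
  all (fun cw => `|ceval cw.1 x| <= C) (deriv_ops R s) ->
  \sum_a iter_partial s (hvec a) x ^+ 2 <=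
    (size (deriv_ops R s))%:R ^+ 2 * C ^+ 2 * (1 + lam) ^+ size s * \sum_a hvec a x ^+ 2.
Proof.
move=> l0 x0 HC; set L := deriv_ops R s in HC *.
pose y : 'cV[R]_h := \col_b hvec b x.
have yE : sqn y = \sum_a hvec a x ^+ 2 by apply: eq_bigr => b _; rewrite mxE.
have wE w : \sum_a word_hvec w a x ^+ 2 = sqn (word_mx w *m y).
  by apply: eq_bigr => a _; rewrite mxE; congr (_ ^+ 2); apply: eq_bigr => b _; rewrite mxE.
have H1 a : iter_partial s (hvec a) x ^+ 2 <=
    (size L)%:R * \sum_(cw <- L) (ceval cw.1 x * word_hvec cw.2 a x) ^+ 2.
  by rewrite iter_partial_hvec//; exact: sqr_sum_le.
apply: (le_trans (ler_sum _ (fun a _ => H1 a))); rewrite -mulr_sumr exchange_big/=.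
rewrite (_ : _ * \sum_a _ = (size L)%:R * ((size L)%:R * (C ^+ 2 * ((1 + lam) ^+ size s * \sum_a hvec a x ^+ 2)))); last by ring.
rewrite ler_wpM2l//.
have -> : (size L)%:R * (C ^+ 2 * ((1 + lam) ^+ size s * \sum_a hvec a x ^+ 2)) =
    \sum_(cw <- L) (C ^+ 2 * ((1 + lam) ^+ size s * sqn y)).
  by rewrite big_const_seq count_predT iter_addr_0 -yE mulr_natl.
have HP : all (fun cw => (`|ceval cw.1 x| <= C) && (size cw.2 <= size s)%N) L.
  by rewrite all_predI HC; exact: deriv_ops_size.
apply: (ler_sum_all HP) => cw /andP[cC cs].
under eq_bigr do rewrite exprMn.
rewrite -mulr_sumr wE ler_pM ?sqr_ge0 ?sqn_ge0//.
  by rewrite -real_normK ?num_real// ler_pXn2r// nnegrE// (le_trans _ cC).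
rewrite (le_trans (sqn_word _ _ l0))// ler_wpM2r ?sqn_ge0//.
rewrite (@le_trans _ _ ((1 + lam) ^+ size cw.2))//.
  by rewrite lerXn2r ?nnegrE ?addr_ge0// lerDr.
by rewrite ler_weXn2l// lerDl.
Qed.

End HarmonicVector.

(** * Bounds for the given spherical harmonics *)

Section SphericalHarmonics.
Variables (R : realType) (e : nat).
Local Notation d := e.+2.
Notation V := 'rV[R]_d.
Implicit Types (x : V) (l m : nat).

Lemma iter_partial_eq (f g : V -> R) s x : (forall y, y != 0 -> f y = g y) -> x != 0 ->
  iter_partial s f x = iter_partial s g x.
Proof.
move=> fg; elim: s x => [|i s IH] x x0 /=; first exact: fg.
apply: near_eq_derive; near=> y; apply: IH; near: y; exact: near_neq0.
Unshelve. all: by end_near.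
Qed.

Definition hmpoly l (c : {ffun 'I_d -> 'I_l.+1} -> R) : mpoly d R :=
  \sum_(a : {ffun 'I_d -> 'I_l.+1} | (\sum_(i < d) (a i : nat) == l)%N)
    c a *: mpolyX R (Multinom [tuple (a i : nat) | i < d]).

Lemma pev_hmpoly l (c : {ffun 'I_d -> 'I_l.+1} -> R) : pev (hmpoly c) = hpoly c.
Proof.
apply/funext => x; rewrite /pev /hmpoly raddf_sum/=; apply: eq_bigr => a _.
rewrite mevalZ mevalX; congr (_ * _); apply: eq_bigr => i _.
by rewrite mnm_tnth tnth_mktuple.
Qed.

Lemma hharm_hmpoly l (c : {ffun 'I_d -> 'I_l.+1} -> R) : Defs.harmonic (hpoly c) -> hharm l (hmpoly c).
Proof.
move=> hc; split.
  apply/mpolyP => m; rewrite mcoeff_euler mcoeffZ.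
  have [->//|ml] := eqVneq (mdeg m) l.
  rewrite (_ : mcoeff m (hmpoly c) = 0) ?mulr0// /hmpoly -big_filter mcoeff_sum big_filter big1// => a al.
  rewrite mcoeffZ mcoeffX; case: eqP => [am|_]; last by rewrite mulr0.
  exfalso; move/eqP: ml; apply; rewrite -am mdegE; apply: etrans (eqP al); apply: eq_bigr => i _.
  by rewrite mnm_tnth tnth_mktuple.
apply: pev_eq0 => x; rewrite -[RHS](hc x) -pev_hmpoly /mlap /pev raddf_sum/=; apply: eq_bigr => i _.
rewrite (_ : (fun y => _) = pev (mderiv i (hmpoly c))); last first.
  by apply/funext => y; have [_ ->] := grad_at_partial i (grad_at_pev (hmpoly c) y).
by have [_ ->] := grad_at_partial i (grad_at_pev (mderiv i (hmpoly c)) x).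
Qed.

Lemma hpolyZ l (c : {ffun 'I_d -> 'I_l.+1} -> R) (t : R) x : hpoly c (t *: x) = t ^+ l * hpoly c x.
Proof.
rewrite /hpoly mulr_sumr; apply: eq_bigr => a /eqP al; rewrite mulrCA; congr (_ * _).
rewrite -[X in t ^+ X]al -prodrXr -big_split/=; apply: eq_bigr => i _.
by rewrite mxE exprMn.
Qed.

Definition zero_homog (f : V -> R) x : R := f ((eucl x)^-1 *: x).

Variable S : nat -> nat -> V -> R.
Hypothesis HS : sph_harm_basis S.
Hypothesis e0 : (0 < e)%N.

Lemma sph_polys l : exists p : 'I_(hdim l d) -> mpoly d R,
  [/\ forall a, hharm l (p a), forall a b, poly_int (p a * p b) = (a == b)%:R,
      forall (a : 'I_(hdim l d)) x, sphere x -> S l a.+1 x = pev (p a) x &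
      forall (a : 'I_(hdim l d)) x, x != 0 -> zero_homog (S l a.+1) x = hvec l p a x].
Proof.
have [H1 H2] := HS.
have ex (a : 'I_(hdim l d)) : exists c : {ffun 'I_d -> 'I_l.+1} -> R,
    Defs.harmonic (hpoly c) /\ forall x, sphere x -> S l a.+1 x = hpoly c x.
  by apply: H1; rewrite ltn_ord.
have [c cP] := choice ex.
pose p a := hmpoly (c a).
have Sp a x : sphere x -> S l (val a).+1 x = pev (p a) x.
  by move=> x1; rewrite pev_hmpoly; have [_ ->] := cP a.
exists p; split => //.
- by move=> a; apply: hharm_hmpoly; have [] := cP a.
- move=> a b; have := H2 l a.+1 l b.+1; rewrite !ltn_ord eqxx => /(_ isT isT) /=.
  rewrite eqSS => <-; apply: eq_sphere_int => x x1.
  by rewrite !Sp// pevM.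
- move=> a x x0; rewrite /zero_homog Sp; last exact: sphere_normalize.
  rewrite pev_hmpoly hpolyZ -pev_hmpoly /hvec; congr (_ * _).
  rewrite /eucl -powR12_sqrt ?dotp_ge0// -powR_inv1 ?powR_ge0//.
  rewrite -powR_mulrn ?powR_ge0// -!powRrM; congr powR; by field.
Qed.

Lemma hdim_le l : (hdim l d <= 2 * l.+1 ^ e)%N.
Proof.
have B k : ('C(k + l, k) <= l.+1 ^ k)%N.
  elim: k => [|k IH]; first by rewrite bin0.
  rewrite -(leq_pmul2l (ltn0Sn k)) addSn -mul_bin_diag expnS mulnA leq_mul//.
  by rewrite mulnS mulSn; lia.
rewrite -size_low_mnms// /low_mnms size_cat size_map -cardE card_ord_partitions mul2n -addnn leq_add//.
case: l B => [//|n] B; rewrite size_map -cardE card_ord_partitions (leq_trans _ (B e))//.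
by rewrite leq_bin2l// leq_add2l.
Qed.

(** Integrating the constant sum of squares gives [hdim l d] by orthonormality, so [c] is the
    inverse of the area of the sphere. The area itself is not computed: degree 0 shows that it is
    positive. *)
Lemma sph_sum_sqr : exists2 c : R, 0 <= c & forall l x, x != 0 ->
  \sum_(1 <= m < (hdim l d).+1) zero_homog (S l m) x ^+ 2 = (hdim l d)%:R * c.
Proof.
pose I1 : R := sphere_int (fun _ : V => 1).
pose x1 : V := evec R ord0.
have x1s : sphere x1.
  rewrite /sphere /= /dotp (bigD1 ord0)//= mxE !eqxx mulr1 big1 ?addr0// => j j0.
  by rewrite mxE (negbTE j0) andbF mul0r.
have H l : exists2 cl : R, (forall x, x != 0 -> \sum_(1 <= m < (hdim l d).+1) zero_homog (S l m) x ^+ 2 = cl) &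
    cl * I1 = (hdim l d)%:R.
  have [p [hp op Sp Zp]] := sph_polys l.
  have [A [AT AA AL]] := plane_derive_matrix (size_low_mnms l e0) hp op.
  exists (\sum_a hvec l p a x1 ^+ 2).
    move=> x x0; rewrite big_add1 big_mkord; under eq_bigr => a _ do rewrite Zp//.
    by apply: (hvec_sum_const hp AT AL) => //; exact: sphere_neq0.
  rewrite -sphere_intZ; last exact: sphere_reg_cst.
  transitivity (poly_int (\sum_a p a * p a)).
    apply: eq_sphere_int => x xs; rewrite mulr1.
    rewrite (hvec_sum_const hp AT AL (sphere_neq0 x1s) (sphere_neq0 xs)).
    rewrite /pev raddf_sum/=; apply: eq_bigr => a _.
    by rewrite -Zp ?sphere_neq0// /zero_homog sphere_eucl// invr1 scale1r Sp// mevalM expr2.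
  rewrite poly_int_sum; under eq_bigr do rewrite op eqxx.
  by rewrite sumr_const card_ord.
have h0 : (hdim 0 d)%:R = 1 :> R.
  by rewrite -size_low_mnms// /low_mnms size_cat size_map -cardE card_ord_partitions !addn0 binn.
have I10 : I1 != 0.
  have [cl _] := H 0%N; apply: contra_eq_neq => ->.
  by rewrite mulr0 h0 eq_sym oner_eq0.
exists I1^-1.
  have [cl cE clI] := H 0%N; rewrite invr_ge0 ltW// lt_neqAle eq_sym I10 /=.
  have cl0 : 0 <= cl by rewrite -(cE x1 (sphere_neq0 x1s)); apply: sumr_ge0 => m _; exact: sqr_ge0.
  rewrite leNgt; apply/negP => I1n; have : cl * I1 <= 0 by rewrite mulr_ge0_le0// ltW.
  by rewrite clI h0 leNgt ltr01.
move=> l x x0; have [cl -> // <-] := H l.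
by rewrite mulfK.
Qed.

(** The exponent [e] comes from the dimension, and 2 per derivative from the eigenvalue. The shell
    is this wide because grid points near the shell from 1/2 to 2, and the segments to them, may
    leave the latter. *)
Lemma sph_deriv_bound s : exists2 C : R, 0 <= C & forall l x, 4^-1 <= eucl x <= 4 ->
  \sum_(1 <= m < (hdim l d).+1) iter_partial s (zero_homog (S l m)) x ^+ 2 <=
    C * l.+1%:R ^+ (e + 2 * size s).
Proof.
have [c c0 cE] := sph_sum_sqr.
have [K K0 KP] : exists2 K : R, 0 <= K & forall x, 4^-1 <= eucl x <= 4 ->
    all (fun cw => `|ceval cw.1 x| <= K) (deriv_ops R s).
  elim: (deriv_ops R s) => [|cw L [K K0 KP]]; first by exists 0.
  have [K1 K10 KP1] := @ceval_bounded R d cw.1 4^-1 4 (ltac:(by rewrite invr_gt0)).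
  exists (Num.max K K1); first by rewrite le_max K0.
  move=> x xx /=; rewrite le_max KP1// orbT/=.
  by apply: sub_all (KP x xx) => cw' /= /le_trans; apply; rewrite le_max lexx.
exists ((size (deriv_ops R s))%:R ^+ 2 * K ^+ 2 * (1 + 2 * d%:R) ^+ size s * (2 * c)).
  by rewrite !mulr_ge0 ?exprn_ge0 ?addr_ge0 ?mulr_ge0.
move=> l x xx; have x0 : x != 0.
  apply: contraTneq xx => ->; rewrite /eucl (_ : dotp (0 : V) 0 = 0).
    by rewrite sqrtr0 leNgt invr_gt0 ltr0n.
  by apply/eqP; rewrite dotp_eq0.
have [p [hp op Sp Zp]] := sph_polys l.
have [A [AT AA AL]] := plane_derive_matrix (size_low_mnms l e0) hp op.
rewrite big_add1 big_mkord.
have E a : iter_partial s (zero_homog (S l (val a).+1)) x = iter_partial s (hvec l p a) x.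
  by apply: iter_partial_eq => // y y0; exact: Zp.
under eq_bigr do rewrite E.
set lam := 2 * _ in AA; have lam0 : 0 <= lam.
  by rewrite /lam !mulr_ge0// -natrD subr_ge0 ler_nat addnS ltnS addnS.
apply: (le_trans (hvec_deriv_bound hp AT AA AL lam0 x0 (KP x xx))).
have -> : \sum_a hvec l p a x ^+ 2 = (hdim l d)%:R * c.
  rewrite -(cE l x x0) big_add1 big_mkord; by apply: eq_bigr => a _; rewrite Zp.
have hl : (hdim l d)%:R <= 2 * l.+1%:R ^+ e :> R.
  by rewrite -natrX -natrM ler_nat hdim_le.
have L0 : 0 <= l%:R :> R by [].
have E0 : 0 <= e%:R :> R by [].
have dE : d%:R = e%:R + 2 :> R by rewrite -[d]addn2 natrD.
have LE : l.+1%:R = l%:R + 1 :> R by rewrite natr1.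
have lb : (1 + lam) ^+ size s <= (1 + 2 * d%:R) ^+ size s * l.+1%:R ^+ (2 * size s).
  have A0 : 0 <= 1 + lam by rewrite addr_ge0.
  have D0 : 0 <= 1 + 2 * d%:R :> R by rewrite dE; lra.
  have B0 : 0 <= (1 + 2 * d%:R) * l.+1%:R ^+ 2 :> R by rewrite mulr_ge0// sqr_ge0.
  rewrite exprM -exprMn; apply: lerXn2r; rewrite ?nnegrE//.
  rewrite /lam dE LE; have : 0 <= l%:R * e%:R :> R by rewrite mulr_ge0.
  have : 0 <= l%:R * (l%:R * e%:R) :> R by rewrite !mulr_ge0.
  nra.
rewrite exprD [leRHS](_ : _ = (size (deriv_ops R s))%:R ^+ 2 * K ^+ 2 *
  ((1 + 2 * d%:R) ^+ size s * l.+1%:R ^+ (2 * size s)) * ((2 * l.+1%:R ^+ e) * c)); last by ring.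
apply: ler_pM; rewrite ?mulr_ge0 ?exprn_ge0 ?addr_ge0//.
  by apply: ler_wpM2l; rewrite ?mulr_ge0 ?exprn_ge0.
exact: ler_wpM2r.
Qed.

Lemma sph_grad s l m x : (1 <= m <= hdim l d)%N -> x != 0 ->
  grad_at (iter_partial s (zero_homog (S l m))) (fun i => iter_partial (i :: s) (zero_homog (S l m)) x) x.
Proof.
move=> /andP[m1 mh] x0; have [p [hp op Sp Zp]] := sph_polys l.
have [A [AT AA AL]] := plane_derive_matrix (size_low_mnms l e0) hp op.
have am : (m.-1 < hdim l d)%N by rewrite prednK.
have E y s' : y != 0 -> iter_partial s' (hvec l p (Ordinal am)) y = iter_partial s' (zero_homog (S l m)) y.
  by move=> y0; apply: iter_partial_eq => // z z0; rewrite -Zp//= prednK.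
have G := grad_iter_partial_hvec hp AL s (Ordinal am) x0.
apply: (grad_at_ext (df := fun i => iter_partial (i :: s) (hvec l p (Ordinal am)) x)) => [i|]; first exact: E.
apply: grad_at_near G; near=> y; apply: E; near: y; exact: near_neq0.
Unshelve. all: by end_near.
Qed.

End SphericalHarmonics.

(** * Gaussian moments and independence *)

Section GaussianMoments.
Variable R : realType.
Implicit Types (u v V y : R) (f g : R -> R) (p : nat).

(** Up to sign, the remainder of order [p] of the Taylor expansion of [exp (- y)]. *)
Fixpoint exp_rem p y : R := if p is q.+1 then y ^+ q / q`!%:R - exp_rem q y else expR (- y).

Lemma is_derive_pow_fact p y :
  is_derive y 1 (fun z : R => z ^+ p.+1 / p.+1`!%:R) (y ^+ p / p`!%:R).
Proof.
have := is_deriveM (is_deriveX p.+1 (is_derive_id y (1 : R))) (is_derive_cst (p.+1`!%:R^-1 : R) y 1).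
rewrite (_ : (fun z : R => _) = (@id R ^+ p.+1 * cst (p.+1`!%:R^-1)) :> (R -> R)); last first.
  by rewrite mulrfctE exprfctE.
move=> H; apply: (is_derive_eq H); rewrite scaler0 add0r /= [_ *: _]mulrC [_%:A]mulr1.
have f0 : p`!%:R != 0 :> R by rewrite pnatr_eq0 -lt0n fact_gt0.
have p0 : p.+1%:R != 0 :> R by rewrite pnatr_eq0.
by rewrite factS natrM invfM [p.+1%:R * _]mulrC -mulrA [_ * (_ / _)]mulrA mulfV// mul1r.
Qed.

Lemma is_derive_exp_rem p y : is_derive y 1 (exp_rem p.+1) (exp_rem p y).
Proof.
elim: p y => [|p IH] y /=.
  have D1 : is_derive y 1 (fun z : R => expR (- z)) (- expR (- y)).
    have DN : is_derive y 1 (fun z : R => - z) (-1) by apply: is_deriveN.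
    apply: (is_derive_eq (is_derive1_comp (is_derive_expR (- y)) DN)).
    by rewrite mulrN1.
  rewrite (_ : (fun z => _) = cst 1 - (fun z : R => expR (- z))); last first.
    by apply/funext => z; rewrite expr0 fact0 divr1.
  apply: (is_derive_eq (is_deriveB (is_derive_cst (1 : R) y 1) D1)).
  by rewrite sub0r opprK.
exact: (is_deriveB (is_derive_pow_fact p y) (IH y)).
Qed.

(** For [p > 0] the remainder vanishes at 0 and its derivative is the previous remainder, so the
    mean value theorem propagates the sign. *)
Lemma exp_rem_ge0 p y : 0 <= y -> 0 <= exp_rem p y.
Proof.
elim: p y => [|p IH] y y0; first exact: expR_ge0.
have E0 : exp_rem p.+1 0 = 0.
  elim: {IH} p => [|p IH]; first by rewrite /= expr0 fact0 divr1 oppr0 expR0 subrr.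
  by rewrite -[LHS]/(0 ^+ p.+1 / p.+1`!%:R - exp_rem p.+1 0) IH expr0n mul0r subrr.
have [||c c0 E] := @MVT_segment R (exp_rem p.+1) (exp_rem p) 0 y y0.
- by move=> z _; exact: is_derive_exp_rem.
- apply: derivable_within_continuous => z _; by have [] := is_derive_exp_rem p z.
- move: E; rewrite E0 !subr0 => ->; rewrite mulr_ge0// IH//.
  by move: c0; rewrite in_itv/= => /andP[].
Qed.

Lemma exp_rem_le p y : 0 <= y -> exp_rem p y <= y ^+ p / p`!%:R.
Proof. by move=> y0; rewrite -subr_ge0; exact: (exp_rem_ge0 p.+1 y0). Qed.

Lemma expRN_exp_rem p y :
  expR (- y) = (-1) ^+ p * exp_rem p y + \sum_(i < p) (-1) ^+ i * (y ^+ i / i`!%:R).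
Proof.
elim: p => [|p IH]; first by rewrite big_ord0 addr0 expr0 mul1r.
by rewrite IH big_ord_recr/= exprS; ring.
Qed.

(** On [v |-> cos (v y)] it is multiplication by [2 - 2 cos (u y)]; iterated on a characteristic
    function it yields moments of [2 - 2 cos (u Y)]. *)
Definition second_diff u f v := 2 * f v - f (v + u) - f (v - u).

Lemma second_diff_poly u (q : {poly R}) : exists2 q' : {poly R}, (size q' <= size q - 2)%N &
  forall v, second_diff u (horner q) v = q'.[v].
Proof.
(* The first symmetric difference is carried along because it enters the second difference of
   [q * 'X]. *)
suff [q1 [q2 [_ s2 _ E2]]] : exists q1 q2 : {poly R}, [/\ (size q1 <= size q - 1)%N,
    (size q2 <= size q - 2)%N, (forall v, q.[v + u] - q.[v - u] = q1.[v]) &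
    forall v, second_diff u (horner q) v = q2.[v]] by exists q2.
elim/poly_ind: q => [|q c [q1 [q2 [s1 s2 E1 E2]]]].
  exists 0, 0; rewrite !size_poly0; split=> // v; rewrite /second_diff !horner0; ring.
have [->|q0] := eqVneq q 0.
  exists 0, 0; rewrite !size_poly0; split=> // v; rewrite /second_diff mul0r add0r !hornerC; ring.
have sq : size (q * 'X + c%:P) = (size q).+1 by rewrite size_MXaddC (negPf q0).
have q0' : (0 < size q)%N by rewrite size_poly_gt0.
have sX (r : {poly R}) n : (size r <= n)%N -> (size (r * 'X)%R <= n.+1)%N.
  move=> rn; have [->|r0] := eqVneq r 0; first by rewrite mul0r size_poly0.
  by rewrite size_mulX.
exists (q1 * 'X + u *: (2 *: q - q2)), (q2 * 'X - u *: q1); split.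
- rewrite sq (leq_trans (size_polyD _ _))// geq_max; apply/andP; split.
    by have := sX _ _ s1; lia.
  rewrite (leq_trans (size_scale_leq _ _))// (leq_trans (size_polyD _ _))// geq_max size_polyN.
  by rewrite subn1 size_scale_leq/= (leq_trans s2)// leq_subr.
- rewrite sq (leq_trans (size_polyD _ _))// geq_max size_polyN; apply/andP; split.
    have [sq1|sq1] := leqP (size q) 1; last by have := sX _ _ s2; lia.
    have -> : q2 = 0 by apply/eqP; rewrite -size_poly_eq0; lia.
    by rewrite mul0r size_poly0.
  by rewrite subSS (leq_trans (size_scale_leq _ _)).
- move=> v; have := E1 v; have := E2 v; rewrite /second_diff !hornerE => <- <-; ring.
- move=> v; have := E1 v; have := E2 v; rewrite /second_diff !hornerE => <- <-; ring.
Qed.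

Lemma iter_second_diff_poly u (q : {poly R}) n : (size q <= 2 * n)%N ->
  forall v, iter n (second_diff u) (horner q) v = 0.
Proof.
elim: n q => [|n IH] q sq v.
  by move: sq; rewrite muln0 => /size_poly_leq0P ->; rewrite /= horner0.
rewrite iterSr; have [q' sq' qE] := second_diff_poly u q.
rewrite (_ : second_diff u (horner q) = horner q'); last by apply/funext => w; rewrite qE.
by apply: IH; rewrite (leq_trans sq')// leq_subLR; move: sq; lia.
Qed.

Lemma iter_second_diff_bound u f (B M : R) n : 0 <= u -> (forall v, `|v| <= M + n%:R * u -> `|f v| <= B) ->
  forall v, `|v| <= M -> `|iter n (second_diff u) f v| <= 4 ^+ n * B.
Proof.
move=> u0; elim: n M => [|n IH] M fB v vM; first by rewrite /= expr0 mul1r fB// mul0r addr0.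
have H w : `|w| <= M + u -> `|iter n (second_diff u) f w| <= 4 ^+ n * B.
  apply: IH => z zM; apply: fB; rewrite (le_trans zM)// -natr1; lra.
have h0 : `|iter n (second_diff u) f v| <= 4 ^+ n * B by apply: H; rewrite (le_trans vM)// lerDl.
have h1 : `|iter n (second_diff u) f (v + u)| <= 4 ^+ n * B.
  by apply: H; rewrite (le_trans (ler_normD _ _))// (ger0_norm u0) lerD2r.
have h2 : `|iter n (second_diff u) f (v - u)| <= 4 ^+ n * B.
  by apply: H; rewrite (le_trans (ler_normB _ _))// (ger0_norm u0) lerD2r.
rewrite iterS /second_diff exprS; move: h0 h1 h2; rewrite !ler_norml; lra.
Qed.

Lemma iter_second_diffD u f g n v : iter n (second_diff u) (fun w => f w + g w) v =
  iter n (second_diff u) f v + iter n (second_diff u) g v.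
Proof.
elim: n v => [//|n IH] v; rewrite !iterS /second_diff !IH; ring.
Qed.

(** The [p] second differences kill the Taylor polynomial of degree below [2p] in [v]. The remainder
    is at most [((p u)^2 V / 2)^p / p!] for [|v| <= p u], and each difference costs a factor 4. *)
Lemma gauss_second_diff u V p : 0 <= u -> 0 <= V ->
  iter p (second_diff u) (fun v => expR (- (v ^+ 2 * V) / 2)) 0 <=
    (2 * p%:R ^+ 2 * V) ^+ p / p`!%:R * u ^+ (2 * p).
Proof.
move=> u0 V0.
pose q : {poly R} := \sum_(i < p) ((-1) ^+ i * ((V / 2) ^+ i / i`!%:R)) *: 'X^(2 * i).
pose r v := (-1) ^+ p * exp_rem p (v ^+ 2 * V / 2).
have E v : expR (- (v ^+ 2 * V) / 2) = q.[v] + r v.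
  rewrite mulNr (expRN_exp_rem p) addrC /r; congr (_ + _).
  rewrite /q horner_sum; apply: eq_bigr => i _.
  by rewrite hornerZ hornerXn exprM -(mulrA (v ^+ 2)) exprMn; ring.
rewrite (_ : (fun v => _) = fun v => q.[v] + r v); last by apply/funext => v; exact: E.
rewrite iter_second_diffD iter_second_diff_poly ?add0r; last first.
  rewrite /q (leq_trans (size_sum _ _ _))//; apply/bigmax_leqP => i _.
  by rewrite (leq_trans (size_scale_leq _ _))// size_polyXn; have := ltn_ord i; lia.
pose B := ((p%:R * u) ^+ 2 * V / 2) ^+ p / p`!%:R.
have rB v : `|v| <= 0 + p%:R * u -> `|r v| <= B.
  rewrite add0r => vp; have y0 : 0 <= v ^+ 2 * V / 2 by rewrite divr_ge0// mulr_ge0// sqr_ge0.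
  rewrite /r normrM normrX normrN1 expr1n mul1r ger0_norm ?exp_rem_ge0//.
  rewrite (le_trans (exp_rem_le p y0))// /B ler_wpM2r// lerXn2r ?nnegrE ?divr_ge0 ?(mulr_ge0 _ V0) ?sqr_ge0//.
  rewrite !ler_wpM2r// -real_normK ?num_real// lerXn2r ?nnegrE// mulr_ge0//.
rewrite (le_trans (ler_norm _))//.
have := @iter_second_diff_bound u r B 0 p u0 rB 0; rewrite normr0 => /(_ (lexx _))/le_trans; apply.
rewrite le_eqVlt; apply/orP; left; apply/eqP.
rewrite /B exprM mulrA [in RHS]mulrAC -!exprMn; congr (_ ^+ _ / _).
by field.
Qed.

End GaussianMoments.

(** * Bounded random variables and their means *)

Section BoundedVariables.
Variables (R : realType) (dT : measure_display) (Om : measurableType dT) (P : probability Om R).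
Implicit Types (f g : Om -> R) (c : R).

Definition bounded_rv f := measurable_fun setT f /\ exists C, forall w, `|f w| <= C.
Definition mean f : R := Rintegral P setT f.

Lemma bounded_rv_integrable f : bounded_rv f -> P.-integrable setT (EFin \o f).
Proof.
move=> [mf [C fC]]; apply: measurable_bounded_integrable => //.
  by rewrite (le_lt_trans (probability_le1 _ _))// ltry.
exists C; split; first by rewrite num_real.
by move=> x Cx w _ /=; rewrite (le_trans (fC w))// ltW.
Qed.

Lemma bounded_rv_cst c : bounded_rv (fun=> c).
Proof. by split; [exact: measurable_cst|exists `|c|]. Qed.

Lemma bounded_rvD f g : bounded_rv f -> bounded_rv g -> bounded_rv (fun w => f w + g w).
Proof.
move=> [mf [C fC]] [mg [D gD]]; split; first exact: measurable_funD.
by exists (C + D) => w; rewrite (le_trans (ler_normD _ _))// lerD.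
Qed.

Lemma bounded_rvM f g : bounded_rv f -> bounded_rv g -> bounded_rv (fun w => f w * g w).
Proof.
move=> [mf [C fC]] [mg [D gD]]; split; first exact: measurable_funM.
by exists (C * D) => w; rewrite normrM ler_pM.
Qed.

Lemma bounded_rvZ c f : bounded_rv f -> bounded_rv (fun w => c * f w).
Proof. by move=> bf; apply: bounded_rvM => //; exact: bounded_rv_cst. Qed.

Lemma bounded_rvB f g : bounded_rv f -> bounded_rv g -> bounded_rv (fun w => f w - g w).
Proof.
move=> bf /(bounded_rvZ (-1)) bg; have := bounded_rvD bf bg.
by under eq_fun do rewrite mulN1r.
Qed.

Lemma bounded_rv_sum (I : Type) (s : seq I) (F : I -> Om -> R) :
  (forall i, bounded_rv (F i)) -> bounded_rv (fun w => \sum_(i <- s) F i w).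
Proof.
move=> bF; elim: s => [|i s IH].
  by under eq_fun do rewrite big_nil; exact: bounded_rv_cst.
by under eq_fun do rewrite big_cons; exact: bounded_rvD.
Qed.

Lemma bounded_rv_prod (I : eqType) (s : seq I) (F : I -> Om -> R) :
  {in s, forall i, bounded_rv (F i)} -> bounded_rv (fun w => \prod_(i <- s) F i w).
Proof.
elim: s => [|i s IH] bF.
  by under eq_fun do rewrite big_nil; exact: bounded_rv_cst.
under eq_fun do rewrite big_cons; apply: bounded_rvM; first exact/bF/mem_head.
by apply: IH => j js; apply: bF; rewrite inE js orbT.
Qed.

Lemma bounded_rvX n f : bounded_rv f -> bounded_rv (fun w => f w ^+ n).
Proof.
move=> bf; elim: n => [|n IH]; first by under eq_fun do rewrite expr0; exact: bounded_rv_cst.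
by under eq_fun do rewrite exprS; exact: bounded_rvM.
Qed.

Lemma bounded_rv_cos f : measurable_fun setT f -> bounded_rv (fun w => cos (f w)).
Proof.
move=> mf; split; last by exists 1 => w; rewrite ler_norml cos_geN1 cos_le1.
by apply: (measurableT_comp _ mf); apply: continuous_measurable_fun; exact: continuous_cos.
Qed.

Lemma bounded_rv_sin f : measurable_fun setT f -> bounded_rv (fun w => sin (f w)).
Proof.
move=> mf; split; last by exists 1 => w; rewrite ler_norml sin_geN1 sin_le1.
by apply: (measurableT_comp _ mf); apply: continuous_measurable_fun; exact: continuous_sin.
Qed.

Lemma bounded_rv_indic (A : set Om) : measurable A -> bounded_rv (\1_A : Om -> R).
Proof.
move=> mA; split; first exact: measurable_indic.
by exists 1 => w; rewrite indicE; case: (_ \in _); rewrite ?normr1 ?normr0.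
Qed.

Lemma mean_cst c : mean (fun=> c) = c.
Proof.
rewrite /mean Rintegral_cst// -[RHS]mulr1; congr (_ * _).
exact: (congr1 fine (probability_setT P)).
Qed.

Lemma meanD f g : bounded_rv f -> bounded_rv g -> mean (fun w => f w + g w) = mean f + mean g.
Proof. by move=> bf bg; rewrite /mean RintegralD//; exact: bounded_rv_integrable. Qed.

Lemma meanB f g : bounded_rv f -> bounded_rv g -> mean (fun w => f w - g w) = mean f - mean g.
Proof. by move=> bf bg; rewrite /mean RintegralB//; exact: bounded_rv_integrable. Qed.

Lemma meanZ c f : bounded_rv f -> mean (fun w => c * f w) = c * mean f.
Proof. by move=> bf; rewrite /mean RintegralZl//; exact: bounded_rv_integrable. Qed.

Lemma mean_sum (I : Type) (s : seq I) (F : I -> Om -> R) : (forall i, bounded_rv (F i)) ->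
  mean (fun w => \sum_(i <- s) F i w) = \sum_(i <- s) mean (F i).
Proof.
move=> bF; elim: s => [|i s IH].
  by rewrite big_nil; under eq_fun do rewrite big_nil; rewrite mean_cst.
rewrite big_cons -IH -meanD//; last exact: bounded_rv_sum.
by congr mean; apply/funext => w; rewrite big_cons.
Qed.

Lemma mean_norm_le f c : bounded_rv f -> (forall w, `|f w| <= c) -> `|mean f| <= c.
Proof.
move=> bf fc; have bn : bounded_rv (fun w => `|f w|).
  by split; [exact: measurableT_comp bf.1|exists c => w; rewrite normr_id].
rewrite (le_trans (le_normr_Rintegral _ _))//; first exact: bounded_rv_integrable.
rewrite -[leRHS]mean_cst le_Rintegral//; apply: bounded_rv_integrable => //; exact: bounded_rv_cst.
Qed.

Lemma mean_indic (A : set Om) : measurable A -> mean (\1_A) = fine (P A).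
Proof. by move=> mA; rewrite /mean /Rintegral integral_indic// setIT. Qed.

Lemma expectation_mean f : bounded_rv f -> ('E_P[f])%E = (mean f)%:E.
Proof.
move=> bf; rewrite unlock /mean /Rintegral fineK//.
exact: integrable_fin_num (bounded_rv_integrable bf).
Qed.

Lemma integral_mean f : bounded_rv f -> (\int[P]_w (f w)%:E = (mean f)%:E)%E.
Proof. by move=> bf; rewrite -expectation_mean// unlock. Qed.

End BoundedVariables.
Arguments bounded_rv_cst {R dT Om} c.

Lemma limn_einf_le (R : realType) (u : nat -> \bar R) (c : \bar R) :
  (forall n, (u n <= c)%E) -> (limn_einf u <= c)%E.
Proof.
move=> uc; rewrite limn_einf_lim; apply: lime_le; first exact: is_cvg_einfs.
by apply: nearW => n; rewrite (le_trans _ (uc n))// ereal_inf_lbound//; exists n => /=.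
Qed.

(** * Even moments from the characteristic function *)

Section GaussianMoment.
Variables (R : realType) (dT : measure_display) (Om : measurableType dT) (P : probability Om R).
Variables (Y : Om -> R) (V : R).
Hypothesis mY : measurable_fun setT Y.
Hypothesis V0 : 0 <= V.
Hypothesis charY : forall u, mean P (fun w => cos (u * Y w)) = expR (- (u ^+ 2 * V) / 2).

Lemma bounded_rv_cosM u : bounded_rv (fun w => cos (u * Y w)).
Proof. by apply: bounded_rv_cos; apply: measurable_funM => //; exact: measurable_cst. Qed.

Lemma bounded_rv_cosX u p : bounded_rv (fun w => (2 - 2 * cos (u * Y w)) ^+ p).
Proof.
apply: bounded_rvX; apply: bounded_rvB; first exact: bounded_rv_cst.
exact/bounded_rvZ/bounded_rv_cosM.
Qed.

Lemma mean_second_diff u p v : mean P (fun w => (2 - 2 * cos (u * Y w)) ^+ p * cos (v * Y w)) =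
  iter p (second_diff u) (fun v => expR (- (v ^+ 2 * V) / 2)) v.
Proof.
elim: p v => [|p IH] v; first by rewrite /= -charY; congr mean; apply/funext => w; rewrite expr0 mul1r.
have b v' : bounded_rv (fun w => (2 - 2 * cos (u * Y w)) ^+ p * cos (v' * Y w)).
  exact: bounded_rvM (bounded_rv_cosX _ _) (bounded_rv_cosM _).
rewrite iterS /second_diff -!IH -meanZ// -!meanB//; last first.
- exact: bounded_rvZ.
- by apply: bounded_rvB => //; exact: bounded_rvZ.
congr mean; apply/funext => w; rewrite [(v + u) * _]mulrDl [(v - u) * _]mulrBl cosB cosD exprS; ring.
Qed.

Lemma cvg_sin_scaled (y : R) : (fun n : nat => sin (n.+1%:R^-1 * y) / n.+1%:R^-1) @ \oo --> y.
Proof.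
have D : is_derive (0 : R) 1 (fun h : R => sin (h * y)) y.
  have D0 : is_derive (0 : R) 1 (fun h : R => h * y) y.
    have := is_deriveM (is_derive_id (0 : R) (1 : R)) (is_derive_cst y (0 : R) (1 : R)).
    by move=> H; apply: (is_derive_eq H); rewrite scaler0 add0r /cst [_ *: _]mulr1.
  apply: (is_derive_eq (is_derive1_comp (is_derive_sin _) D0)).
  by rewrite mul0r cos0 mul1r.
have [/cvg_ex[l hl] E] := D.
have ly : l = y by rewrite -E; apply/esym/cvg_lim.
rewrite {}ly in hl.
have H0 : (fun n : nat => n.+1%:R^-1 : R) @ \oo --> 0^'.
  move=> B; rewrite /dnbhs /within /= => nB; have [N _ HN] := @cvg_harmonic R _ nB.
  exists N => // n /HN /= Bn; apply: Bn; rewrite /sequences.harmonic.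
  by rewrite invr_neq0// pnatr_eq0.
have := cvg_comp _ _ H0 hl; apply: cvg_trans; apply: near_eq_cvg; near=> n.
by rewrite /= addr0 mul0r sin0 subr0 [_ *: 1]mulr1 [_ *: _]mulrC.
Unshelve. all: by end_near. Qed.

(** As [u] tends to 0, [(2 - 2 cos (u Y))^p / u^(2p)] tends to [Y^(2p)], while its mean is bounded
    uniformly in [u] by [gauss_second_diff]. Fatou's lemma concludes without prior integrability of
    [Y]. *)
Lemma gauss_moment p : (0 < p)%N ->
  (\int[P]_w (Y w ^+ (2 * p))%:E <= ((2 * p%:R ^+ 2 * V) ^+ p / p`!%:R)%:E)%E.
Proof.
move=> p0.
(* The factor 2 fits the half-angle formula [2 - 2 cos (2 s) = 4 sin^2 s], which leads to the
   quotient in [cvg_sin_scaled]. *)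
pose u n : R := 2 * n.+1%:R^-1.
pose F n w := ((2 - 2 * cos (u n * Y w)) ^+ p / u n ^+ (2 * p)).
have u0 n : 0 < u n by rewrite mulr_gt0// invr_gt0.
have bF n : bounded_rv (F n).
  exact: (bounded_rvM (bounded_rv_cosX (u n) p) (bounded_rv_cst _)).
have F0 n w : 0 <= F n w.
  by rewrite divr_ge0 ?exprn_ge0 ?(ltW (u0 n))// subr_ge0 ler_piMr// cos_le1.
have mF n : (\int[P]_w (F n w)%:E <= ((2 * p%:R ^+ 2 * V) ^+ p / p`!%:R)%:E)%E.
  rewrite integral_mean// lee_fin.
  have -> : mean P (F n) = (u n ^+ (2 * p))^-1 * mean P (fun w => (2 - 2 * cos (u n * Y w)) ^+ p * cos (0 * Y w)).
    rewrite -meanZ; last first.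
      exact: bounded_rvM (bounded_rv_cosX _ _) (bounded_rv_cosM _).
    by congr mean; apply/funext => w; rewrite mul0r cos0 mulr1 mulrC.
  rewrite mean_second_diff ler_pdivrMl ?exprn_gt0// mulrC.
  exact: gauss_second_diff (ltW (u0 n)) V0.
have cF w : (fun n => (F n w)%:E) @ \oo --> (Y w ^+ (2 * p))%:E.
  apply: cvg_EFin; first by near=> n.
  rewrite (_ : fine \o _ = fun n => (sin (n.+1%:R^-1 * Y w) / n.+1%:R^-1) ^+ (2 * p)); last first.
    apply/funext => n /=; rewrite /F /u exprM [RHS]exprM -expr_div_n; congr (_ ^+ _).
    rewrite -mulrA (_ : 2 * (_ * _) = (n.+1%:R^-1 * Y w) *+ 2); last by rewrite mulr_natl.
    rewrite cos_mulr2n cos2sin2; have : n.+1%:R != 0 :> R by rewrite pnatr_eq0.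
    by move: (n.+1%:R) (sin _) => a b a0; field.
  apply: (@continuous_cvg _ _ _ _ _ _ (fun y : R => y ^+ (2 * p))); first exact: exprn_continuous.
  exact: cvg_sin_scaled.
have cY w : limn_einf (fun n => (F n w)%:E) = (Y w ^+ (2 * p))%:E.
  by have [-> _] := cvg_limn_einf_sup (cF w).
under eq_integral do rewrite -cY.
apply: (le_trans (fatou P measurableT _ _)) => [n|n w _|].
- exact/measurable_EFinP/(bF n).1.
- by rewrite lee_fin.
- exact: limn_einf_le.
Unshelve. all: by end_near. Qed.

End GaussianMoment.

Section StepApprox.
Variable R : realType.

Lemma count_le_floor (n : nat) (x : R) : 0 <= x <= n%:R ->
  x - 1 <= \sum_(i < n) ((i.+1%:R <= x)%R)%:R <= x.
Proof.
have full m (y : R) : m%:R <= y -> \sum_(i < m) ((i.+1%:R <= y)%R)%:R = m%:R :> R.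
  move=> my; under eq_bigr => i _.
    have -> : (i.+1%:R <= y) by rewrite (le_trans _ my)// ler_nat.
    over.
  by rewrite sumr_const card_ord.
elim: n => [|n IH] /andP[x0 xn]; first by rewrite big_ord0; apply/andP; split; lra.
have [xb|xb] := leP n.+1%:R x.
  have -> : x = n.+1%:R by apply/le_anti/andP.
  by rewrite full//; apply/andP; split; lra.
rewrite big_ord_recr/= [n.+1%:R <= x]leNgt xb/= addr0.
have [xc|xc] := leP x n%:R; first by apply: IH; rewrite x0.
by rewrite (full _ _ (ltW xc)) (ltW xc) andbT; move: xb; rewrite -natr1; lra.
Qed.

(** Layer-cake approximation: after rescaling [f] to a function [x] with values in [[0, n]], [x] is
    replaced by the number of superlevel sets [i + 1 <= x] that contain the point, with error at
    most 1. *)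
Lemma step_approx (dT : measure_display) (Om : measurableType dT) (f : Om -> R) (eps : R) :
  bounded_rv f -> 0 < eps -> exists (n : nat) (c0 c : R) (B : nat -> set Om),
    (forall i, measurable (B i)) /\
    forall w, `|f w - (c0 + c * \sum_(i <- iota 0 n) \1_(B i) w)| <= eps.
Proof.
move=> [mf [C fC]] e0.
pose C' := `|C| + 1; have C0 : 0 < C' by rewrite ltr_wpDl.
have fC' w : - C' <= f w <= C'.
  by rewrite -ler_norml (le_trans (fC w))// (le_trans (ler_norm _))// lerDl.
pose n := (Num.trunc (2 * C' / eps)).+1.
have nE : 2 * C' / n%:R <= eps.
  by rewrite ler_pdivrMr// [leRHS]mulrC -ler_pdivrMr// ltW// /n truncnS_gt.
pose x w := n%:R * (f w + C') / (2 * C').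
have n0 : n%:R != 0 :> R by rewrite pnatr_eq0.
exists n, (- C'), (2 * C' / n%:R), (fun i => [set w | i.+1%:R <= x w]); split.
  move=> i; rewrite (_ : [set w | _] = x @^-1` `[i.+1%:R, +oo[); last first.
    by apply/seteqP; split=> w /=; rewrite in_itv/= andbT.
  rewrite -[X in measurable X]setTI; apply: (_ : measurable_fun setT x) => //.
  apply: measurable_funM => //; apply: measurable_funM => //; exact: measurable_funD.
move=> w.
have -> : f w - (- C' + 2 * C' / n%:R * \sum_(i <- iota 0 n) \1_[set w | i.+1%:R <= x w] w)
  = 2 * C' / n%:R * (x w - \sum_(i < n) ((i.+1%:R <= x w)%R)%:R).
  rewrite -(big_mkord xpredT (fun i => ((i.+1%:R <= x w)%R)%:R)) /index_iota subn0.
  have -> : \sum_(i <- iota 0 n) \1_[set w | i.+1%:R <= x w] w = \sum_(i <- iota 0 n) ((i.+1%:R <= x w)%R)%:R :> R.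
    apply: eq_bigr => i _; rewrite indicE; congr (nat_of_bool _)%:R.
    by apply/idP/idP => [/set_mem//|h]; apply/mem_set.
  rewrite /x; move: (\sum_(i <- _) _) => S; field; rewrite n0/=; lra.
have x01 : 0 <= x w <= n%:R.
  have /andP[f1 f2] := fC' w; apply/andP; split.
    by rewrite divr_ge0// ?mulr_ge0//; lra.
  by rewrite ler_pdivrMr; [rewrite ler_wpM2l//; lra|lra].
have /andP[h1 h2] := count_le_floor x01.
have c0 : 0 <= 2 * C' / n%:R by rewrite divr_ge0//; lra.
rewrite normrM ger0_norm// (le_trans _ nE)// -[leRHS]mulr1 ler_wpM2l// ler_norml; apply/andP; split; lra.
Qed.

End StepApprox.

(** * Independence: from events to bounded functionals of the processes *)

Section Independence.
Variables (R : realType) (dT : measure_display) (Om : measurableType dT) (P : probability Om R).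
Variables (K : eqType) (J : set K) (T : R) (X : K -> R -> Om -> R).
Hypothesis mX : forall k t, J k -> 0 <= t <= T -> measurable_fun setT (X k t).
Hypothesis indX : indep_procs P T J X.

Definition gen_events (k : K) : set (set Om) :=
  [set A | exists t B, (0 <= t <= T) /\ measurable B /\ A = X k t @^-1` B].
Local Notation sigma k := (g_sigma_algebraType (gen_events k)).
(** The type ascription selects the sigma-algebra: [f] is a bounded functional of the process [X k]
    alone, over times in [[0, T]]. *)
Definition proc_rv (k : K) (f : Om -> R) := bounded_rv (f : sigma k -> R).

Lemma proc_events_measurable k A : J k -> proc_events T (X k) A -> measurable A.
Proof.
move=> Jk; apply: smallest_sub; first exact: sigma_algebra_measurable.
move=> _ [t [B [t0T [mB ->]]]]; rewrite -[X in measurable X]setTI.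
exact: (mX Jk t0T).
Qed.

Lemma proc_rv_bounded k f : J k -> proc_rv k f -> bounded_rv f.
Proof.
move=> Jk [mf [C fC]]; split; last by exists C.
by move=> _ B mB; apply: (proc_events_measurable Jk); exact: mf.
Qed.

Lemma mean_mul_ext k (G f : Om -> R) : J k -> bounded_rv G -> proc_rv k f ->
  (forall B, proc_events T (X k) B -> mean P (fun w => G w * \1_B w) = mean P G * mean P (\1_B)) ->
  mean P (fun w => G w * f w) = mean P G * mean P f.
Proof.
move=> Jk bG bf HB; have bf' := proc_rv_bounded Jk bf.
have [M GM] := bG.2.
apply/eqP; rewrite -subr_eq0 -normr_eq0 eq_le normr_ge0 andbT; apply/ler_addgt0Pr => e e0.
rewrite add0r.
(* Two error terms remain, each at most [(|M| + 1) * e'], that is half of [e]. *)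
pose e' := e / (2 * (`|M| + 1)).
have M1 : 0 < `|M| + 1 by rewrite ltr_wpDl.
have e'0 : 0 < e' by rewrite divr_gt0// mulr_gt0.
have [n [c0 [c [B [mB fB]]]]] := step_approx bf e'0.
have bB i : bounded_rv (\1_(B i) : Om -> R).
  by apply: bounded_rv_indic; exact: (proc_events_measurable Jk (mB i)).
pose S (w : Om) : R := \sum_(i <- iota 0 n) \1_(B i : set Om) w.
have bS : bounded_rv S by exact: bounded_rv_sum.
pose h w := c0 + c * S w.
have bh : bounded_rv h by apply: bounded_rvD (bounded_rv_cst _) (bounded_rvZ _ bS).
have Eh : mean P (fun w => G w * h w) = mean P G * mean P h.
  have -> : mean P (fun w => G w * h w) = mean P (fun w => c0 * G w + c * \sum_(i <- iota 0 n) G w * \1_(B i) w).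
    by congr mean; apply/funext => w; rewrite /h /S -mulr_sumr; ring.
  have bGS : bounded_rv (fun w => \sum_(i <- iota 0 n) G w * \1_(B i) w).
    by apply: bounded_rv_sum => i; exact: bounded_rvM.
  rewrite /h !meanD ?meanZ ?mean_cst ?mean_sum//; try exact: bounded_rvZ; try exact: bounded_rv_cst.
    have -> : \sum_(i <- iota 0 n) mean P (fun w => G w * \1_(B i) w) =
        mean P G * \sum_(i <- iota 0 n) mean P (\1_(B i)).
      by rewrite mulr_sumr; apply: eq_bigr => i _; rewrite HB//; exact: mB.
    by rewrite -/(mean P (\1_(B _))); ring.
  by move=> i; exact: bounded_rvM.
pose r w := f w - h w.
have br : bounded_rv r by exact: bounded_rvB.
have re w : `|r w| <= e' by exact: fB.
have -> : mean P (fun w => G w * f w) - mean P G * mean P f =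
  mean P (fun w => G w * r w) - mean P G * mean P r.
  have -> : mean P (fun w => G w * r w) = mean P (fun w => G w * f w) - mean P (fun w => G w * h w).
    rewrite -meanB; [|exact: bounded_rvM|exact: bounded_rvM].
    by congr mean; apply/funext => w; rewrite /r mulrBr.
  by rewrite /r meanB// Eh; ring.
have m1 : `|mean P (fun w => G w * r w)| <= (`|M| + 1) * e'.
  apply: mean_norm_le; first exact: bounded_rvM.
  move=> w; rewrite normrM ler_pM// (le_trans (GM w))// (le_trans (ler_norm _))// lerDl//.
have m2 : `|mean P G * mean P r| <= (`|M| + 1) * e'.
  rewrite normrM ler_pM//; apply: mean_norm_le => // w.
  by rewrite (le_trans (GM w))// (le_trans (ler_norm _))// lerDl.
rewrite (le_trans (ler_normB _ _))// (le_trans (lerD m1 m2))// /e' le_eqVlt; apply/orP; left; apply/eqP.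
by field; lra.
Qed.

Lemma prod_indic (s : seq K) (A : K -> set Om) w :
  \prod_(k <- s) \1_(A k) w = \1_(\bigcap_(k in [set k | k \in s]) A k) w :> R.
Proof.
rewrite indicE; elim: s => [|k s IH].
  by rewrite big_nil mem_set// => k /=.
rewrite big_cons IH indicE -natrM mulnb; congr (nat_of_bool _)%:R.
apply/andP/idP => [[/set_mem Ak /set_mem As]|/set_mem As].
  by apply/mem_set => j /=; rewrite inE => /orP[/eqP ->//|js]; exact: As.
split; apply/mem_set; first by apply: As => /=; exact: mem_head.
by move=> j js; apply: As => /=; rewrite inE js orbT.
Qed.

(** Independence is given for events; indicators are replaced by functionals one at a time. For the
    head [k] of [s1], the induction hypothesis with [k] moved to the list of events supplies what
    [mean_mul_ext] asks for. *)
Lemma mean_prod_indic (s1 s2 : seq K) (f : K -> Om -> R) (A : K -> set Om) :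
  uniq (s1 ++ s2) -> {subset s1 ++ s2 <= J} ->
  {in s1, forall k, proc_rv k (f k)} -> {in s2, forall k, proc_events T (X k) (A k)} ->
  mean P (fun w => \prod_(k <- s1) f k w * \prod_(k <- s2) \1_(A k) w) =
  \prod_(k <- s1) mean P (f k) * \prod_(k <- s2) mean P (\1_(A k)).
Proof.
elim: s1 s2 A => [|k s1 IH] s2 A us sJ bf pA.
  rewrite big_nil mul1r.
  have mA k : k \in s2 -> measurable (A k).
    by move=> ks; apply: (@proc_events_measurable k); [exact/set_mem/sJ|exact: pA].
  have mcap (s : seq K) : {subset s <= s2} -> measurable (\bigcap_(k in [set k | k \in s]) A k).
    elim: s => [|j s IHs] ss.
      rewrite (_ : \bigcap_(k in _) _ = setT)//; apply/seteqP; split=> // w _ k; by rewrite /= in_nil.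
    rewrite (_ : \bigcap_(k in _) _ = A j `&` \bigcap_(k in [set k | k \in s]) A k).
      apply: measurableI; first by apply: mA; exact/ss/mem_head.
      by apply: IHs => i si; apply: ss; rewrite inE si orbT.
    apply/seteqP; split=> w /= Aw; first by split=> [|i si]; apply: Aw; rewrite /= inE ?eqxx// si orbT.
    by move=> i; rewrite /= inE => /orP[/eqP ->|si]; [exact: Aw.1|exact: Aw.2].
  have -> : (fun w => \prod_(k <- [::]) f k w * \prod_(k <- s2) \1_(A k) w) =
      (\1_(\bigcap_(k in [set k | k \in s2]) A k) : Om -> R).
    by apply/funext => w; rewrite big_nil mul1r prod_indic.
  rewrite mean_indic; last exact: mcap.
  transitivity (fine (\prod_(k <- s2) P (A k))%E); first exact: (congr1 fine (indX us sJ pA)).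
  suff -> : (\prod_(k <- s2) P (A k) = (\prod_(k <- s2) mean P (\1_(A k)))%:E)%E by [].
  suff H s : {subset s <= s2} -> (\prod_(k <- s) P (A k) = (\prod_(k <- s) mean P (\1_(A k)))%:E)%E.
    exact: H.
  elim: s => [|j s IHs] ss; first by rewrite !big_nil.
  have mj : measurable (A j) by apply: mA; exact/ss/mem_head.
  rewrite !big_cons EFinM mean_indic// fineK ?fin_num_measure// IHs// => i is_.
  by apply: ss; rewrite inE is_ orbT.
have Jk : J k by apply/set_mem/sJ; exact: mem_head.
pose G w := \prod_(k <- s1) f k w * \prod_(k <- s2) \1_(A k) w.
have inJ j : j \in s1 ++ s2 -> J j by move=> js; apply/set_mem/sJ; rewrite inE js orbT.
have bG : bounded_rv G.
  apply: bounded_rvM; apply: bounded_rv_prod => j js.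
    apply: (@proc_rv_bounded j); first by apply: inJ; rewrite mem_cat js.
    by apply: bf; rewrite inE js orbT.
  apply: bounded_rv_indic; apply: (@proc_events_measurable j); last exact: pA.
  by apply: inJ; rewrite mem_cat js orbT.
have us' : uniq (s1 ++ s2) by case/andP: us.
have EG : mean P G = \prod_(k <- s1) mean P (f k) * \prod_(k <- s2) mean P (\1_(A k)).
  apply: IH => //; first by move=> j js; exact/mem_set/inJ.
  by move=> j js; apply: bf; rewrite inE js orbT.
have -> : mean P (fun w => \prod_(k <- k :: s1) f k w * \prod_(k <- s2) \1_(A k) w) =
    mean P (fun w => G w * f k w).
  by congr mean; apply/funext => w; rewrite big_cons /G; ring.
have kn : k \notin s1 ++ s2 by case/andP: us.
rewrite (@mean_mul_ext k)//; first by rewrite EG big_cons; ring.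
  by apply: bf; exact: mem_head.
move=> B pB; pose A' j := if j == k then B else A j.
have A's2 : {in s2, A' =1 A}.
  by move=> j js; rewrite /A'; case: eqP => // jk; move: kn; rewrite -jk mem_cat js orbT.
have := IH (k :: s2) A'.
rewrite -cat1s uniq_catCA cat1s us => /(_ isT).
have sub1 : {subset s1 ++ k :: s2 <= J}.
  move=> j js; apply: sJ; move: js; rewrite !(mem_cat, inE).
    by case: (j == k); case: (j \in s1); case: (j \in s2).
move=> /(_ sub1) => E1.
have -> : mean P (fun w => G w * \1_B w) =
    mean P (fun w => \prod_(k <- s1) f k w * \prod_(k <- k :: s2) \1_(A' k) w).
  congr mean; apply/funext => w; rewrite big_cons /A' eqxx /G.
  rewrite [X in _ = _ * (_ * X)](eq_big_seq (fun j => \1_(A j) w)); first by ring.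
  by move=> j js /=; rewrite -/(A' j) A's2.
rewrite E1.
- rewrite big_cons [A' k]/A' eqxx EG.
  rewrite [X in _ * (_ * X) = _](eq_big_seq (fun j => mean P (\1_(A j)))); first by ring.
  by move=> j js /=; rewrite A's2.
- by move=> j js; apply: bf; rewrite inE js orbT.
- move=> j; rewrite inE => /orP[/eqP ->|js]; first by rewrite /A' eqxx.
  by rewrite A's2//; exact: pA.
Qed.

Lemma mean_prod (s : seq K) (f : K -> Om -> R) : uniq s -> {subset s <= J} ->
  {in s, forall k, proc_rv k (f k)} ->
  mean P (fun w => \prod_(k <- s) f k w) = \prod_(k <- s) mean P (f k).
Proof.
move=> us sJ bf; have := @mean_prod_indic s [::] f (fun=> set0).
rewrite cats0 big_nil mulr1 => <-//.
by congr mean; apply/funext => w; rewrite big_nil mulr1.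
Qed.

(* The trailing product over [s2] makes the induction go through the addition formulas. *)
Lemma mean_trig_sum_prod (s1 s2 : seq K) (Y : K -> Om -> R) (f : K -> Om -> R) (V : R) (a : K -> R) u :
  uniq (s1 ++ s2) -> {subset s1 ++ s2 <= J} ->
  (forall k, measurable_fun setT (Y k : sigma k -> R)) ->
  {in s1, forall k v, mean P (fun w => cos (v * Y k w)) = expR (- (v ^+ 2 * V) / 2) /\
                      mean P (fun w => sin (v * Y k w)) = 0} ->
  {in s2, forall k, proc_rv k (f k)} ->
  mean P (fun w => cos (u * \sum_(k <- s1) a k * Y k w) * \prod_(k <- s2) f k w) =
    expR (- (u ^+ 2 * ((\sum_(k <- s1) a k ^+ 2) * V)) / 2) * \prod_(k <- s2) mean P (f k) /\
  mean P (fun w => sin (u * \sum_(k <- s1) a k * Y k w) * \prod_(k <- s2) f k w) = 0.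
Proof.
move=> + + mY; elim: s1 s2 f => [|k s1 IH] s2 f us sJ chY bf.
  split.
    rewrite big_nil mul0r mulr0 oppr0 mul0r expR0 mul1r -mean_prod//.
    by congr mean; apply/funext => w; rewrite big_nil mulr0 cos0 mul1r.
  rewrite -[RHS](mean_cst P); congr mean; apply/funext => w.
  by rewrite big_nil mulr0 sin0 mul0r.
have kn : k \notin s1 ++ s2 by case/andP: us.
have Jk : J k by apply/set_mem/sJ; exact: mem_head.
have inJ j : j \in s1 ++ s2 -> J j by move=> js; apply/set_mem/sJ; rewrite inE js orbT.
have mYk : measurable_fun setT (fun w : sigma k => u * a k * Y k w).
  by apply: measurable_funM => //; exact: measurable_cst.
have bc : proc_rv k (fun w => cos (u * a k * Y k w)) by exact: bounded_rv_cos.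
have bs : proc_rv k (fun w => sin (u * a k * Y k w)) by exact: bounded_rv_sin.
pose Z w := u * \sum_(k <- s1) a k * Y k w.
pose Phi w := \prod_(k <- s2) f k w.
have bPhi : bounded_rv Phi.
  apply: bounded_rv_prod => j js; apply: (@proc_rv_bounded j); last exact: bf.
  by apply: inJ; rewrite mem_cat js orbT.
have mZ : measurable_fun setT Z.
  apply: measurable_funM; first exact: measurable_cst.
  rewrite (_ : (fun w => _) = fun w => \sum_(k <- s1) (if k \in s1 then a k * Y k w else 0)); last first.
    by apply/funext => w; apply: eq_big_seq => j ->.
  apply: measurable_sum => j; case: (boolP (j \in s1)) => js; last exact: measurable_cst.
  apply: measurable_funM; first exact: measurable_cst.
  move=> _ B mB; apply: (@proc_events_measurable j); last exact: mY.
  by apply: inJ; rewrite mem_cat js.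
have key g : proc_rv k g ->
  mean P (fun w => cos (Z w) * (g w * Phi w)) =
    expR (- (u ^+ 2 * ((\sum_(k <- s1) a k ^+ 2) * V)) / 2) * (mean P g * \prod_(k <- s2) mean P (f k)) /\
  mean P (fun w => sin (Z w) * (g w * Phi w)) = 0.
  move=> bg; pose f' j := if j == k then g else f j.
  have f's2 : {in s2, f' =1 f}.
    by move=> j js; rewrite /f'; case: eqP => // jk; move: kn; rewrite -jk mem_cat js orbT.
  have E1 w : \prod_(j <- k :: s2) f' j w = g w * Phi w.
    rewrite big_cons {1}/f' eqxx; congr (_ * _); apply: eq_big_seq => j js; by rewrite f's2.
  have E2 : \prod_(j <- k :: s2) mean P (f' j) = mean P g * \prod_(j <- s2) mean P (f j).
    rewrite big_cons {1}/f' eqxx; congr (_ * _); apply: eq_big_seq => j js; by rewrite f's2.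
  have := IH (k :: s2) f'; rewrite -cat1s uniq_catCA cat1s us E2 => /(_ isT).
  under [X in _ -> _ -> _ -> mean P X = _ /\ _]eq_fun do rewrite E1.
  under [X in _ -> _ -> _ -> _ /\ mean P X = _]eq_fun do rewrite E1.
  apply.
  - move=> j js; apply: sJ; move: js; rewrite !(mem_cat, inE).
    by case: (j == k); case: (j \in s1); case: (j \in s2).
  - by move=> j js; apply: chY; rewrite inE js orbT.
  - move=> j; rewrite inE => /orP[/eqP ->|js]; first by rewrite /f' eqxx.
    by rewrite f's2//; exact: bf.
have [kc1 kc2] := key _ bc; have [ks1 ks2] := key _ bs.
have [c1 s1'] := chY k (mem_head _ _) (u * a k).
have bb g h : bounded_rv g -> bounded_rv h -> bounded_rv (fun w => g w * (h w * Phi w)).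
  by move=> bg bh; apply: bounded_rvM => //; exact: bounded_rvM.
have bcZ := bounded_rv_cos mZ; have bsZ := bounded_rv_sin mZ.
have bc' := proc_rv_bounded Jk bc; have bs' := proc_rv_bounded Jk bs.
split.
  rewrite (_ : (fun w => _) = fun w => cos (Z w) * (cos (u * a k * Y k w) * Phi w) -
      sin (Z w) * (sin (u * a k * Y k w) * Phi w)); last first.
    by apply/funext => w; rewrite big_cons mulrDr mulrA -/(Z w) cosD -/(Phi w); ring.
  rewrite meanB; [|exact: bb|exact: bb].
  rewrite kc1 ks2 subr0 c1 mulrA -expRD big_cons; congr (expR _ * _); by field.
rewrite (_ : (fun w => _) = fun w => sin (Z w) * (cos (u * a k * Y k w) * Phi w) +
    cos (Z w) * (sin (u * a k * Y k w) * Phi w)); last first.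
  by apply/funext => w; rewrite big_cons mulrDr mulrA -/(Z w) sinD -/(Phi w); ring.
rewrite meanD; [|exact: bb|exact: bb].
by rewrite kc2 ks1 s1' mul0r mulr0 addr0.
Qed.

End Independence.

(** * Moments of linear combinations of fractional Brownian motions *)

Section FractionalSums.
Variables (R : realType) (dT : measure_display) (Om : measurableType dT) (P : probability Om R).
Variables (K : eqType) (J : set K) (T H : R) (X : K -> R -> Om -> R).
Hypothesis H0 : 0 < H.
Hypothesis fX : forall k, J k -> is_fBm P T H (X k).
Hypothesis indX : indep_procs P T J X.

Lemma fBm_measurable k t : J k -> 0 <= t <= T -> measurable_fun setT (X k t).
Proof. by move=> Jk tT; have [_ [mX _]] := fX Jk; exact: mX. Qed.

(** All [Y k] have the same variance [V], so by independence the combination has the characteristic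
    function of a centred Gaussian whose variance is [V] times the sum of the squared weights. *)
Lemma fBm_sum_moment (s : seq K) (a : K -> R) (ts : seq (R * R)) (V : R) p :
  uniq s -> {subset s <= J} -> all (fun q => 0 <= q.1 <= T) ts -> (0 < p)%N ->
  \sum_(q <- ts) \sum_(r <- ts) q.2 * r.2 * fbm_cov H q.1 r.1 = V -> 0 <= V ->
  (\int[P]_w ((\sum_(k <- s) a k * \sum_(q <- ts) q.2 * X k q.1 w) ^+ (2 * p))%:E <=
    ((2 * p%:R ^+ 2) ^+ p / p`!%:R * ((\sum_(k <- s) a k ^+ 2) * V) ^+ p)%:E)%E.
Proof.
move=> us sJ tsT p0 EV V0; rewrite mulrAC -exprMn.
pose Y k w := \sum_(q <- ts) q.2 * X k q.1 w.
have mY k : measurable_fun setT (Y k : g_sigma_algebraType (gen_events T X k) -> R).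
  (* Measurability is available only for times in [[0, T]]; elsewhere the summand is set to 0, which
     changes nothing on [ts]. *)
  rewrite (_ : Y k = fun w => \sum_(q <- ts) (if 0 <= q.1 <= T then q.2 * X k q.1 w else 0)); last first.
    by apply/funext => w; apply: eq_big_seq => q /(allP tsT) ->.
  apply: measurable_sum => q; case: (boolP (0 <= q.1 <= T)) => qT; last exact: measurable_cst.
  apply: measurable_funM; first exact: measurable_cst.
  move=> _ B mB; rewrite setTI; apply: sub_sigma_algebra.
  by exists q.1, B.
have mXY k : J k -> measurable_fun setT (Y k).
  move=> Jk; rewrite (_ : Y k = fun w => \sum_(q <- ts) (if 0 <= q.1 <= T then q.2 * X k q.1 w else 0)); last first.
    by apply/funext => w; apply: eq_big_seq => q /(allP tsT) ->.
  apply: measurable_sum => q; case: (boolP (0 <= q.1 <= T)) => qT; last exact: measurable_cst.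
  by apply: measurable_funM; [exact: measurable_cst|exact: fBm_measurable].
have mZ : measurable_fun setT (fun w => \sum_(k <- s) a k * Y k w).
  rewrite (_ : (fun w => _) = fun w => \sum_(k <- s) (if k \in s then a k * Y k w else 0)); last first.
    by apply/funext => w; apply: eq_big_seq => j ->.
  apply: measurable_sum => j; case: (boolP (j \in s)) => js; last exact: measurable_cst.
  apply: measurable_funM; first exact: measurable_cst.
  by apply: mXY; apply/set_mem/sJ.
have S0 : 0 <= \sum_(k <- s) a k ^+ 2 by apply: sumr_ge0 => k _; exact: sqr_ge0.
apply: (gauss_moment mZ) => //; first exact: mulr_ge0.
move=> u; have mX k t : J k -> 0 <= t <= T -> measurable_fun setT (X k t) by exact: fBm_measurable.
have := @mean_trig_sum_prod _ _ _ P K J T X mX indX s [::] Y (fun=> cst 0) V a u.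
rewrite cats0 => /(_ us sJ mY) [|//|+ _].
  move=> k ks v; have Jk : J k by apply/set_mem/sJ.
  have [_ [_ /(_ ts tsT v)]] := fX Jk.
  rewrite EV -/(Y k) => -[E1 E2]; have mvY : measurable_fun setT (fun w => v * Y k w).
    by apply: measurable_funM; [exact: measurable_cst|exact: mXY].
  move: E1 E2; rewrite (expectation_mean _ (bounded_rv_cos mvY)) (expectation_mean _ (bounded_rv_sin mvY)).
  by move=> [->] [->].
rewrite big_nil mulr1 => <-; congr mean; apply/funext => w.
by rewrite big_nil mulr1.
Qed.

Lemma fBm_increment_moment (s : seq K) (a : K -> R) t t' p :
  uniq s -> {subset s <= J} -> 0 <= t <= T -> 0 <= t' <= T -> (0 < p)%N ->
  (\int[P]_w ((\sum_(k <- s) a k * (X k t w - X k t' w)) ^+ (2 * p))%:E <=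
    ((2 * p%:R ^+ 2) ^+ p / p`!%:R * ((\sum_(k <- s) a k ^+ 2) * powR `|t - t'| (2 * H)) ^+ p)%:E)%E.
Proof.
move=> us sJ tT t'T p0.
have z0 : powR (0 : R) (2 * H) = 0 by rewrite powR0//; apply: lt0r_neq0; rewrite mulr_gt0.
under [X in (X <= _)%E]eq_integral.
  move=> w _; rewrite (eq_bigr (fun k => a k * \sum_(q <- [:: (t, 1); (t', -1)]) q.2 * X k q.1 w)); last first.
    by move=> k _; rewrite !big_cons big_nil /= addr0 mul1r mulN1r.
  over.
apply: fBm_sum_moment => //=; first by rewrite tT t'T.
  by rewrite !big_cons !big_nil /fbm_cov/= !subrr normr0 z0 (distrC t' t); field.
Qed.

Lemma fBm_moment (s : seq K) (a : K -> R) t p :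
  uniq s -> {subset s <= J} -> 0 <= t <= T -> (0 < p)%N ->
  (\int[P]_w ((\sum_(k <- s) a k * X k t w) ^+ (2 * p))%:E <=
    ((2 * p%:R ^+ 2) ^+ p / p`!%:R * ((\sum_(k <- s) a k ^+ 2) * powR t (2 * H)) ^+ p)%:E)%E.
Proof.
move=> us sJ tT p0.
have z0 : powR (0 : R) (2 * H) = 0 by rewrite powR0//; apply: lt0r_neq0; rewrite mulr_gt0.
under [X in (X <= _)%E]eq_integral.
  move=> w _; rewrite (eq_bigr (fun k => a k * \sum_(q <- [:: (t, 1)]) q.2 * X k q.1 w)); last first.
    by move=> k _; rewrite !big_cons big_nil /= addr0 mul1r.
  over.
apply: fBm_sum_moment => //=; first by rewrite tT.
  by rewrite !big_cons !big_nil /fbm_cov/= !subrr normr0 z0; field.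
exact: powR_ge0.
Qed.

End FractionalSums.

(** * Chaining and almost sure bounds *)

Lemma double_cases (m n : nat) : (2 * m < n.+1)%N -> (n < 2 * m.+1)%N -> n = (2 * m)%N \/ n = (2 * m).+1.
Proof. lia. Qed.

Lemma succ_cases (m n : nat) : (m <= n <= m.+1)%N -> n = m \/ n = m.+1.
Proof. lia. Qed.

Section Chaining.
Variable R : realType.

Lemma pow2_small (x e : R) : 0 < e -> exists N, forall n, (N <= n)%N -> x / 2 ^+ n < e.
Proof.
move=> e0; exists (Num.trunc (`|x| / e)).+1 => n Nn.
rewrite ltr_pdivrMr ?exprn_gt0// mulrC -ltr_pdivrMr// (le_lt_trans (_ : _ <= `|x| / e))//.
  by rewrite ler_wpM2r ?invr_ge0 ?ler_norm// ltW.
rewrite (lt_le_trans (truncnS_gt _))// -natrX ler_nat (leq_trans Nn)// ltnW// ltn_expl//.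
Qed.

Lemma powR2N_expr (a : R) n : powR 2 (- a) ^+ n = powR (2 ^- n) a.
Proof.
elim: n => [|n IH]; first by rewrite !expr0 invr1 powR1.
rewrite exprS IH exprS invfM powRM ?invr_ge0 ?exprn_ge0//; congr (_ * _).
by rewrite -[2^-1]powR_inv1// -powRrM mulN1r.
Qed.

(** The value at [t] and that at the level-[n] dyadic point left of [t] differ by a geometric tail.
    Two times are compared on the level whose mesh matches their distance. [C] does not depend on
    [f], so it serves all blocks at once. *)
Lemma dyadic_chaining (T a : R) : 0 < T -> 0 < a -> exists2 C : R, 0 <= C &
  forall (f : R -> R) (M : R), 0 <= M -> {within [set t | 0 <= t <= T], continuous f} ->
    (forall n i, (i < 2 ^ n)%N ->
       `|f (T * i.+1%:R / 2 ^+ n) - f (T * i%:R / 2 ^+ n)| <= M * powR 2 (- a) ^+ n) ->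
    forall t t', 0 <= t <= T -> 0 <= t' <= T -> `|f t - f t'| <= C * M * powR `|t - t'| a.
Proof.
move=> T0 a0; pose r : R := powR 2 (- a).
have r0 : 0 < r by rewrite powR_gt0.
have r1 : r < 1.
  have : powR 1 a < powR 2 a by rewrite gt0_ltr_powR ?nnegrE ?ler01 ?ler0n ?ltr1n.
  by rewrite powR1 /r powRN => h; rewrite invf_lt1 ?powR_gt0.
have r1' : 0 < 1 - r by rewrite subr_gt0.
exists ((2 / (1 - r) + 1) * powR (2 / T) a).
  by rewrite mulr_ge0 ?powR_ge0// addr_ge0// divr_ge0// ltW.
move=> f M M0 cf step.
pose k n t := Num.trunc (2 ^+ n * t / T).
pose g n t := f (T * (k n t)%:R / 2 ^+ n).
have p2 n : 0 < 2 ^+ n :> R by rewrite exprn_gt0.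
have kP n t : 0 <= t -> (k n t)%:R <= 2 ^+ n * t / T < (k n t).+1%:R.
  by move=> t0; apply: truncn_itv; rewrite divr_ge0 ?mulr_ge0// ltW.
have kS n t : 0 <= t -> k n.+1 t = (2 * k n t)%N \/ k n.+1 t = (2 * k n t).+1.
  move=> t0; have /andP[h1 h2] := kP n t t0; have /andP[h3 h4] := kP n.+1 t t0.
  have E : 2 ^+ n.+1 * t / T = 2 * (2 ^+ n * t / T) by rewrite exprS; ring.
  rewrite E in h3 h4.
  have l1 : (2 * k n t < (k n.+1 t).+1)%N.
    by rewrite -(ltr_nat R) natrM; apply: le_lt_trans h4; rewrite ler_pM2l.
  have l2 : (k n.+1 t < 2 * (k n t).+1)%N.
    by rewrite -(ltr_nat R) natrM; apply: (le_lt_trans h3); rewrite ltr_pM2l.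
  exact: double_cases.
have kle n t : 0 <= t <= T -> (k n t <= 2 ^ n)%N.
  move=> /andP[t0 tT]; have /andP[h1 _] := kP n t t0.
  by rewrite -(ler_nat R) natrX (le_trans h1)// ler_pdivrMr// ler_wpM2l// ltW.
have gS n t : 0 <= t <= T -> `|g n.+1 t - g n t| <= M * r ^+ n.+1.
  move=> tT; have /andP[t0 _] := tT.
  have E : g n t = f (T * (2 * k n t)%:R / 2 ^+ n.+1).
    by rewrite /g natrM exprS; congr f; field; rewrite lt0r_neq0.
  have [kE|kE] := kS n t t0; rewrite E /g kE.
    by rewrite subrr normr0 mulr_ge0// exprn_ge0// ltW.
  by apply: step; rewrite -kE; exact: kle.
have gnm n m t : 0 <= t <= T -> `|g (n + m)%N t - g n t| <= M * (r ^+ n - r ^+ (n + m)) / (1 - r).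
  move=> tT; elim: m => [|m IH]; first by rewrite addn0 !subrr normr0 mulr0 mul0r.
  rewrite addnS (le_trans (ler_distD (g (n + m)%N t) _ _))// (le_trans (lerD (gS _ _ tT) IH))//.
  rewrite -[X in X + _](mulfK (lt0r_neq0 r1')) -mulrDl ler_pdivlMr// divfK ?lt0r_neq0//.
  rewrite -mulrA -mulrDr ler_wpM2l// exprS.
  rewrite -subr_ge0 (_ : _ - _ = r ^+ (n + m) * (1 - r) ^+ 2); last by ring.
  by rewrite mulr_ge0 ?sqr_ge0// exprn_ge0// ltW.
have gcvg t : 0 <= t <= T -> (fun n => g n t) @ \oo --> f t.
  move=> tT; have /andP[t0 _] := tT.
  have /(_ t tT)/cvgrPdist_lt cft := proj1 (subspace_continuousP _ f) cf.
  apply/cvgrPdist_lt => e e0; have := cft _ e0; rewrite near_withinE => -[d /= d0 dP].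
  have [N Nd] := pow2_small T d0; exists N => // n /= Nn; apply: dP => /=; last first.
    have h := kle n t tT; rewrite divr_ge0 ?mulr_ge0 ?exprn_ge0 ?(ltW T0)//=.
    by rewrite ler_pdivrMr// ler_pM2l// -natrX ler_nat.
  have /andP[h1 h2] := kP n t t0; apply: le_lt_trans (Nd n Nn).
  rewrite ger0_norm; last first.
    by rewrite subr_ge0 ler_pdivrMr// mulrC -ler_pdivlMr// [t * _]mulrC.
  rewrite lerBlDr -mulrDl ler_pdivlMr// mulrC -[X in X + _]mulr1 -mulrDr.
  by rewrite -ler_pdivrMl// [T^-1 * _]mulrC (le_trans (ltW h2))// -natr1 addrC.
have gf n t : 0 <= t <= T -> `|f t - g n t| <= M * r ^+ n / (1 - r).
  move=> tT; apply/ler_addgt0Pr => e e0.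
  have /cvgrPdist_lt/(_ _ e0)[N _ NP] := gcvg t tT.
  rewrite (le_trans (ler_distD (g (n + N)%N t) _ _))// addrC lerD//.
    rewrite (le_trans (gnm n N t tT))// ler_wpM2r ?invr_ge0 ?(ltW r1')// ler_wpM2l//.
    by rewrite gerBl exprn_ge0// ltW.
  by apply: ltW; apply: NP => /=; rewrite leq_addl.
have main t t' : 0 <= t <= T -> 0 <= t' <= T -> t < t' ->
  `|f t - f t'| <= (2 / (1 - r) + 1) * powR (2 / T) a * M * powR (t' - t) a.
  move=> tT t'T tt'.
  (* The least such [n] gives [T / 2^(n+1) < t' - t <= T / 2^n]: the upper bound makes the two
     dyadic points equal or adjacent, the lower one turns [r ^ n] into a power of [t' - t]. *)
  pose P n := (T / 2 ^+ n.+1 < t' - t).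
  have exP : exists n, P n.
    have d0 : 0 < t' - t by rewrite subr_gt0.
    by have [N NP] := pow2_small T d0; exists N; apply: NP.
  case: (ex_minnP exP) => n Pn nmin {exP}.
  have dn : t' - t <= T / 2 ^+ n.
    case: n Pn nmin => [|n] Pn nmin; first by rewrite expr0 divr1; move: tT t'T; lra.
    by rewrite leNgt; apply/negP => /nmin; rewrite ltnn.
  have g1 : `|g n t - g n t'| <= M * r ^+ n.
    have k1 : (k n t <= k n t' <= (k n t).+1)%N.
      have /andP[h1 h2] := kP n t (proj1 (andP tT)); have /andP[h3 h4] := kP n t' (proj1 (andP t'T)).
      have E1 : 2 ^+ n * t / T <= 2 ^+ n * t' / T.
        by rewrite ler_wpM2r ?invr_ge0 ?(ltW T0)// ler_pM2l// ltW.
      have E2 : 2 ^+ n * t' / T <= 2 ^+ n * t / T + 1.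
        by rewrite -lerBlDl -mulrBl -mulrBr ler_pdivrMr// mul1r mulrC -(ler_pdivlMr _ _ (p2 n)).
      apply/andP; split; rewrite -ltnS -(ltr_nat R).
        exact: le_lt_trans h1 (le_lt_trans E1 h4).
      by rewrite -natr1 (le_lt_trans h3)// (le_lt_trans E2)// ltrD2r.
    have [kE|kE] : k n t' = k n t \/ k n t' = (k n t).+1 by exact: succ_cases.
      by rewrite /g kE subrr normr0 mulr_ge0// exprn_ge0// ltW.
    by rewrite /g kE distrC; apply: step; rewrite -kE kle.
  have rn : r ^+ n <= powR (2 / T) a * powR (t' - t) a.
    rewrite powR2N_expr -powRM ?divr_ge0 ?subr_ge0 ?(ltW tt') ?(ltW T0)//.
    apply: ge0_ler_powR; rewrite ?nnegrE ?invr_ge0 ?exprn_ge0 ?mulr_ge0 ?subr_ge0 ?(ltW tt') ?(ltW T0) ?(ltW a0) ?invr_ge0 ?(ltW T0)//.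
    rewrite -[2 / T * _]mulrAC ler_pdivlMr// -ler_pdivrMl// ltW//.
    by apply: le_lt_trans Pn; rewrite exprS invfM; lra.
  have := gf n t tT; have := gf n t' t'T => e1 e2.
  have e3 : `|f t - f t'| <= M * r ^+ n / (1 - r) + (M * r ^+ n + M * r ^+ n / (1 - r)).
    rewrite (le_trans (ler_distD (g n t) _ _))// lerD//.
    by rewrite (le_trans (ler_distD (g n t') _ _))// lerD// distrC.
  rewrite (le_trans e3)//.
  have -> : M * r ^+ n / (1 - r) + (M * r ^+ n + M * r ^+ n / (1 - r)) =
    (2 / (1 - r) + 1) * M * r ^+ n by field; rewrite lt0r_neq0.
  rewrite -!mulrA ler_wpM2l//; first by rewrite addr_ge0// divr_ge0// ltW.
  by rewrite [leRHS]mulrCA ler_wpM2l.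
move=> t t' tT t'T; have [tt'|tt'|->] := ltgtP t t'.
- by rewrite (distrC t t') (gtr0_norm (_ : 0 < t' - t)) ?subr_gt0//; exact: main.
- by rewrite distrC (gtr0_norm (_ : 0 < t - t')) ?subr_gt0//; exact: main.
- by rewrite !subrr !normr0 powR0 ?lt0r_neq0// mulr0.
Qed.

End Chaining.

Lemma term_le_sum (R : realType) (I : finType) (F : I -> R) i : (forall i, 0 <= F i) -> F i <= \sum_i F i.
Proof. by move=> F0; rewrite (bigD1 i)//= lerDl sumr_ge0. Qed.

(** * From summable means to almost sure bounds *)

Section AlmostSureBounds.
Variables (R : realType) (dT : measure_display) (Om : measurableType dT) (P : probability Om R).

(** The sum of all [F m] has mean at most [c], so it is almost surely finite, and it dominates each
    term. *)
Lemma ae_bounded_seq (F : nat -> Om -> R) (c : R) :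
  (forall m, measurable_fun setT (F m)) -> (forall m w, 0 <= F m w) ->
  (forall m, (\int[P]_w (F m w)%:E <= (c / (2 ^ m.+1)%:R)%:E)%E) ->
  {ae P, forall w, exists M, forall m, F m w <= M}.
Proof.
move=> mF F0 intF; pose g w := (\sum_(0 <= m <oo) (F m w)%:E)%E.
have mF' m : measurable_fun setT (fun w => (F m w)%:E) by exact/measurable_EFinP.
have F0' m w : setT w -> (0 <= (F m w)%:E)%E by rewrite lee_fin.
have gint : (\int[P]_w g w <= c%:E)%E.
  have c0 : 0 <= c.
    have := le_trans (integral_ge0 P (F0' 0%N)) (intF 0%N).
    by rewrite lee_fin pmulr_lge0// invr_gt0 ltr0n expn_gt0.
  rewrite integral_nneseries//; apply: le_trans (epsilon_trick0 xpredT c0).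
  apply: lee_nneseries => [m _ _|m _]; [exact: (integral_ge0 P (F0' m))|exact: intF].
have g0 w : (0 <= g w)%E by apply: nneseries_ge0 => m _ _; rewrite lee_fin.
have ig : P.-integrable setT g.
  apply/integrableP; split; first by apply: ge0_emeasurable_sum => [m w _ _|m _]; [rewrite lee_fin|exact: mF'].
  by under eq_integral do rewrite gee0_abs//; rewrite (le_lt_trans gint)// ltry.
apply: filterS (integrable_ae measurableT ig) => w /(_ I) gw; exists (fine (g w)) => m.
rewrite -lee_fin fineK// (le_trans _ (@nneseries_lim_ge R _ xpredT 0 m.+1 _))//; last first.
  by move=> n _ _; rewrite lee_fin.
rewrite big_nat_recr//= leeDr// sume_ge0// => i _; by rewrite lee_fin.
Qed.

(** Summation along the diagonals [j + n = m]: such a diagonal has [m + 1 <= 2^m] terms of mean at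
    most [c / 4^m]. *)
Lemma ae_bounded_seq2 (F : nat -> nat -> Om -> R) (c : R) :
  (forall j n, measurable_fun setT (F j n)) -> (forall j n w, 0 <= F j n w) ->
  (forall j n, (\int[P]_w (F j n w)%:E <= (c / (4 ^+ j * 4 ^+ n))%:E)%E) ->
  {ae P, forall w, exists M, forall j n, F j n w <= M}.
Proof.
move=> mF F0 intF.
have c0 : 0 <= c.
  have F00 w : setT w -> (0 <= (F 0%N 0%N w)%:E)%E by rewrite lee_fin.
  have := le_trans (integral_ge0 P F00) (intF 0%N 0%N).
  by rewrite lee_fin !expr0 mulr1 divr1.
pose G m w := \sum_(j < m.+1) F j (m - j)%N w.
have mG m : measurable_fun setT (G m) by exact: measurable_sum.
have G0 m w : 0 <= G m w by apply: sumr_ge0.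
have intG m : (\int[P]_w (G m w)%:E <= (2 * c / (2 ^ m.+1)%:R)%:E)%E.
  rewrite /G; under eq_integral do rewrite -sumEFin.
  rewrite ge0_integral_sum//; [|by move=> j; exact/measurable_EFinP|by move=> j w _; rewrite lee_fin].
  apply: (@le_trans _ _ (\sum_(j < m.+1) (c / 4 ^+ m)%:E)%E).
    apply: lee_sum => j _; have := intF j (m - j)%N.
    by rewrite -exprD subnKC// -ltnS.
  rewrite sumEFin lee_fin sumr_const card_ord.
  have -> : c / 4 ^+ m *+ m.+1 = c * (m.+1%:R / 4 ^+ m) by rewrite -mulr_natr; ring.
  have -> : 2 * c / (2 ^ m.+1)%:R = c * (2 ^ m)%:R^-1.
    rewrite expnS natrM; have : (2 ^ m)%:R != 0 :> R by rewrite pnatr_eq0 -lt0n expn_gt0.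
    by move: ((2 ^ m)%:R) => y y0; field.
  rewrite ler_wpM2l// ler_pdivrMr ?exprn_gt0// ler_pdivlMl ?ltr0n ?expn_gt0// -natrX -natrM ler_nat.
  rewrite (_ : 4 = 2 * 2)%N// expnMn leq_mul2l; apply/orP; right; exact: ltn_expl.
apply: filterS (ae_bounded_seq mG G0 intG) => w [M HM]; exists M => j n.
apply: le_trans (HM (j + n)%N).
have jn : (j < (j + n).+1)%N by rewrite ltnS leq_addr.
rewrite -[in leLHS](addKn j n).
exact: (@term_le_sum R 'I_(j + n).+1 (fun i => F i (j + n - i)%N w) (Ordinal jn)).
Qed.

End AlmostSureBounds.

Lemma expr_small (R : realType) (u e : R) : 0 <= u < 1 -> 0 < e -> exists N, forall p, (N <= p)%N -> u ^+ p <= e.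
Proof.
move=> /andP[u0 u1] e0; have /cvg_expr/cvgrPdist_lt/(_ _ e0)[N _ NP] : `|u| < 1 by rewrite ger0_norm.
exists N => p Np; have := NP p Np; rewrite /= sub0r normrN ger0_norm ?exprn_ge0//; exact: ltW.
Qed.

(** Extracts a bound from an even power without roots: [|M| + 1] is at least 1, hence at most its
    own powers. *)
Lemma even_power_bound (R : realType) (M q : R) p x :
  (0 < p)%N -> 0 < q -> (q * x) ^+ (2 * p) <= M -> `|x| <= (`|M| + 1) / q.
Proof.
move=> p0 q0 h; rewrite ler_pdivlMr// leNgt; apply/negP => lt.
have M1 : 1 <= `|M| + 1 by rewrite lerDr.
have : (`|M| + 1) ^+ (2 * p) < (`|x| * q) ^+ (2 * p).
  by rewrite (ltrXn2r _ (le_trans ler01 M1) lt) -lt0n muln_gt0.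
rewrite -[X in _ < (_ * X) ^+ _](gtr0_norm q0) -normrM -normrX [X in _ < X]ger0_norm; last first.
  by rewrite exprM exprn_ge0// sqr_ge0.
rewrite mulrC ltNge (le_trans h)// (le_trans (ler_norm _))//.
apply: (@le_trans _ _ (`|M| + 1)); first by rewrite lerDl.
by rewrite -[leLHS]expr1 ler_weXn2l// muln_gt0.
Qed.

Lemma leq_double_sum m n : (m <= 2 * (m + n).+1)%N.
Proof. lia. Qed.

(** * Simultaneous path bounds for exponentially many linear combinations *)

Section PathBounds.
Variables (R : realType) (dT : measure_display) (Om : measurableType dT) (P : probability Om R).
Variables (K : eqType) (J : set K) (T H : R) (X : K -> R -> Om -> R).
Hypothesis T0 : 0 < T.
Hypothesis H0 : 0 < H.
Hypothesis fX : forall k, J k -> is_fBm P T H (X k).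
Hypothesis indX : indep_procs P T J X.
Variables (B : nat -> seq K) (n : nat -> nat) (L : nat -> nat -> K -> R) (c : R) (D : nat).
Hypothesis uB : forall j, uniq (B j).
Hypothesis BJ : forall j, {subset B j <= J}.
Hypothesis L1 : forall j i, (i < n j)%N -> \sum_(k <- B j) L j i k ^+ 2 <= 1.
Hypothesis c0 : 0 <= c.
Hypothesis D0 : (0 < D)%N.
Hypothesis nD : forall j, (n j)%:R <= c * D%:R ^+ j.

Let Z j i t w := \sum_(k <- B j) L j i k * X k t w.

Lemma measurable_block_sum j i t : 0 <= t <= T -> measurable_fun setT (Z j i t).
Proof.
move=> tT; rewrite (_ : Z j i t = fun w => \sum_(k <- B j) (if k \in B j then L j i k * X k t w else 0)); last first.
  by apply/funext => w; apply: eq_big_seq => k ->.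
apply: measurable_sum => k; case: (boolP (k \in B j)) => kB; last exact: measurable_cst.
apply: measurable_funM; first exact: measurable_cst.
apply: (@fBm_measurable _ _ _ P K J T H X fX) => //; exact/set_mem/(BJ kB).
Qed.

(** Rescaled by [al ^ m * v ^ j], the dyadic increments have [2p]-th moments decaying geometrically
    in [m] and [j]. For large [p] this beats the [2^m] increments of level [m] and the [c D^j]
    combinations of block [j], with a margin that makes everything summable. *)
Lemma path_bound a e : 0 < a < H -> 0 < e ->
  {ae P, forall w, exists2 M : R, 0 <= M & forall j i, (i < n j)%N ->
    (forall t, 0 <= t <= T -> `|Z j i t w| <= M * powR 2 e ^+ j) /\
    (forall t t', 0 <= t <= T -> 0 <= t' <= T ->
      `|Z j i t w - Z j i t' w| <= M * powR 2 e ^+ j * powR `|t - t'| a)}.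
Proof.
move=> /andP[a0 aH] e0.
pose u := powR 2 (a - H) : R; pose v := powR 2 (- e) : R; pose al := powR 2 a : R.
have lt1 (x : R) : x < 0 -> 0 < powR 2 x < 1.
  move=> x0; rewrite powR_gt0//=.
  have : powR 1 (- x) < powR 2 (- x) by rewrite gt0_ltr_powR ?nnegrE ?ler01 ?ler0n ?ltr1n// oppr_gt0.
  by rewrite powR1 powRN => h; rewrite -invf_gt1 ?powR_gt0.
have /andP[u0 u1] : 0 < u < 1 by apply: lt1; rewrite subr_lt0.
have /andP[v0 v1] : 0 < v < 1 by apply: lt1; rewrite oppr_lt0.
have al0 : 0 < al by rewrite powR_gt0.
(* Against [2^m] increments the bound 1/8 leaves [4^(-m)]; against [D^j] combinations the bound
   [1 / (4 D)] below leaves [4^(-j)]. *)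
have [Nu HNu] : exists N, forall p, (N <= p)%N -> u ^+ p <= 8^-1.
  by apply: expr_small; [rewrite ltW|rewrite invr_gt0].
have [Nv HNv] : exists N, forall p, (N <= p)%N -> v ^+ p <= (4 * D%:R)^-1.
  by apply: expr_small; [rewrite ltW|rewrite invr_gt0 mulr_gt0// ltr0n].
pose p := (Nu + Nv).+1.
have up : u ^+ (2 * p) <= 8^-1 by apply/HNu/leq_double_sum.
have vp : v ^+ (2 * p) <= (4 * D%:R)^-1 by apply: HNv; rewrite /p addnC leq_double_sum.
pose Cp : R := (2 * p%:R ^+ 2) ^+ p / p`!%:R.
have Cp0 : 0 <= Cp by rewrite divr_ge0 ?exprn_ge0 ?mulr_ge0 ?sqr_ge0.
pose tm m l : R := T * l%:R / 2 ^+ m.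
have tmT m l : (l <= 2 ^ m)%N -> 0 <= tm m l <= T.
  move=> lm; rewrite /tm divr_ge0 ?mulr_ge0 ?(ltW T0) ?exprn_ge0//=.
  by rewrite ler_pdivrMr ?exprn_gt0// ler_pM2l// -natrX ler_nat.
pose F j m w : R := \sum_(l < 2 ^ m) \sum_(i < n j)
  ((al ^+ m * v ^+ j) * (Z j i (tm m l.+1) w - Z j i (tm m l) w)) ^+ (2 * p).
pose F0 j w : R := \sum_(i < n j) (v ^+ j * Z j i 0 w) ^+ (2 * p).
have even0 (x : R) : 0 <= x ^+ (2 * p) by rewrite exprM exprn_ge0// sqr_ge0.
have mZ2 j i (x t t' : R) : 0 <= t <= T -> 0 <= t' <= T -> measurable_fun setT (fun w => (x * (Z j i t w - Z j i t' w)) ^+ (2 * p)).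
  move=> tT t'T; apply: measurable_funX; apply: measurable_funM; first exact: measurable_cst.
  by apply: measurable_funB; exact: measurable_block_sum.
have tl m (l : 'I_(2 ^ m)) : 0 <= tm m l.+1 <= T by apply: tmT.
have tl' m (l : 'I_(2 ^ m)) : 0 <= tm m l <= T by apply/tmT/ltnW.
have mF j m : measurable_fun setT (F j m).
  by apply: measurable_sum => l; apply: measurable_sum => i; exact: mZ2.
have T00 : 0 <= (0 : R) <= T by rewrite lexx ltW.
have mF0 j : measurable_fun setT (F0 j).
  apply: measurable_sum => i; apply: measurable_funX; apply: measurable_funM; first exact: measurable_cst.
  exact: measurable_block_sum.
have intZ j (i : 'I_(n j)) m (l : 'I_(2 ^ m)) :
  (\int[P]_w (((al ^+ m * v ^+ j) * (Z j i (tm m l.+1) w - Z j i (tm m l) w)) ^+ (2 * p))%:E <=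
    (Cp * powR T (2 * H) ^+ p * ((u ^+ (2 * p)) ^+ m * (v ^+ (2 * p)) ^+ j))%:E)%E.
  under eq_integral do rewrite exprMn EFinM.
  rewrite ge0_integralZl//; first last.
  - by rewrite lee_fin.
  - by move=> w _; rewrite lee_fin.
  - apply/measurable_EFinP; have := mZ2 j i 1 _ _ (tl m l) (tl' m l).
    by under eq_fun do rewrite mul1r.
  have h := @fBm_increment_moment _ _ _ P K J T H X H0 fX indX (B j) (L j i) (tm m l.+1) (tm m l) p (uB j) (@BJ j) (tl m l) (tl' m l) isT.
  under eq_integral => w _.
    rewrite (_ : Z j i (tm m l.+1) w - _ = \sum_(k <- B j) L j i k * (X k (tm m l.+1) w - X k (tm m l) w)); last first.
      by rewrite /Z -sumrB; apply: eq_bigr => k _; rewrite mulrBr.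
    over.
  apply: (le_trans (lee_wpmul2l _ h)); first by rewrite lee_fin.
  rewrite -EFinM lee_fin.
  have -> : `|tm m l.+1 - tm m l| = T * 2 ^- m.
    by rewrite /tm -mulrBl -mulrBr -natrB// subSnn mulr1 ger0_norm// divr_ge0 ?exprn_ge0 ?(ltW T0).
  have TE : powR (T * 2 ^- m) (2 * H) = powR T (2 * H) * (powR 2 (- H) ^+ 2) ^+ m.
    rewrite powRM ?invr_ge0 ?exprn_ge0 ?(ltW T0)// -powR2N_expr; congr (_ * _ ^+ _).
    by rewrite -powR_mulrn ?powR_ge0// -powRrM mulNr mulrC.
  have uE : u = al * powR 2 (- H).
    by rewrite /u /al powRD//; apply/implyP.
  have S0 : 0 <= \sum_(k <- B j) L j i k ^+ 2 by apply: sumr_ge0 => k _; exact: sqr_ge0.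
  rewrite TE.
  apply: (@le_trans _ _ ((al ^+ m * v ^+ j) ^+ (2 * p) * (Cp * (powR T (2 * H) * (powR 2 (- H) ^+ 2) ^+ m) ^+ p))).
    rewrite ler_wpM2l// ler_wpM2l// lerXn2r// ?nnegrE ?mulr_ge0 ?powR_ge0 ?exprn_ge0 ?sqr_ge0//.
    by rewrite ler_piMl ?L1// mulr_ge0 ?powR_ge0 ?exprn_ge0 ?sqr_ge0.
  rewrite le_eqVlt; apply/orP; left; apply/eqP; rewrite uE !exprMn -!exprM.
  move: (powR 2 (- H)) => z; rewrite (mulnC _ m) (mulnC _ j).
  have -> : z ^+ (m * p) * z ^+ (m * p) = z ^+ (m * (2 * p)) by rewrite -exprD addnn -mul2n mulnCA.
  by ring.
have intF j m : (\int[P]_w (F j m w)%:E <= (Cp * powR T (2 * H) ^+ p * c / (4 ^+ j * 4 ^+ m))%:E)%E.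
  rewrite /F; under eq_integral do rewrite -sumEFin.
  rewrite ge0_integral_sum//; last first.
  - by move=> l w _; rewrite lee_fin sumr_ge0.
  - by move=> l; apply/measurable_EFinP; apply: measurable_sum => i; exact: mZ2.
  pose b := Cp * powR T (2 * H) ^+ p * ((u ^+ (2 * p)) ^+ m * (v ^+ (2 * p)) ^+ j).
  apply: (@le_trans _ _ (\sum_(l < 2 ^ m) (\sum_(i < n j) b)%:E)%E).
    apply: lee_sum => l _; under eq_integral do rewrite -sumEFin.
    rewrite ge0_integral_sum//; last first.
    - by move=> i w _; rewrite lee_fin.
    - by move=> i; apply/measurable_EFinP; exact: mZ2.
    by rewrite -sumEFin; apply: lee_sum => i _; exact: intZ.
  rewrite sumEFin lee_fin !sumr_const !card_ord -[(b *+ _) *+ _]mulr_natr -(mulr_natr b).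
  rewrite -mulrA; apply: (@le_trans _ _ (b * (c * D%:R ^+ j * 2 ^+ m))).
    rewrite ler_wpM2l//; last by rewrite natrX ler_wpM2r// exprn_ge0.
    by rewrite !mulr_ge0 ?exprn_ge0 ?powR_ge0 ?(ltW u0) ?(ltW v0).
  rewrite /b -!(mulrA (Cp * _)) ler_wpM2l ?mulr_ge0 ?exprn_ge0 ?powR_ge0//.
  have -> : (u ^+ (2 * p)) ^+ m * (v ^+ (2 * p)) ^+ j * (c * D%:R ^+ j * 2 ^+ m) =
      c * ((D%:R * v ^+ (2 * p)) ^+ j * (2 * u ^+ (2 * p)) ^+ m) by rewrite !exprMn; ring.
  rewrite ler_wpM2l// invfM ler_pM ?exprn_ge0 ?mulr_ge0 ?exprn_ge0 ?(ltW u0) ?(ltW v0)//.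
    rewrite -exprVn lerXn2r ?nnegrE ?mulr_ge0 ?exprn_ge0 ?(ltW v0) ?invr_ge0//.
    by move: vp; rewrite invfM ler_pdivlMr ?ltr0n// mulrC.
  rewrite -exprVn lerXn2r ?nnegrE ?mulr_ge0 ?exprn_ge0 ?(ltW u0) ?invr_ge0//.
  by move: up; move: (u ^+ _) => y; lra.
(* At time 0 the variance is 0, and so is the moment bound. Control of the starting values turns the
   increment bound into a sup bound. *)
have intF0 j : (\int[P]_w (F0 j w)%:E <= (0 / (2 ^ j.+1)%:R)%:E)%E.
  rewrite mul0r /F0; under eq_integral do rewrite -sumEFin.
  rewrite ge0_integral_sum//; last first.
  - by move=> i w _; rewrite lee_fin.
  - move=> i; apply/measurable_EFinP; apply: measurable_funX; apply: measurable_funM; first exact: measurable_cst.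
    exact: measurable_block_sum.
  apply: sume_le0 => i _; under eq_integral do rewrite exprMn EFinM.
  rewrite ge0_integralZl//; first last.
  - by rewrite lee_fin.
  - by move=> w _; rewrite lee_fin.
  - by apply/measurable_EFinP; apply: measurable_funX; exact: measurable_block_sum.
  have := @fBm_moment _ _ _ P K J T H X H0 fX indX (B j) (L j i) 0 p (uB j) (@BJ j) T00 isT.
  rewrite powR0 ?mulr0 ?expr0n ?mulr0; last by rewrite lt0r_neq0// mulr_gt0.
  by move=> h; apply: mule_ge0_le0 => //; rewrite lee_fin.
have [C C0 chain] := dyadic_chaining T0 a0.
have vE : v^-1 = powR 2 e by rewrite /v powRN invrK.
have alE : al^-1 = powR 2 (- a) by rewrite powRN.
apply: filterS2 (ae_bounded_seq2 mF (fun j m w => _) intF) (ae_bounded_seq mF0 (fun j w => _) intF0).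
- move=> w [M1 HM1] [M2 HM2].
  have step j i m l : (i < n j)%N -> (l < 2 ^ m)%N ->
      `|Z j i (tm m l.+1) w - Z j i (tm m l) w| <= (`|M1| + 1) * powR 2 e ^+ j * powR 2 (- a) ^+ m.
    move=> ij lm; rewrite -vE -alE !exprVn -mulrA -invfM mulrC (mulrC (v ^+ j)).
    rewrite mulrC; apply: (@even_power_bound _ _ _ p) => //; first by rewrite mulr_gt0 ?exprn_gt0.
    apply: le_trans (HM1 j m); rewrite /F.
    apply: le_trans (term_le_sum (Ordinal lm) _) => [|l']; last by apply: sumr_ge0.
    exact: le_trans (term_le_sum (Ordinal ij) _).
  have start j i : (i < n j)%N -> `|Z j i 0 w| <= (`|M2| + 1) * powR 2 e ^+ j.
    move=> ij; rewrite -vE exprVn; apply: (@even_power_bound _ _ _ p) => //; first by rewrite exprn_gt0.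
    by apply: le_trans (HM2 j); rewrite /F0; exact: le_trans (term_le_sum (Ordinal ij) _).
  have cont j i : {within [set t | 0 <= t <= T], continuous (fun t => Z j i t w)}.
    apply/subspace_continuousP => t tT.
    suff cs s : {subset s <= J} -> (\sum_(k <- s) L j i k * X k t' w @[t' --> within [set t | 0 <= t <= T] (nbhs t)] -->
        \sum_(k <- s) L j i k * X k t w) by apply: cs; exact: BJ.
    elim: s => [|k s IH] sJ.
      rewrite (_ : (fun t' => _) = cst 0); last by apply/funext => t'; rewrite big_nil.
      by rewrite big_nil; exact: cvg_cst.
    rewrite (_ : (fun t' => _) = fun t' => L j i k * X k t' w + \sum_(k <- s) L j i k * X k t' w); last first.
      by apply/funext => t'; rewrite big_cons.
    rewrite big_cons; apply: cvgD; last by apply: IH => k' k's; apply: sJ; rewrite inE k's orbT.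
    apply: cvgM; first exact: cvg_cst.
    have Jk : J k by apply/set_mem/sJ; exact: mem_head.
    by have [cX _] := fX Jk; exact: (proj1 (subspace_continuousP _ _) (cX w)).
  pose M := C * (`|M1| + 1).
  have M0 : 0 <= M by rewrite mulr_ge0// addr_ge0.
  have e1 j : 0 <= powR 2 e ^+ j by rewrite exprn_ge0 ?powR_ge0.
  have inc j i t t' : (i < n j)%N -> 0 <= t <= T -> 0 <= t' <= T ->
      `|Z j i t w - Z j i t' w| <= M * powR 2 e ^+ j * powR `|t - t'| a.
    move=> ij tT t'T; have := chain (fun t => Z j i t w) ((`|M1| + 1) * powR 2 e ^+ j) _ (cont j i) _ t t' tT t'T.
    rewrite mulrA; apply; first by rewrite mulr_ge0// addr_ge0.
    by move=> m l lm; exact: step.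
  exists (M + (`|M2| + 1 + M * powR T a)).
    by rewrite !addr_ge0// mulr_ge0 ?powR_ge0.
  move=> j i ij; split=> [t tT|t t' tT t'T]; last first.
    rewrite (le_trans (inc j i t t' ij tT t'T))// ler_wpM2r ?powR_ge0// ler_wpM2r//.
    by rewrite lerDl !addr_ge0// mulr_ge0 ?powR_ge0.
  rewrite -(subrK (Z j i 0 w) (Z j i t w)) (le_trans (ler_normD _ _))//.
  rewrite (le_trans (lerD (inc j i t 0 ij tT T00) (start j i ij)))// subr0.
  have /andP[t0 tT'] := tT; rewrite ger0_norm//.
  have h : powR t a <= powR T a by rewrite ge0_ler_powR ?nnegrE ?(ltW a0) ?(ltW T0).
  have h2 : M * powR 2 e ^+ j * powR t a <= M * powR T a * powR 2 e ^+ j.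
    by rewrite mulrAC ler_wpM2r// ler_wpM2l.
  have h3 : 0 <= M * powR 2 e ^+ j by rewrite mulr_ge0.
  by rewrite !mulrDl; move: h2 h3; lra.
- by move=> j m w; apply: sumr_ge0 => l _; apply: sumr_ge0.
- by move=> j w; apply: sumr_ge0.
Qed.

End PathBounds.

(** * Finite nets and dyadic blocks *)

Lemma uniform_const (R : realType) (I : eqType) (s : seq I) (Q : I -> R -> Prop) :
  (forall i C C', Q i C -> C <= C' -> Q i C') -> (forall i, exists C : R, Q i C) ->
  exists C : R, forall i, i \in s -> Q i C.
Proof.
move=> mon ex; elim: s => [|i s [C IH]]; first by exists 0.
have [C' QC'] := ex i; exists (Num.max C C') => j; rewrite inE => /orP[/eqP ->|js].
  by apply: mon QC' _; rewrite le_max lexx orbT.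
by apply: mon (IH j js) _; rewrite le_max lexx.
Qed.

Definition words (I : finType) (n : nat) : seq (seq I) :=
  flatten [seq [seq tval t | t : m.-tuple I] | m <- iota 0 n.+1].

Lemma mem_words (I : finType) n (s : seq I) : (size s <= n)%N -> s \in words I n.
Proof.
move=> sn; apply/flattenP; exists [seq tval t | t : (size s).-tuple I].
  by apply: (map_f (fun m => [seq tval t | t : m.-tuple I])); rewrite mem_iota.
by apply/mapP; exists (in_tuple s); rewrite ?mem_enum.
Qed.

Lemma dotp_close (R : realType) d (x y : 'rV[R]_d) (r : R) : eucl x <= 2 ->
  (forall i, `|y ord0 i - x ord0 i| <= r) -> r <= 1 -> `|dotp y y - dotp x x| <= 5 * d%:R * r.
Proof.
move=> x2 yx r1; rewrite /dotp -sumrB (le_trans (ler_norm_sum _ _ _))//.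
have -> : 5 * d%:R * r = \sum_(i < d) r * 5 by rewrite sumr_const card_ord -[_ *+ d]mulr_natr; ring.
apply: ler_sum => i _.
rewrite (_ : _ - _ = (y ord0 i - x ord0 i) * (y ord0 i - x ord0 i + 2 * x ord0 i)); last by ring.
rewrite normrM ler_pM// (le_trans (ler_normD _ _))// normrM gtr0_norm//.
have := yx i; have := le_trans (ler_coord_eucl x i) x2.
by move: `|_ - _| `|x _ _| => u v; lra.
Qed.

Lemma sqr_close_itv (R : realType) (u v : R) : 2^-1 <= v -> v <= 2 -> 0 <= u ->
  - 8^-1 <= u ^+ 2 - v ^+ 2 -> u ^+ 2 - v ^+ 2 <= 8^-1 -> 4^-1 <= u <= 4.
Proof.
move=> v1 v2 u0 h1 h2.
by apply/andP; split; rewrite leNgt; apply/negP => h; nra.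
Qed.

(** * Coefficient vectors of a dyadic block and their net *)

Section Net.
Variables (R : realType) (e : nat).
Local Notation d := e.+2.
Implicit Types (x y : 'rV[R]_d) (s : seq 'I_d) (j l m : nat).

Definition block j : seq (nat * nat) :=
  [seq (l, m) | l <- iota (2 ^ j).-1 (2 ^ j), m <- iota 1 (hdim l d)].

Lemma mem_block j k : (k \in block j) = (2 ^ j <= k.1.+1 < 2 ^ j.+1)%N && (1 <= k.2 <= hdim k.1 d)%N.
Proof.
have p0 : (0 < 2 ^ j)%N by rewrite expn_gt0.
apply/allpairsPdep/idP => [[l [m [+ + ->]]]|/andP[h1 h2]].
  by rewrite !mem_iota /= expnS; move: p0; lia.
exists k.1, k.2; split; last by case: k {h1 h2}.
  by rewrite mem_iota; move: h1; rewrite expnS; move: p0; lia.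
by rewrite mem_iota; move: h2; lia.
Qed.

Lemma uniq_block j : uniq (block j).
Proof.
apply: allpairs_uniq_dep; [exact: iota_uniq|by move=> l _; exact: iota_uniq|].
by move=> [l m] [l' m'] _ _ /= [-> ->].
Qed.

Lemma sum_block j (F : nat * nat -> R) : \sum_(k <- block j) F k =
  \sum_((2 ^ j).-1 <= l < (2 ^ j.+1).-1) \sum_(1 <= m < (hdim l d).+1) F (l, m).
Proof.
rewrite big_allpairs_dep /index_iota expnS.
rewrite (_ : (2 * 2 ^ j).-1 - (2 ^ j).-1 = 2 ^ j)%N; last first.
  by have p0 : (0 < 2 ^ j)%N; [rewrite expn_gt0|lia].
by apply: eq_bigr => l _; rewrite subn1.
Qed.

Variable S : nat -> nat -> 'rV[R]_d -> R.
Hypothesis HS : sph_harm_basis S.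
Hypothesis e0 : (0 < e)%N.
Variables (A : nat -> R) (eta W : R).
Hypothesis A0 : forall l, 0 <= A l.
Hypothesis eta0 : 0 < eta.
Hypothesis AW : forall n, \sum_(0 <= l < n) A l * powR l.+1%:R (e%:R + eta) <= W.

Lemma size_block j : (size (block j) <= 2 ^ e.+1 * (2 ^ e.+1) ^ j)%N.
Proof.
rewrite size_allpairs_dep sumnE big_map.
apply: (@leq_trans (\sum_(l <- iota (2 ^ j).-1 (2 ^ j)) 2 * (2 ^ j.+1) ^ e)).
  rewrite big_seq [leqRHS]big_seq; apply: leq_sum => l; rewrite mem_iota size_iota => h.
  rewrite (leq_trans (hdim_le e0 l))// leq_mul2l/= leq_exp2r// expnS.
  by have p0 : (0 < 2 ^ j)%N; [rewrite expn_gt0|lia].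
rewrite big_const_seq count_predT size_iota iter_addn_0 -expnM -expnS -expnM -!expnD leq_exp2l//.
by rewrite !mulSn (mulnC e j); lia.
Qed.

Definition sph_coef s x (k : nat * nat) : R :=
  Num.sqrt (A k.1) * iter_partial s (zero_homog (S k.1 k.2)) x.

Definition rate s : R := powR 2 ((size s)%:R - eta / 2).

Lemma rate_gt0 s : 0 < rate s. Proof. exact: powR_gt0. Qed.

Lemma rate_cons i s : rate (i :: s) = 2 * rate s.
Proof.
rewrite /rate /= -[(size s).+1%:R]natr1 (_ : _ + 1 - _ = 1 + ((size s)%:R - eta / 2)); last by ring.
by rewrite powRD ?powRr1//; apply/implyP.
Qed.

Lemma W_ge0 : 0 <= W.
Proof. by have := AW 0; rewrite big_nil. Qed.

(** On block [j], [l + 1] and [2^j] agree up to a factor 2: the powers due to derivatives become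
    [rate s ^ (2 j)], and [4 ^ size s] pays for [l + 1 <= 2 * 2^j]. *)
Lemma powR_block_weight s j l : (2 ^ j <= l.+1 < 2 ^ j.+1)%N ->
  l.+1%:R ^+ (e + 2 * size s) <= 4 ^+ size s * rate s ^+ j ^+ 2 * powR l.+1%:R (e%:R + eta) :> R.
Proof.
move=> /andP[l1 l2]; pose x : R := l.+1%:R.
have x0 : 0 < x by rewrite ltr0n.
have xx : 2 ^+ j <= x by rewrite -natrX ler_nat.
have x2 : x <= 2 * 2 ^+ j by rewrite -exprS -natrX ler_nat ltnW.
have -> : rate s ^+ j ^+ 2 = (2 ^+ j) ^+ (2 * size s) * powR (2 ^+ j) (- eta).
  rewrite -exprM -powR_mulrn ?powR_ge0// -!powR_mulrn// -!powRrM -powRD; last by apply/implyP.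
  by congr (powR _ _); rewrite !natrM; field.
have -> : powR x (e%:R + eta) = x ^+ e * powR x eta.
  by rewrite powRD ?powR_mulrn ?(ltW x0)//; apply/implyP => _; exact: lt0r_neq0.
rewrite exprD -/x.
have h1 : x ^+ (2 * size s) <= 4 ^+ size s * (2 ^+ j) ^+ (2 * size s).
  rewrite !exprM -exprMn lerXn2r// ?nnegrE ?mulr_ge0 ?exprn_ge0 ?(ltW x0)//.
  by rewrite (_ : 4 = 2 ^+ 2); [rewrite -exprMn lerXn2r// ?nnegrE ?mulr_ge0 ?exprn_ge0 ?(ltW x0)|ring].
have h2 : 1 <= powR (2 ^+ j) (- eta) * powR x eta.
  rewrite powRN mulrC ler_pdivlMr ?powR_gt0 ?exprn_gt0// mul1r.
  by rewrite ge0_ler_powR ?nnegrE ?(ltW eta0) ?exprn_ge0 ?(ltW x0).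
have -> : 4 ^+ size s * ((2 ^+ j) ^+ (2 * size s) * powR (2 ^+ j) (- eta)) * (x ^+ e * powR x eta) =
   x ^+ e * ((4 ^+ size s * (2 ^+ j) ^+ (2 * size s)) * (powR (2 ^+ j) (- eta) * powR x eta)) by ring.
rewrite ler_wpM2l ?exprn_ge0 ?(ltW x0)// -[leLHS]mulr1.
by rewrite ler_pM ?exprn_ge0 ?(ltW x0).
Qed.

Lemma sph_coef_sum_sqr s : exists2 C : R, 0 <= C & forall j x, 4^-1 <= eucl x <= 4 ->
  \sum_(k <- block j) sph_coef s x k ^+ 2 <= (C * rate s ^+ j) ^+ 2.
Proof.
have [C C0 HC] := sph_deriv_bound HS e0 s.
have K0 : 0 <= C * 4 ^+ size s * W by rewrite !mulr_ge0 ?exprn_ge0 ?W_ge0.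
exists (Num.sqrt (C * 4 ^+ size s * W)); first exact: sqrtr_ge0.
move=> j x hx; rewrite sum_block exprMn sqr_sqrtr//.
apply: (@le_trans _ _ (\sum_((2 ^ j).-1 <= l < (2 ^ j.+1).-1)
   C * 4 ^+ size s * rate s ^+ j ^+ 2 * (A l * powR l.+1%:R (e%:R + eta)))); last first.
  rewrite -mulr_sumr [leRHS]mulrAC ler_wpM2l//.
    by rewrite !mulr_ge0 ?exprn_ge0 ?(ltW (rate_gt0 s)).
  apply: le_trans (AW (2 ^ j.+1).-1).
  rewrite [leRHS](@big_cat_nat _ _ _ (2 ^ j).-1)//=; last first.
    by rewrite -!subn1 leq_sub2r// leq_exp2l.
  by rewrite lerDr sumr_ge0// => l _; rewrite mulr_ge0// powR_ge0.
rewrite big_seq [leRHS]big_seq; apply: ler_sum => l; rewrite mem_index_iota => hl.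
have hl' : (2 ^ j <= l.+1 < 2 ^ j.+1)%N.
  by move: hl; have p0 : (0 < 2 ^ j)%N; [rewrite expn_gt0|rewrite expnS; lia].
under eq_bigr do rewrite /sph_coef/= exprMn sqr_sqrtr//.
rewrite -mulr_sumr mulrCA; apply: ler_wpM2l => //.
apply: (le_trans (HC l x hx)); rewrite -!mulrA; apply: ler_wpM2l => //.
by have := powR_block_weight s hl'; rewrite expr2 !mulrA.
Qed.

Lemma sph_coef_uniform (K : nat) : exists2 C : R, 0 < C & forall s, (size s <= K)%N ->
  forall j x, 4^-1 <= eucl x <= 4 ->
  \sum_(k <- block j) sph_coef s x k ^+ 2 <= (C * rate s ^+ j) ^+ 2.
Proof.
have [|s|C HC] := @uniform_const R (seq 'I_d) (words 'I_d K) (fun s C => forall j x, 4^-1 <= eucl x <= 4 ->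
  \sum_(k <- block j) sph_coef s x k ^+ 2 <= (Num.max 1 C * rate s ^+ j) ^+ 2).
- move=> s C C' HC CC' j x hx; apply: (le_trans (HC j x hx)).
  have r0 : 0 <= rate s ^+ j by rewrite exprn_ge0// ltW// rate_gt0.
  rewrite lerXn2r ?nnegrE ?mulr_ge0 ?le_max ?ler01//.
  by rewrite ler_wpM2r// ge_max !le_max lexx CC' orbT.
- have [C C0 HC] := sph_coef_sum_sqr s; exists C => j x hx; apply: (le_trans (HC j x hx)).
  have r0 : 0 <= rate s ^+ j by rewrite exprn_ge0// ltW// rate_gt0.
  by rewrite lerXn2r ?nnegrE ?mulr_ge0 ?le_max ?ler01 ?C0 ?orbT// ler_wpM2r// le_max lexx orbT.
exists (Num.max 1 C); first by rewrite lt_max ltr01.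
by move=> s sK; apply: HC; exact: mem_words.
Qed.


Lemma square_bound (a b : R) : 0 <= b -> a ^+ 2 <= b ^+ 2 -> `|a| <= b.
Proof. by move=> b0 h; rewrite -(ger0_norm b0) -ler_sqr ?nnegrE ?normr_ge0// !real_normK ?num_real. Qed.

Lemma eucl_neq0 x (r : R) : 0 < r -> r <= eucl x -> x != 0.
Proof. by move=> r0 rx; rewrite -dotp_gt0 -sqr_eucl exprn_gt0// (lt_le_trans r0). Qed.

(** By [dotp_close] the squared norms differ by at most [5 d r <= 1/8]. *)
Lemma close_shell x y (r : R) : 2^-1 <= eucl x <= 2 -> (forall i, `|y ord0 i - x ord0 i| <= r) ->
  0 <= r <= 1 -> 40 * d%:R * r <= 1 -> 4^-1 <= eucl y <= 4.
Proof.
move=> /andP[x1 x2] yx /andP[r0 r1] dr.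
have E : `|dotp y y - dotp x x| <= 8^-1 by rewrite (le_trans (dotp_close x2 yx r1))//; lra.
rewrite -!sqr_eucl in E; move: E; rewrite ler_norml => /andP[E1 E2].
have y0 : 0 <= eucl y := sqrtr_ge0 _.
exact: sqr_close_itv x1 x2 y0 E1 E2.
Qed.

(** The grid of mesh [1 / N] in the cube [[-4, 4]^d], which contains the wide shell. *)
Definition grid_point (N : nat) (f : {ffun 'I_d -> 'I_(8 * N).+1}) : 'rV[R]_d :=
  \row_i ((f i)%:R / N%:R - 4).

Lemma grid_near (N : nat) x : (0 < N)%N -> eucl x <= 2 ->
  exists f : {ffun 'I_d -> 'I_(8 * N).+1}, forall i, `|grid_point f ord0 i - x ord0 i| <= N%:R^-1.
Proof.
move=> N0 x2; have N0' : 0 < N%:R :> R by rewrite ltr0n.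
exists [ffun i => inord (Num.trunc (N%:R * (x ord0 i + 4)))] => i.
have := le_trans (ler_coord_eucl x i) x2; rewrite ler_norml => /andP[h1 h2].
have x40 : 0 <= N%:R * (x ord0 i + 4) by rewrite mulr_ge0//; lra.
have /andP[t1 t2] := truncn_itv x40.
have tN : (Num.trunc (N%:R * (x ord0 i + 4))%R < (8 * N).+1)%N.
  rewrite ltnS -(ler_nat R) (le_trans t1)// natrM mulrC ler_wpM2r ?ltW//; lra.
rewrite mxE ffunE inordK// ler_norml; move: t1 t2; rewrite -[(Num.trunc _).+1%:R]natr1.
move: (Num.trunc _)%:R => t t1 t2.
have E : t / N%:R - 4 - x ord0 i = (t - N%:R * (x ord0 i + 4)) / N%:R by field; exact: lt0r_neq0.
rewrite E lerNl -mulNr; apply/andP; split; rewrite -[leRHS]div1r ler_pM2r ?invr_gt0//; lra.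
Qed.

Lemma sph_coef_diff s k x y (r b : R) : (1 <= k.2 <= hdim k.1 d)%N ->
  (forall c, 0 <= c <= 1 -> x + c *: (y - x) != 0) ->
  (forall i, `|y ord0 i - x ord0 i| <= r) ->
  (forall c i, 0 <= c <= 1 -> `|sph_coef (i :: s) (x + c *: (y - x)) k| <= b) ->
  `|sph_coef s y k - sph_coef s x k| <= d%:R * r * b.
Proof.
move=> kh seg yx bnd; rewrite /sph_coef -mulrBr.
have [t t01 Ht] := @mean_value_segment R d (iter_partial s (zero_homog (S k.1 k.2)))
  (fun z i => iter_partial (i :: s) (zero_homog (S k.1 k.2)) z) x (y - x)
  (fun t t01 => sph_grad HS e0 s kh (seg t t01)).
have xy : x + (y - x) = y by rewrite addrC subrK.
rewrite -{1}xy Ht mulr_sumr (le_trans (ler_norm_sum _ _ _))//.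
rewrite -mulrA mulr_natl -[d in _ *+ d]card_ord -sumr_const; apply: ler_sum => i _.
by rewrite mulrCA normrM ler_pM// ?mxE ?yx// bnd.
Qed.

(** The net consists of the unit vectors of the block and the normalised coefficient vectors at grid
    points. The unit vectors bound every single [b k], which controls the error of moving [x] to a
    grid point; the mesh makes this error at most the main term, whence the factor 2 in [2 * C]. *)
Lemma net_bound (K : nat) : exists (n : nat -> nat) (L : nat -> nat -> nat * nat -> R) (c : R) (D : nat) (C : R),
  [/\ forall j i, (i < n j)%N -> \sum_(k <- block j) L j i k ^+ 2 <= 1,
      0 <= c, (0 < D)%N, forall j, (n j)%:R <= c * D%:R ^+ j & 0 <= C] /\
  forall j (b : nat * nat -> R) Y, (forall i, (i < n j)%N -> `|\sum_(k <- block j) L j i k * b k| <= Y) ->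
    forall s x, (size s <= K)%N -> 2^-1 <= eucl x <= 2 ->
    `|\sum_(k <- block j) sph_coef s x k * b k| <= C * rate s ^+ j * Y.
Proof.
(* One order beyond [K], since moving to a grid point costs a derivative. *)
have [C C0 HC] := sph_coef_uniform K.+1.
(* [N j] exceeds [d] times the bound [2^(e+1) (2^(e+1))^j] on the block size times the factor [2^j]
   of the additional derivative; the 40 serves [close_shell]. *)
pose Q := (40 * d * 2 ^ e.+1)%N; pose N j := (Q * (2 ^ e.+2) ^ j)%N.
have Q0 : (0 < Q)%N by rewrite !muln_gt0 expn_gt0.
have N0 j : (0 < N j)%N by rewrite muln_gt0 Q0 !expn_gt0.
have NR j : 0 < (N j)%:R :> R by rewrite ltr0n.
pose code := ((nat * nat) + (seq 'I_d * 'rV[R]_d))%type.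
pose codes j : seq code := [seq inl k | k <- block j] ++
  [seq inr (s, grid_point f) | s <- words 'I_d K, f <- enum {: {ffun 'I_d -> 'I_(8 * N j).+1}}].
(* Grid points off the shell and words that are too long get the zero vector, so the norm bound
   holds for every code. *)
pose vec j (z : code) (k : nat * nat) : R := match z with
  | inl k' => (k == k')%:R
  | inr (s, g) => if (size s <= K)%N && (4^-1 <= eucl g <= 4) then sph_coef s g k / (C * rate s ^+ j) else 0 end.
pose n j := size (codes j).
pose L j i := vec j (nth (inl (0, 0)%N) (codes j) i).
have w0 s j : 0 < C * rate s ^+ j by rewrite mulr_gt0// exprn_gt0// rate_gt0.
have HL z j : \sum_(k <- block j) vec j z k ^+ 2 <= 1.
  case: z => [k'|[s g]] /=.
    have [kB|kB] := boolP (k' \in block j).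
      rewrite (bigD1_seq k') ?uniq_block//= eqxx expr1n big1 ?addr0// => k /negPf ->.
      by rewrite expr0n.
    rewrite big_seq big1 ?ler01// => k kB'; case: eqP => [kk|_]; last by rewrite expr0n.
    by move: kB; rewrite -kk kB'.
  case: (boolP ((size s <= K)%N && (4^-1 <= eucl g <= 4))) => [/andP[sK hg]|_]; last by rewrite big1// => k _; rewrite expr0n.
  under eq_bigr do rewrite expr_div_n; rewrite -mulr_suml ler_pdivrMr ?exprn_gt0// mul1r.
  by apply: HC => //; rewrite ltnW.
exists n, L, ((2 ^ e.+1)%:R + (size (words 'I_d K) * (9 * Q) ^ d)%:R), (2 ^ (e.+2 * d))%N, (2 * C).
split; first split.
- by move=> j i _; exact: HL.
- by rewrite addr_ge0.
- by rewrite expn_gt0.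
- move=> j; rewrite -natrX -natrD -natrM ler_nat /n size_cat size_map size_allpairs mulnDl leq_add//.
    rewrite (leq_trans (size_block j))// leq_mul2l; apply/orP; right; rewrite -!expnM leq_exp2l// leq_mul2r; apply/orP; right.
    by rewrite (leq_trans (leqnSn _))// leq_pmulr.
  rewrite -mulnA leq_mul2l -cardE card_ffun !card_ord; apply/orP; right.
  rewrite -(expnM 2) mulnAC expnM -expnMn leq_exp2r// expnM -mulnA -/(N j).
  by have := N0 j; lia.
- by rewrite mulr_ge0// ltW.
move=> j b Y HY s x sK hx.
have Hz z : z \in codes j -> `|\sum_(k <- block j) vec j z k * b k| <= Y.
  move=> zc; have := HY (index z (codes j)); rewrite /n index_mem => /(_ zc).
  by rewrite /L nth_index.
have bY k : k \in block j -> `|b k| <= Y.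
  move=> kB; have := Hz (inl k); rewrite mem_cat map_f// => /(_ isT) /=.
  rewrite (bigD1_seq k) ?uniq_block//= eqxx mul1r big1 ?addr0// => k' /negPf ->.
  by rewrite mul0r.
have [f Hf] := grid_near (N0 j) (proj2 (andP hx)).
pose g := grid_point f.
have Nr : 40 * d%:R * (N j)%:R^-1 <= 1 :> R.
  rewrite ler_pdivrMr// mul1r -natrM ler_nat /N /Q -!mulnA leq_mul2l/= leq_pmulr//.
  by rewrite muln_gt0 !expn_gt0.
have Nr1 : 0 <= ((N j)%:R^-1 : R) <= 1.
  by rewrite invr_ge0 ltW//= invf_le1// (ler_nat R 1).
have seg c : 0 <= c <= 1 -> 4^-1 <= eucl (x + c *: (g - x)) <= 4.
  move=> /andP[c0 c1]; apply: (close_shell (r := (N j)%:R^-1) hx _ Nr1 Nr) => i.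
  rewrite !mxE addrAC subrr add0r normrM (ger0_norm c0) -[leRHS]mul1r ler_pM// ?normr_ge0//.
  by have := Hf i; rewrite mxE.
have hg : 4^-1 <= eucl g <= 4.
  by have := seg 1; rewrite scale1r addrC subrK; apply; rewrite ler01 lexx.
have gc : (inr (s, g) : code) \in codes j.
  rewrite mem_cat; apply/orP; right; apply/allpairsP; exists (s, f).
  by rewrite mem_words// mem_enum.
have Hg := Hz _ gc; rewrite /= sK hg /= in Hg.
have dk k : k \in block j -> `|sph_coef s g k - sph_coef s x k| <= d%:R * (N j)%:R^-1 * (C * (2 * rate s) ^+ j).
  move=> kB; have := kB; rewrite mem_block => /andP[_ kh].
  apply: sph_coef_diff => //.
  - by move=> c /seg/andP[h _]; apply: (eucl_neq0 _ h); rewrite invr_gt0.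
  - move=> c i /seg hz; apply: square_bound.
      by rewrite mulr_ge0 ?exprn_ge0 ?mulr_ge0 ?(ltW C0) ?(ltW (rate_gt0 s)).
    rewrite -(rate_cons i s); apply: le_trans (HC (i :: s) _ j _ hz); last by rewrite /= ltnS.
    by rewrite (bigD1_seq k) ?uniq_block//= lerDl sumr_ge0// => k' _; exact: sqr_ge0.
(* The sign of [Y] comes from a unit vector or, for an empty block, from the vanishing sum at the
   grid point. *)
have Y0 : 0 <= Y \/ block j = [::].
  case E : (block j) => [|k t]; [by right|left].
  by apply: le_trans (bY k _); rewrite ?E ?mem_head.
case: Y0 => [Y0|E0]; last first.
  have : `|\sum_(k <- block j) sph_coef s g k / (C * rate s ^+ j) * b k| <= Y by [].
  rewrite E0 !big_nil normr0 => Y0; rewrite !mulr_ge0 ?exprn_ge0 ?(ltW C0) ?(ltW (rate_gt0 s))//.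
have E : \sum_(k <- block j) sph_coef s x k * b k =
   (C * rate s ^+ j) * (\sum_(k <- block j) sph_coef s g k / (C * rate s ^+ j) * b k) -
   \sum_(k <- block j) (sph_coef s g k - sph_coef s x k) * b k.
  rewrite mulr_sumr -sumrB; apply: eq_bigr => k _.
  by rewrite mulrBl mulrA [_ * (_ / _)]mulrC divfK ?lt0r_neq0//; ring.
rewrite E (le_trans (ler_normB _ _))// -!mulrA mulr_natl mulr2n !mulrA lerD//.
  by rewrite normrM (gtr0_norm (w0 s j)) ler_wpM2l// ltW.
rewrite (le_trans (ler_norm_sum _ _ _))//.
apply: (@le_trans _ _ (\sum_(k <- block j) d%:R * (N j)%:R^-1 * (C * (2 * rate s) ^+ j) * Y)).
  rewrite big_seq [leRHS]big_seq; apply: ler_sum => k kB.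
  by rewrite normrM ler_pM// ?dk// bY.
rewrite big_const_seq count_predT iter_addr_0 -[_ *+ size _]mulr_natl !mulrA ler_wpM2r//.
have -> : (size (block j))%:R * d%:R / (N j)%:R * C * (2 * rate s) ^+ j =
    ((size (block j))%:R * d%:R * 2 ^+ j / (N j)%:R) * (C * rate s ^+ j) by rewrite exprMn; ring.
rewrite -[leRHS]mul1r ler_wpM2r ?(ltW (w0 s j))// ler_pdivrMr// mul1r -natrX -!natrM ler_nat.
apply: (@leq_trans (2 ^ e.+1 * (2 ^ e.+1) ^ j * d * 2 ^ j)).
  by rewrite !leq_mul2r size_block !orbT.
rewrite /N /Q (expnS 2 e.+1) expnMn -!mulnA.
rewrite (_ : 2 ^ e.+1 * _ = d * (2 ^ e.+1 * (2 ^ j * (2 ^ e.+1) ^ j)))%N; first by rewrite leq_pmull.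
by rewrite [(_ ^ j * _)%N]mulnCA mulnCA [(2 ^ j * _)%N]mulnC.
Qed.

End Net.

(** * Hölder regularity of the sum of blocks *)

Section Series.
Variable R : realType.
Implicit Types (u : nat -> R) (c r : R).

Lemma geo_series u c r : 0 <= r < 1 -> (forall j, `|u j| <= c * r ^+ j) ->
  cvgn (series u) /\ `|limn (series u)| <= c / (1 - r).
Proof.
move=> /andP[r0 r1] uc.
have r1' : `|r| < 1 by rewrite ger0_norm.
have cg : cvgn (series (geometric c r)) by exact: is_cvg_geometric_series.
have c0 : 0 <= c by have := le_trans (normr_ge0 _) (uc 0%N); rewrite expr0 mulr1.
have cn : cvgn [normed series u].
  have g0 n : 0 <= geometric c r n by rewrite (le_trans _ (uc n)).
  exact: series_le_cvg (fun n => normr_ge0 (u n)) g0 uc cg.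
split; first exact: normed_cvg.
rewrite (le_trans (lim_series_norm cn))// (le_trans (lim_series_le cn cg uc))//.
by have /cvg_lim -> := @cvg_geometric_series _ c _ r1'.
Qed.

Lemma lim_series_sub u v : cvgn (series u) -> cvgn (series v) ->
  limn (series (fun j => u j - v j)) = limn (series u) - limn (series v).
Proof. exact: lim_seriesB. Qed.

(** Interpolates between a size bound, represented by 1, and a Lipschitz bound, represented by
    [v]. *)
Lemma min1_powR (v th : R) : 0 <= v -> 0 <= th <= 1 -> Num.min 1 v <= powR v th.
Proof.
move=> v0 /andP[t0 t1]; have [v1|v1] := leP 1 v.
  by rewrite -[leLHS](powRr0 v) ler_powR.
have [->|vn] := eqVneq v 0; first exact: powR_ge0.
by rewrite ger1_powR// lt_neqAle eq_sym vn v0 ltW.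
Qed.

Lemma powR_expr (x th : R) n : 0 <= x -> powR (x ^+ n) th = powR x th ^+ n.
Proof.
move=> x0; elim: n => [|n IH]; first by rewrite !expr0 powR1.
by rewrite !exprS powRM ?exprn_ge0// IH.
Qed.

Lemma powR_small (c th e : R) : 0 <= c -> 0 < th -> 0 < e ->
  exists2 del, 0 < del & forall t, 0 <= t < del -> c * powR t th < e.
Proof.
move=> c0 th0 e0; have c1 : 0 < c + 1 by rewrite ltr_wpDl.
exists (powR (e / (c + 1)) th^-1); first by rewrite powR_gt0// divr_gt0.
move=> t /andP[t0 td].
have h : powR t th <= e / (c + 1).
  have -> : e / (c + 1) = powR (powR (e / (c + 1)) th^-1) th.
    by rewrite -powRrM mulVf ?lt0r_neq0// powRr1// divr_ge0// ltW.
  by rewrite ge0_ler_powR ?nnegrE ?powR_ge0 ?(ltW th0) ?(ltW td).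
rewrite (le_lt_trans (ler_wpM2l c0 h))// mulrCA -[ltRHS]mulr1 ltr_pM2l// ltr_pdivrMr// mul1r ltrDl.
exact: ltr01.
Qed.

Lemma is_derive_taylor (V : normedModType R) (f : V -> R) x v (D c th del : R) :
  0 <= c -> 0 < th -> 0 < del ->
  (forall t : R, `|t| < del -> `|f (x + t *: v) - f x - t * D| <= c * `|t| * powR `|t| th) ->
  is_derive x v f D.
Proof.
move=> c0 th0 d0 H.
suff h : (fun t : R => t^-1 *: ((f \o shift x) (t *: v) - f x)) @ 0^' --> D.
  by apply: DeriveDef; [apply/cvg_ex; exists D|exact: cvg_lim h].
apply/cvgrPdist_lt => e e0.
have [d1 d10 Hd1] := powR_small c0 th0 e0.
near=> t.
have t0 : t != 0 by near: t; exact: nbhs_dnbhs_neq.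
have tn : 0 < `|t| by rewrite normr_gt0.
have td : `|t| < Num.min del d1.
  near: t; apply: dnbhs0_lt; by rewrite lt_min d0.
move: td; rewrite lt_min => /andP[td td1].
have -> : D - t^-1 *: ((f \o shift x) (t *: v) - f x) = - (t^-1 * (f (x + t *: v) - f x - t * D)).
  rewrite /= [t *: v + x]addrC -[t^-1 *: (_ - _)]/(t^-1 * (f (x + t *: v) - f x)).
  by rewrite [in RHS]mulrBr mulrA mulVf// mul1r opprB.
rewrite normrN normrM normfV (le_lt_trans (_ : _ <= c * powR `|t| th))//.
  by rewrite ler_pdivrMl// mulrA [`|t| * c]mulrC H.
by apply: Hd1; rewrite normr_ge0.
Unshelve. all: by end_near. Qed.

Lemma sin_le_id (u : R) : 0 <= u -> `|sin u| <= u.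
Proof.
move=> u0.
have [|c c0 E] := @MVT_segment R sin cos 0 u u0.
- by apply: continuous_subspaceT => z; exact: continuous_sin.
- move: E; rewrite sin0 !subr0 => ->; rewrite normrM (ger0_norm u0) ler_piMl//.
  by rewrite ler_norml cos_geN1 cos_le1.
Qed.

Lemma cos_ge_quadratic (t : R) : 0 <= t -> 2 - 2 * cos t <= t ^+ 2.
Proof.
move=> t0; have h := @sin_le_id (t / 2) (divr_ge0 t0 (ler0n _ 2)).
have -> : t = (t / 2) *+ 2 by rewrite -mulr_natr divfK.
rewrite cos_mulr2n cos2sin2.
have : sin (t / 2) ^+ 2 <= (t / 2) ^+ 2.
  by rewrite -[leLHS]real_normK ?num_real// lerXn2r ?nnegrE ?divr_ge0.
move: {h} (t / 2) => u; move: (sin u) => s su.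
rewrite -subr_ge0 (_ : _ - _ = 4 * (u ^+ 2 - s ^+ 2)); last by ring.
by rewrite mulr_ge0// subr_ge0.
Qed.

End Series.

(** * Chords and geodesic distance on the sphere *)

Section SphereGeometry.
Variables (R : realType) (d : nat).
Implicit Types (x y v : 'rV[R]_d).

Lemma dotpDl x y v : dotp (x + y) v = dotp x v + dotp y v.
Proof. by rewrite /dotp -big_split/=; apply: eq_bigr => i _; rewrite mxE mulrDl. Qed.

Lemma dotpDr x y v : dotp v (x + y) = dotp v x + dotp v y.
Proof. by rewrite dotpC dotpDl !(dotpC v). Qed.

Lemma dotpNl x v : dotp (- x) v = - dotp x v.
Proof. by rewrite -scaleN1r dotpZl mulN1r. Qed.

Lemma dotpNr x v : dotp v (- x) = - dotp v x.
Proof. by rewrite dotpC dotpNl dotpC. Qed.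

Lemma dotp_sphere_itv x y : sphere x -> sphere y -> -1 <= dotp x y <= 1.
Proof.
move=> sx sy; have := dotp_ge0 (x + y); have := dotp_ge0 (x - y).
rewrite !(dotpDl, dotpDr, dotpNl, dotpNr) (dotpC y x) sx sy; lra.
Qed.

Lemma cos_geod x y : sphere x -> sphere y -> cos (geod x y) = dotp x y.
Proof. by move=> sx sy; rewrite acosK// in_itv/= dotp_sphere_itv. Qed.

Lemma geod_ge0 x y : sphere x -> sphere y -> 0 <= geod x y.
Proof. by move=> sx sy; rewrite acos_ge0// dotp_sphere_itv. Qed.

(** The left side is the squared chord, which is at most the squared arc. *)
Lemma sqr_dist_geod x y : sphere x -> sphere y -> 2 - 2 * dotp x y <= geod x y ^+ 2.
Proof. by move=> sx sy; rewrite -cos_geod// cos_ge_quadratic// geod_ge0. Qed.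

Lemma coord_dist_geod x y i : sphere x -> sphere y -> `|y ord0 i - x ord0 i| <= geod x y.
Proof.
move=> sx sy; have g0 := geod_ge0 sx sy; rewrite -(ger0_norm g0) -ler_sqr ?nnegrE ?normr_ge0//.
rewrite !real_normK ?num_real// (le_trans _ (sqr_dist_geod sx sy))//.
have -> : 2 - 2 * dotp x y = eucl (y - x) ^+ 2.
  by rewrite sqr_eucl !(dotpDl, dotpDr, dotpNl, dotpNr) (dotpC y x) sx sy; ring.
rewrite -[leLHS]real_normK ?num_real// lerXn2r ?nnegrE ?sqrtr_ge0//.
by have := ler_coord_eucl (y - x) i; rewrite !mxE.
Qed.

(** The squared norm on the chord is [1 - c (1 - c) |y - x|^2], at least 1/2 when the angle is at
    most a right one. The chord thus stays away from the origin, where the homogeneous extensions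
    are singular. *)
Lemma sphere_segment x y c : sphere x -> sphere y -> 0 <= dotp x y -> 0 <= c <= 1 ->
  2^-1 <= eucl (x + c *: (y - x)) <= 2.
Proof.
move=> sx sy xy /andP[c0 c1]; have /andP[_ xy1] := dotp_sphere_itv sx sy.
have E : eucl (x + c *: (y - x)) ^+ 2 = 1 - c * (1 - c) * (2 - 2 * dotp x y).
  rewrite sqr_eucl !(dotpDl, dotpDr, dotpZl, dotpZr, dotpNl, dotpNr) (dotpC y x) sx sy; ring.
have e0 : 0 <= eucl (x + c *: (y - x)) := sqrtr_ge0 _.
have h1 : 0 <= c * (1 - c) by rewrite mulr_ge0// subr_ge0.
have h2 : c * (1 - c) <= 4^-1 by have := sqr_ge0 (c - 2^-1); lra.
have h3 : c * (1 - c) * (2 - 2 * dotp x y) <= 4^-1 * 2 by rewrite ler_pM//; lra.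
have h4 : 0 <= c * (1 - c) * (2 - 2 * dotp x y) by rewrite mulr_ge0//; lra.
move: E; set z := eucl _ in e0 * => E.
by apply/andP; split; rewrite leNgt; apply/negP => h; nra.
Qed.

End SphereGeometry.

Lemma lim_series_scale (R : realType) (c : R) (u : nat -> R) : cvgn (series u) ->
  cvgn (series (fun j => c * u j)) /\ limn (series (fun j => c * u j)) = c * limn (series u).
Proof.
move=> cu; have E : series (fun j => c * u j) = (fun n => c * series u n).
  by apply/funext => n; rewrite /series /= mulr_sumr.
have h : (fun n => c * series u n) @ \oo --> c * limn (series u) by apply: cvgM => //; exact: cvg_cst.
by rewrite E; split; [apply/cvg_ex; exists (c * limn (series u))|exact: cvg_lim h].
Qed.

Lemma lim_series_lin (R : realType) (I : Type) (s : seq I) (c : I -> R) (w : I -> nat -> R) :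
  (forall i, cvgn (series (w i))) ->
  cvgn (series (fun j => \sum_(i <- s) c i * w i j)) /\
  limn (series (fun j => \sum_(i <- s) c i * w i j)) = \sum_(i <- s) c i * limn (series (w i)).
Proof.
move=> cw.
have E : series (fun j => \sum_(i <- s) c i * w i j) = (fun n => \sum_(i <- s) c i * series (w i) n).
  by apply/funext => n; rewrite /series /= exchange_big/=; apply: eq_bigr => i _; rewrite mulr_sumr.
have h : (fun n => \sum_(i <- s) c i * series (w i) n) @ \oo --> \sum_(i <- s) c i * limn (series (w i)).
  elim: {E} s => [|i s IH].
    by rewrite big_nil (_ : (fun n => _) = cst 0); [exact: cvg_cst|apply/funext => n; rewrite big_nil].
  rewrite big_cons (_ : (fun n => _) = fun n => c i * series (w i) n + \sum_(i <- s) c i * series (w i) n).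
    by apply: cvgD => //; apply: cvgM; [exact: cvg_cst|exact: cw].
  by apply/funext => n; rewrite big_cons.
rewrite E; split; last exact: cvg_lim h.
by apply/cvg_ex; eexists; exact: h.
Qed.

Lemma geo_bound_ge0 (R : realType) (c r : R) : 0 <= c -> 0 <= r < 1 -> 0 <= c / (1 - r).
Proof. by move=> c0 /andP[_ r1]; rewrite divr_ge0// subr_ge0 ltW. Qed.

Lemma near_coord (R : realType) d (x : 'rV[R]_d) (del : R) : 0 < del ->
  \forall z \near x, forall i, `|(z : 'rV[R]_d) ord0 i - x ord0 i| < del.
Proof.
move=> del0; apply: (@filter_forall _ _ (fun i (z : 'rV[R]_d) => `|z ord0 i - x ord0 i| < del) (nbhs x)) => i.
have /cvgrPdist_lt/(_ _ del0) := @coord_continuous R 1 d ord0 i x.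
by apply: filterS => z; rewrite distrC.
Qed.

Lemma shell_neq0 (R : realType) d (x : 'rV[R]_d) : 2^-1 <= eucl x <= 2 -> x != 0.
Proof. by move=> /andP[h _]; rewrite -dotp_gt0 -sqr_eucl exprn_gt0// (lt_le_trans _ h)// invr_gt0. Qed.

Lemma shell_oc (R : realType) d (x : 'rV[R]_d) : 2^-1 < eucl x < 2 -> 2^-1 <= eucl x <= 2.
Proof. by move=> /andP[/ltW -> /ltW ->]. Qed.

Lemma sphere_oshell (R : realType) d (x : 'rV[R]_d) : sphere x -> 2^-1 < eucl x < 2.
Proof. by move=> su; rewrite (sphere_eucl su) invf_lt1// !ltr1n. Qed.

Lemma sphere_shell (R : realType) d (x : 'rV[R]_d) : sphere x -> 2^-1 <= eucl x <= 2.
Proof. by move=> /sphere_oshell/shell_oc. Qed.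

Lemma sqr_open_itv (R : realType) (u : R) : 0 <= u -> 4^-1 < u ^+ 2 -> u ^+ 2 < 4 -> 2^-1 < u < 2.
Proof. by move=> u0 h1 h2; apply/andP; split; rewrite ltNge; apply/negP => h; nra. Qed.

Lemma shell_ball (R : realType) d (x : 'rV[R]_d) : 2^-1 < eucl x < 2 -> exists2 del, 0 < del &
  forall z : 'rV[R]_d, (forall i, `|z ord0 i - x ord0 i| < del) -> 2^-1 < eucl z < 2.
Proof.
move=> /andP[x1 x2]; pose g := Num.min (eucl x ^+ 2 - 4^-1) (4 - eucl x ^+ 2).
have g0 : 0 < g.
  rewrite lt_min; move: (eucl x) x1 x2 => u; clear => x1 x2.
  by apply/andP; split; nra.
have D0 : 0 < 5 * d%:R + 1 :> R by rewrite ltr_wpDl// mulr_ge0.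
pose del := Num.min 1 (g / (5 * d%:R + 1)).
exists del; first by rewrite lt_min ltr01 divr_gt0.
move=> z zx.
have d1 : del <= 1 by rewrite ge_min lexx.
have E : `|dotp z z - dotp x x| < g.
  rewrite (le_lt_trans (dotp_close (ltW x2) (fun i => ltW (zx i)) d1))//.
  apply: (@le_lt_trans _ _ (5 * d%:R * (g / (5 * d%:R + 1)))).
    by rewrite ler_wpM2l ?mulr_ge0// ge_min lexx orbT.
  by rewrite mulrA ltr_pdivrMr// mulrC ltr_pM2l// ltrDl.
rewrite -!sqr_eucl in E; move: E; rewrite ltr_norml => /andP[E1 E2].
have g1 : g <= eucl x ^+ 2 - 4^-1 by rewrite ge_min lexx.
have g2 : g <= 4 - eucl x ^+ 2 by rewrite ge_min lexx orbT.
have z0 : 0 <= eucl z := sqrtr_ge0 _.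
by apply: sqr_open_itv => //; lra.
Qed.

(** * Deterministic regularity of a sum of blocks *)

Section RandomSeriesPath.
Variables (R : realType) (d : nat) (T eta : R) (K : nat).
Variable y : nat -> seq 'I_d -> R -> 'rV[R]_d -> R.
Hypothesis ygrad : forall j s t x, x != 0 -> grad_at (y j s t) (fun i => y j (i :: s) t x) x.
Hypothesis T0 : 0 < T.
Implicit Types (s : seq 'I_d) (t : R) (x z v : 'rV[R]_d) (j : nat).

Variables (a eps M : R).
Hypothesis a01 : 0 < a <= 1.
Hypothesis M0 : 0 <= M.
(** Growth per block of the derivative along [s], including the loss [eps] of the almost sure
    bounds; the differentiated series converges while it is below 1. *)
Definition rate_eps s : R := powR 2 ((size s)%:R - eta / 2 + eps).
Hypothesis ybnd : forall j s t x, (size s <= K)%N -> 0 <= t <= T -> 2^-1 <= eucl x <= 2 ->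
  `|y j s t x| <= M * rate_eps s ^+ j.
Hypothesis ytime : forall j s t t' x, (size s <= K)%N -> 0 <= t <= T -> 0 <= t' <= T ->
  2^-1 <= eucl x <= 2 -> `|y j s t x - y j s t' x| <= M * rate_eps s ^+ j * powR `|t - t'| a.

Definition path_deriv s t x : R := limn (series (fun j => y j s t x)).

Lemma rate_eps_gt0 s : 0 < rate_eps s. Proof. exact: powR_gt0. Qed.

Lemma powR2_lt1 (b : R) : b < 0 -> 0 <= powR 2 b < 1.
Proof.
move=> b0; rewrite powR_ge0/=.
have : powR 1 (- b) < powR 2 (- b) by rewrite gt0_ltr_powR ?nnegrE ?ler01 ?ler0n ?ltr1n ?oppr_gt0.
by rewrite powR1 powRN => h; rewrite -invf_gt1 ?powR_gt0.
Qed.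

Lemma rate_eps_theta s th : rate_eps s * powR 2 th = powR 2 ((size s)%:R + th - eta / 2 + eps).
Proof. by rewrite /rate_eps -powRD; [congr (powR _ _); ring|apply/implyP]. Qed.

(** If [rho] exceeds [2^(-j)] the triangle inequality is the better bound (constant 2), otherwise
    the mean value theorem (constant [d]), whose additional derivative costs [2^j]. *)
Lemma space_diff j s t x z rho : (size s < K)%N -> 0 <= t <= T -> 0 <= rho ->
  (forall c, 0 <= c <= 1 -> 2^-1 <= eucl (x + c *: (z - x)) <= 2) ->
  (forall i, `|z ord0 i - x ord0 i| <= rho) ->
  `|y j s t z - y j s t x| <= (2 + d%:R) * M * rate_eps s ^+ j * Num.min 1 (2 ^+ j * rho).
Proof.
move=> sK tT rho0 seg xz.
have r0 : 0 <= M * rate_eps s ^+ j by rewrite mulr_ge0// exprn_ge0// ltW// rate_eps_gt0.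
have x1 : x + 1 *: (z - x) = z by rewrite scale1r addrC subrK.
have hx : 2^-1 <= eucl x <= 2.
  by have := seg 0; rewrite scale0r addr0; apply; rewrite lexx ler01.
have hz : 2^-1 <= eucl z <= 2 by rewrite -x1 seg// ler01 lexx.
have [h1|h1] := leP 1 (2 ^+ j * rho); rewrite ?mulr1.
  rewrite (le_trans (ler_normB _ _))// (le_trans (lerD (ybnd j (ltnW sK) tT hz) (ybnd j (ltnW sK) tT hx)))//.
  by rewrite -mulrA mulrDl mulr_natl mulr2n lerDl mulr_ge0.
have [c c01 E] := @mean_value_segment R d (y j s t) (fun z i => y j (i :: s) t z) x (z - x)
  (fun c c01 => ygrad j s t (shell_neq0 (seg c c01))).
rewrite -{1}x1 scale1r E (le_trans (ler_norm_sum _ _ _))//.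
apply: (@le_trans _ _ (\sum_(i < d) rho * (M * (2 * rate_eps s) ^+ j))).
  apply: ler_sum => i _; rewrite normrM !mxE ler_pM//.
  have := ybnd j (s := i :: s) sK tT (seg c c01).
  rewrite (_ : rate_eps (i :: s) = 2 * rate_eps s)//.
  rewrite /rate_eps /= -[(size s).+1%:R]natr1 (_ : _ + 1 - _ + _ = 1 + ((size s)%:R - eta / 2 + eps)); last by ring.
  by rewrite powRD ?powRr1//; apply/implyP.
rewrite sumr_const card_ord -[_ *+ d]mulr_natl exprMn.
have -> : d%:R * (rho * (M * (2 ^+ j * rate_eps s ^+ j))) = d%:R * (M * rate_eps s ^+ j * (2 ^+ j * rho)) by ring.
have -> : (2 + d%:R) * M * rate_eps s ^+ j * (2 ^+ j * rho) =
  2 * (M * rate_eps s ^+ j * (2 ^+ j * rho)) + d%:R * (M * rate_eps s ^+ j * (2 ^+ j * rho)) by ring.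
by rewrite lerDr !mulr_ge0 ?exprn_ge0 ?(ltW (rate_eps_gt0 s)).
Qed.

Lemma space_diff_powR j s t x z rho th : (size s < K)%N -> 0 <= t <= T -> 0 <= rho -> 0 <= th <= 1 ->
  (forall c, 0 <= c <= 1 -> 2^-1 <= eucl (x + c *: (z - x)) <= 2) ->
  (forall i, `|z ord0 i - x ord0 i| <= rho) ->
  `|y j s t z - y j s t x| <= ((2 + d%:R) * M * powR rho th) * (rate_eps s * powR 2 th) ^+ j.
Proof.
move=> sK tT rho0 th01 seg xz; apply: le_trans (space_diff j sK tT rho0 seg xz) _.
have c0 : 0 <= (2 + d%:R) * M * rate_eps s ^+ j.
  by rewrite !mulr_ge0 ?exprn_ge0 ?addr_ge0 ?(ltW (rate_eps_gt0 s)).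
apply: (le_trans (ler_wpM2l c0 (min1_powR _ th01))); first by rewrite mulr_ge0 ?exprn_ge0.
rewrite powRM ?exprn_ge0// exprMn le_eqVlt; apply/orP; left; apply/eqP.
rewrite powR_expr//; ring.
Qed.

(** Up to a right angle the chord joins the points. Beyond it the chord may come close to the
    origin, but then [geod x z >= 1] and the size bounds suffice. *)
Lemma sphere_diff_powR j s t x z th : (size s < K)%N -> 0 <= t <= T -> 0 <= th <= 1 ->
  sphere x -> sphere z ->
  `|y j s t x - y j s t z| <= ((2 + d%:R) * M * powR (geod x z) th) * (rate_eps s * powR 2 th) ^+ j.
Proof.
move=> sK tT th01 sx sz; have g0 := geod_ge0 sx sz.
have [xz|xz] := leP 0 (dotp x z).
  rewrite distrC; apply: space_diff_powR => //; first by move=> c c01; exact: sphere_segment.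
  by move=> i; exact: coord_dist_geod.
have g1 : 1 <= geod x z.
  by have := sqr_dist_geod sx sz; rewrite leNgt => h; apply/negP => g1; nra.
rewrite (le_trans (ler_normB _ _))//.
rewrite (le_trans (lerD (ybnd j (ltnW sK) tT (sphere_shell sx)) (ybnd j (ltnW sK) tT (sphere_shell sz))))//.
have r0 : 0 <= rate_eps s ^+ j by rewrite exprn_ge0// ltW// rate_eps_gt0.
have p1 : 1 <= powR (geod x z) th by rewrite -(powRr0 (geod x z)) ler_powR//; case/andP: th01.
have p2 : 1 <= powR (2 : R) th ^+ j.
  have q1 : powR (2 : R) 0 <= powR 2 th by rewrite ler_powR ?ler1n//; case/andP: th01.
  by rewrite powRr0 in q1; exact: exprn_ege1.
rewrite exprMn -mulr2n.
apply: (@le_trans _ _ ((2 + d%:R) * M * 1 * (rate_eps s ^+ j * 1))).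
  have -> : M * rate_eps s ^+ j *+ 2 = 2 * (M * rate_eps s ^+ j) by rewrite mulr_natl.
  have -> : (2 + d%:R) * M * 1 * (rate_eps s ^+ j * 1) = (2 + d%:R) * (M * rate_eps s ^+ j) by ring.
  by rewrite ler_wpM2r ?lerDl// mulr_ge0.
by rewrite ler_pM ?mulr_ge0 ?addr_ge0// ler_wpM2l ?mulr_ge0 ?addr_ge0.
Qed.

Lemma path_cvg s t x : (size s)%:R + eps < eta / 2 -> (size s <= K)%N -> 0 <= t <= T -> 2^-1 <= eucl x <= 2 ->
  cvgn (series (fun j => y j s t x)) /\ `|path_deriv s t x| <= M / (1 - rate_eps s).
Proof.
move=> se sK tT hx; apply: geo_series; last by move=> j; exact: ybnd.
by apply: powR2_lt1; lra.
Qed.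

Lemma path_time s : (size s)%:R + eps < eta / 2 -> (size s <= K)%N ->
  exists2 C, 0 <= C & forall t t' x, 0 <= t <= T -> 0 <= t' <= T -> 2^-1 <= eucl x <= 2 ->
    `|path_deriv s t x - path_deriv s t' x| <= C * powR `|t - t'| a.
Proof.
move=> se sK; have r01 : 0 <= rate_eps s < 1 by apply: powR2_lt1; lra.
exists (M / (1 - rate_eps s)); first exact: geo_bound_ge0.
move=> t t' x tT t'T hx.
have [c1 _] := path_cvg se sK tT hx; have [c2 _] := path_cvg se sK t'T hx.
rewrite /path_deriv -lim_series_sub// mulrAC.
by apply: (geo_series r01 _).2 => j; rewrite mulrAC ytime.
Qed.

Lemma theta_rate s th : (size s)%:R + th + eps < eta / 2 -> 0 <= rate_eps s * powR 2 th < 1.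
Proof. by move=> h; rewrite rate_eps_theta; apply: powR2_lt1; lra. Qed.

Lemma path_space s th : 0 <= th <= 1 -> (size s)%:R + th + eps < eta / 2 -> (size s < K)%N ->
  exists2 C, 0 <= C & forall t x z rho, 0 <= t <= T -> 0 <= rho ->
    (forall c, 0 <= c <= 1 -> 2^-1 <= eucl (x + c *: (z - x)) <= 2) ->
    (forall i, `|z ord0 i - x ord0 i| <= rho) ->
    `|path_deriv s t z - path_deriv s t x| <= C * powR rho th.
Proof.
move=> th01 se sK; have r01 := theta_rate se.
exists ((2 + d%:R) * M / (1 - rate_eps s * powR 2 th)).
  by rewrite geo_bound_ge0// !mulr_ge0// addr_ge0.
move=> t x z rho tT rho0 seg xz.
have x1 : x + 1 *: (z - x) = z by rewrite scale1r addrC subrK.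
have hx : 2^-1 <= eucl x <= 2.
  by have := seg 0; rewrite scale0r addr0; apply; rewrite lexx ler01.
have hz : 2^-1 <= eucl z <= 2 by rewrite -x1 seg// ler01 lexx.
have se' : (size s)%:R + eps < eta / 2 by case/andP: th01 => *; lra.
have [c1 _] := path_cvg se' (ltnW sK) tT hx; have [c2 _] := path_cvg se' (ltnW sK) tT hz.
rewrite /path_deriv -lim_series_sub// mulrAC.
by apply: (geo_series r01 _).2 => j; exact: space_diff_powR.
Qed.

Lemma path_sphere s th : 0 <= th <= 1 -> (size s)%:R + th + eps < eta / 2 -> (size s < K)%N ->
  exists2 C, 0 <= C & forall t x z, 0 <= t <= T -> sphere x -> sphere z ->
    `|path_deriv s t x - path_deriv s t z| <= C * powR (geod x z) th.
Proof.
move=> th01 se sK; have r01 := theta_rate se.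
exists ((2 + d%:R) * M / (1 - rate_eps s * powR 2 th)).
  by rewrite geo_bound_ge0// !mulr_ge0// addr_ge0.
move=> t x z tT sx sz.
have se' : (size s)%:R + eps < eta / 2 by case/andP: th01 => *; lra.
have [c1 _] := path_cvg se' (ltnW sK) tT (sphere_shell sx); have [c2 _] := path_cvg se' (ltnW sK) tT (sphere_shell sz).
rewrite /path_deriv -lim_series_sub// mulrAC.
by apply: (geo_series r01 _).2 => j; exact: sphere_diff_powR.
Qed.

(** In each block the first-order remainder along [tau *: v] is [|tau|] times a [th]-Hölder
    increment of the next derivatives. The sum over the blocks is of order [|tau|^(1 + th)], which
    identifies the derivative of the limit directly. *)
Lemma path_grad s th t x : 0 < th <= 1 -> (size s).+1%:R + th + eps < eta / 2 -> ((size s).+1 < K)%N ->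
  0 <= t <= T -> 2^-1 < eucl x < 2 ->
  grad_at (path_deriv s t) (fun i => path_deriv (i :: s) t x) x.
Proof.
move=> /andP[th0 th1] se sK tT hx v.
have [del del0 Hdel] := shell_ball hx.
pose V := \sum_i `|v ord0 i| + 1.
have vV i : `|v ord0 i| <= V.
  by rewrite /V (bigD1 i)//= -addrA lerDl addr_ge0// sumr_ge0.
have V0 : 0 < V by rewrite ltr_wpDl// sumr_ge0.
have se0 : (size s)%:R + 1 + th + eps < eta / 2 by rewrite natr1.
have se1 : (size s)%:R + eps < eta / 2 by lra.
have se2 i : (size (i :: s))%:R + eps < eta / 2 by rewrite /= -[(size s).+1%:R]natr1; lra.
pose r := powR 2 ((size s).+1%:R + th - eta / 2 + eps).
have r01 : 0 <= r < 1 by apply: powR2_lt1; lra.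
pose C := (2 + d%:R) * M * powR V th * V / (1 - r).
have C0 : 0 <= C.
  by rewrite geo_bound_ge0// !mulr_ge0 ?powR_ge0 ?(ltW V0)// addr_ge0.
apply: (@is_derive_taylor _ _ _ x v _ C th (del / V)) => //; first exact: divr_gt0.
move=> tau taud.
have tV : `|tau| * V < del by rewrite -ltr_pdivlMr.
have seg c : 0 <= c <= 1 -> 2^-1 < eucl (x + c *: (tau *: v)) < 2.
  move=> /andP[c0 c1]; apply: Hdel => i; rewrite !mxE addrAC subrr add0r !normrM (ger0_norm c0).
  apply: le_lt_trans tV; rewrite -[leRHS]mul1r ler_pM ?mulr_ge0// ler_wpM2l//.
have seg' c : 0 <= c <= 1 -> 2^-1 <= eucl (x + c *: (tau *: v)) <= 2.
  by move=> /seg/andP[/ltW -> /ltW ->].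
have hx' : 2^-1 <= eucl x <= 2 by case/andP: hx => /ltW -> /ltW ->.
have hz' : 2^-1 <= eucl (x + tau *: v) <= 2.
  by have := seg' 1; rewrite scale1r; apply; rewrite ler01 lexx.
have [cx _] := path_cvg se1 (ltnW (ltnW sK)) tT hx'.
have [cz _] := path_cvg se1 (ltnW (ltnW sK)) tT hz'.
have ci i : cvgn (series (fun j => y j (i :: s) t x)).
  by have [] := path_cvg (se2 i) (ltnW sK) tT hx'.
have [cS ES] := lim_series_lin (index_enum 'I_d) (fun i => v ord0 i) (w := fun i j => y j (i :: s) t x) ci.
have [cT ET] := lim_series_scale tau cS.
have cB : cvgn (series (fun j => y j s t (x + tau *: v) - y j s t x)) by exact: is_cvg_seriesB.
rewrite /path_deriv -ES -ET -lim_series_sub// -lim_series_sub//.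
have -> : C * `|tau| * powR `|tau| th = (2 + d%:R) * M * powR (`|tau| * V) th * (`|tau| * V) / (1 - r).
  by rewrite powRM ?(ltW V0)// /C; ring.
apply: (geo_series r01 _).2 => j.
have [c c01 E] := @mean_value_segment R d (y j s t) (fun z i => y j (i :: s) t z) x (tau *: v)
  (fun c c01 => ygrad j s t (shell_neq0 (seg' c c01))).
rewrite E mulr_sumr -sumrB (le_trans (ler_norm_sum _ _ _))//.
have Dk i : `|y j (i :: s) t (x + c *: (tau *: v)) - y j (i :: s) t x| <=
    (2 + d%:R) * M * powR (`|tau| * V) th * r ^+ j.
  rewrite /r -(rate_eps_theta (i :: s) th); apply: space_diff_powR => //.
  - by rewrite mulr_ge0// ltW.
  - by rewrite (ltW th0).
  - move=> c' /andP[c'0 c'1]; have -> : x + c' *: (x + c *: (tau *: v) - x) = x + (c' * c) *: (tau *: v).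
      by rewrite [x + c *: (tau *: v)]addrC addrK [c' *: _]scalerA.
    case/andP: c01 => c0 c1; apply: seg'; rewrite mulr_ge0//= -[leRHS]mul1r ler_pM//.
  - move=> i'; rewrite !mxE addrAC subrr add0r !normrM; case/andP: c01 => c0 c1.
    by rewrite (ger0_norm c0) -[leRHS]mul1r ler_pM ?mulr_ge0// ler_wpM2l.
apply: (@le_trans _ _ (\sum_i `|tau| * `|v ord0 i| * ((2 + d%:R) * M * powR (`|tau| * V) th * r ^+ j))).
  apply: ler_sum => i _; rewrite !mxE.
  have -> : tau * v ord0 i * y j (i :: s) t (x + c *: (tau *: v)) - tau * (v ord0 i * y j (i :: s) t x) =
    tau * v ord0 i * (y j (i :: s) t (x + c *: (tau *: v)) - y j (i :: s) t x) by ring.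
  by rewrite !normrM ler_wpM2l// mulr_ge0.
rewrite -mulr_suml -mulr_sumr.
have Z0 : 0 <= (2 + d%:R) * M * powR (`|tau| * V) th * r ^+ j.
  by rewrite !mulr_ge0 ?addr_ge0 ?powR_ge0// exprn_ge0//; case/andP: r01.
have -> : (2 + d%:R) * M * powR (`|tau| * V) th * (`|tau| * V) * r ^+ j =
  `|tau| * V * ((2 + d%:R) * M * powR (`|tau| * V) th * r ^+ j) by ring.
by rewrite ler_wpM2r// ler_wpM2l// /V lerDl.
Qed.

Lemma shell_near x : 2^-1 < eucl x < 2 -> \forall z \near x, 2^-1 < eucl z < 2.
Proof.
by move=> /shell_ball[del del0 H]; apply: filterS (near_coord x del0).
Qed.

Lemma path_continuous s th t x : 0 < th <= 1 -> (size s)%:R + th + eps < eta / 2 -> (size s < K)%N ->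
  0 <= t <= T -> 2^-1 < eucl x < 2 -> {for x, continuous (path_deriv s t)}.
Proof.
move=> /andP[th0 th1] se sK tT hx; have th01 : 0 <= th <= 1 by rewrite ltW.
have [C C0 HC] := path_space th01 se sK; have [del del0 Hdel] := shell_ball hx.
apply/(@cvgrPdist_lt _ _ _ (nbhs x)) => e e0; have [d1 d10 Hd1] := powR_small C0 th0 e0.
pose rho := Num.min del d1 / 2.
have m0 : 0 < Num.min del d1 by rewrite lt_min del0.
have rho0 : 0 < rho by rewrite divr_gt0.
have rlt : rho < Num.min del d1 by rewrite ltr_pdivrMr// mulr_natr mulr2n ltrDl.
apply: filterS (near_coord x rho0) => z xz.
have xzi i : `|z ord0 i - x ord0 i| <= rho by rewrite ltW.
move: rlt; rewrite lt_min => /andP[r1 r2].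
rewrite /= distrC (le_lt_trans (HC t x z rho tT (ltW rho0) _ xzi))//.
  move=> c /andP[c0 c1]; suff /andP[/ltW -> /ltW ->] : 2^-1 < eucl (x + c *: (z - x)) < 2 by [].
  apply: Hdel => i; rewrite !mxE addrAC subrr add0r normrM (ger0_norm c0).
  by apply: le_lt_trans r1; rewrite -[leRHS]mul1r ler_pM.
by apply: Hd1; rewrite (ltW rho0).
Qed.

Section Holder.
Variable f : R -> 'rV[R]_d -> R.
Variable b : R.
Hypothesis yhomog : forall j t x, x != 0 -> y j [::] t ((eucl x)^-1 *: x) = y j [::] t x.
Hypothesis fE : forall t x, 0 <= t <= T -> sphere x -> f t x = path_deriv [::] t x.
Hypothesis b0 : 0 < b.
Hypothesis be : b + eps < eta / 2.
Hypothesis bK : b + 1 < K%:R.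
Hypothesis eps0 : 0 < eps.

Lemma holder_sphere_path t : 0 <= t <= T -> holder_sphere b (f t).
Proof.
move=> tT; pose fh x := f t ((eucl x)^-1 *: x).
have fhE x : x != 0 -> fh x = path_deriv [::] t x.
  move=> x0; rewrite /fh fE//; last exact: sphere_normalize.
  by rewrite /path_deriv; congr (limn (series _)); apply/funext => j; exact: yhomog.
have exk : exists n, b <= n.+1%:R.
  by exists (Num.trunc b); rewrite ltW// truncnS_gt.
(* Minimality puts [b - k] into the interval from 0 excluded to 1 included, also for integral
   [b]. *)
case: (ex_minnP exk) => k bk kmin {exk}.
have kb : k%:R < b.
  by case: k bk kmin => [//|k] _ kmin; rewrite ltNge; apply/negP => /kmin; rewrite ltnn.
have kK : (k.+1 < K)%N by rewrite -(ltr_nat R) (le_lt_trans _ bK)// -[k.+1%:R]natr1 lerD2r ltW.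
pose th := b - k%:R.
have th0 : 0 < th <= 1 by rewrite /th subr_gt0 kb/= lerBlDl natr1.
have sz n : (n <= k)%N -> n%:R + th + eps < eta / 2.
  by rewrite -(ler_nat R) /th; have := be; lra.
(* The shell is open, so the identity for [s] holds near each point and can be differentiated once
   more. *)
have key s x : (size s <= k)%N -> 2^-1 < eucl x < 2 -> iter_partial s fh x = path_deriv s t x.
  elim: s x => [|i s IH] x sk hx.
    by rewrite /= fhE// shell_neq0// shell_oc.
  have G := path_grad th0 (sz _ sk) (leq_ltn_trans sk (ltnW kK)) tT hx.
  have N : \near x, path_deriv s t x = iter_partial s fh x.
    by apply: filterS (shell_near hx) => z hz; rewrite IH// ltnW.
  have [_ <-] := grad_at_partial i (grad_at_near N G).
  by [].
have der s i x : (size s < k)%N -> 2^-1 < eucl x < 2 -> derivable (iter_partial s fh) x (evec R i).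
  move=> sk hx; have G := path_grad th0 (sz _ sk) (leq_ltn_trans sk (ltnW kK)) tT hx.
  have N : \near x, path_deriv s t x = iter_partial s fh x.
    by apply: filterS (shell_near hx) => z hz; rewrite key// ltnW.
  by have [] := grad_at_partial i (grad_at_near N G).
have cont s x : (size s <= k)%N -> 2^-1 < eucl x < 2 -> {for x, continuous (iter_partial s fh)}.
  move=> sk hx; have N : \near x, path_deriv s t x = iter_partial s fh x.
    by apply: filterS (shell_near hx) => z hz; rewrite key.
  have h := path_continuous th0 (sz _ sk) (leq_ltn_trans sk (ltnW kK)) tT hx.
  suff : iter_partial s fh z @[z --> x] --> path_deriv s t x by rewrite -(key _ _ sk hx).
  move=> B /h hB; apply: (@filterS2 _ (nbhs x) _ _ _ _ _ N hB) => z /= <- //.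
exists k; split; first by rewrite kb natr1.
split=> [s sk x hx|]; first by split=> [|sk' i]; [exact: cont|exact: der].
have [s C C' HC CC' sk x z sx sz'|s|C HC] := @uniform_const R _ (words 'I_d k) (fun s C => (size s <= k)%N ->
    forall x z, sphere x -> sphere z -> `|path_deriv s t x| <= C /\
      ((size s = k)%N -> `|path_deriv s t x - path_deriv s t z| <= C * powR (geod x z) th)).
- have [h1 h2] := HC sk x z sx sz'; split; first exact: le_trans CC'.
  by move=> /h2 h; rewrite (le_trans h)// ler_wpM2r ?powR_ge0.
- have [sk|sk] := leqP (size s) k; last by exists 0.
  have sK : (size s < K)%N by exact: leq_ltn_trans sk (ltnW kK).
  have se : (size s)%:R + eps < eta / 2 by have := sz _ sk; case/andP: th0; lra.
  have th01 : 0 <= th <= 1 by case/andP: th0 => /ltW -> ->.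
  have [C C0 HC] := path_sphere th01 (sz _ sk) sK.
  exists (Num.max C (M / (1 - rate_eps s))) => _ x z sx sz'; split.
    by have [_ h] := path_cvg se (ltnW sK) tT (sphere_shell sx); rewrite (le_trans h)// le_max lexx orbT.
  by move=> _; rewrite (le_trans (HC t x z tT sx sz'))// ler_wpM2r ?powR_ge0// le_max lexx.
exists C => s sk x z sx sz'; have := HC s (mem_words sk) sk x z sx sz'.
by rewrite -!key//; exact: sphere_oshell.
Qed.

(** Lowers the time exponent from [a] to [a'] and to [Num.min a' b]; time increments do not exceed
    [T]. *)
Lemma powR_compare (u g c : R) : 0 <= u -> 0 < g <= c -> c <= 1 -> u <= T -> powR u c <= (1 + T) * powR u g.
Proof.
move=> u0 /andP[g0 gc] c1 uT.
have [->|un] := eqVneq u 0.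
  by rewrite !powR0 ?mulr0// ?lt0r_neq0// (lt_le_trans g0).
have E : powR u c = powR u (c - g) * powR u g.
  by rewrite -powRD ?subrK//; apply/implyP.
rewrite E ler_wpM2r ?powR_ge0// (le_trans (_ : _ <= powR (1 + T) (c - g)))//.
  by rewrite ge0_ler_powR ?nnegrE ?subr_ge0//; [rewrite addr_ge0// ltW|rewrite (le_trans uT)// lerDr].
rewrite -[leRHS]powRr1 ?addr_ge0 ?(ltW T0)// ler_powR// ?lerDl ?(ltW T0)//; lra.
Qed.

(** A joint increment splits into a time step at fixed [x] and a space step at fixed [t'], both
    measured with the exponent [Num.min a' b]. *)
Lemma holder_TS_path a' : 0 < a' <= a -> holder_TS T a' b f.
Proof.
move=> /andP[a'0 a'a]; case/andP: a01 => a0 a1.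
have K0 : (0 < K)%N by rewrite -(ltr_nat R) (lt_trans _ bK)// addr_gt0.
have e1 : (size ([::] : seq 'I_d))%:R + eps < eta / 2 by rewrite /=; have := be; have := b0; lra.
have [C1 C10 HC1] := path_time e1 (leq0n K).
pose B := M / (1 - rate_eps [::]).
have HB t x : 0 <= t <= T -> sphere x -> `|f t x| <= B.
  move=> tT sx; rewrite fE//; exact: (path_cvg e1 (leq0n K) tT (sphere_shell sx)).2.
have tdist t t' : 0 <= t <= T -> 0 <= t' <= T -> `|t - t'| <= T.
  by move=> /andP[? ?] /andP[? ?]; rewrite ler_norml; apply/andP; split; lra.
have HT g t t' x : 0 < g <= a -> 0 <= t <= T -> 0 <= t' <= T -> sphere x ->
    `|f t x - f t' x| <= C1 * (1 + T) * powR `|t - t'| g.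
  move=> ga tT t'T sx; rewrite !fE// (le_trans (HC1 t t' x tT t'T (sphere_shell sx)))//.
  by rewrite -mulrA ler_wpM2l// powR_compare// tdist.
split; [|split].
- pose g := Num.min a' b.
  have g0 : 0 < g by rewrite lt_min a'0.
  have ga' : g <= a' by rewrite ge_min lexx.
  have gb : g <= b by rewrite ge_min lexx orbT.
  have g1 : 0 <= g <= 1 by rewrite ltW//=; lra.
  have e2 : (size ([::] : seq 'I_d))%:R + g + eps < eta / 2 by rewrite /=; have := be; have := b0; lra.
  have [C2 C20 HC2] := path_sphere g1 e2 K0.
  exists (Num.max B (C1 * (1 + T) + C2)) => -[t x] [t' x'] [/= tT sx] [/= t'T sx']; split.
    by rewrite (le_trans (HB t x tT sx))// le_max lexx.
  have gd := geod_ge0 sx sx'.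
  pose D := `|t - t'| + geod x x'; have D0 : 0 <= D by rewrite addr_ge0.
  have h1 : `|f t x - f t' x| <= C1 * (1 + T) * powR D g.
    rewrite (le_trans (HT g t t' x _ tT t'T sx)) ?g0 ?(le_trans ga')//.
    rewrite ler_wpM2l ?mulr_ge0 ?addr_ge0 ?(ltW T0)//.
    by rewrite ge0_ler_powR ?nnegrE ?(ltW g0) ?addr_ge0 ?lerDl.
  have h2 : `|f t' x - f t' x'| <= C2 * powR D g.
    rewrite !fE// (le_trans (HC2 t' x x' t'T sx sx'))// ler_wpM2l//.
    by rewrite ge0_ler_powR ?nnegrE ?(ltW g0) ?addr_ge0 ?lerDr.
  rewrite (le_trans (ler_distD (f t' x) _ _))// (le_trans (lerD h1 h2))// -mulrDl.
  by rewrite ler_wpM2r ?powR_ge0// le_max lexx orbT.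
- move=> x sx; exists (Num.max B (C1 * (1 + T))) => t t' tT t'T; split.
    by rewrite (le_trans (HB t x tT sx))// le_max lexx.
  rewrite (le_trans (HT a' t t' x _ tT t'T sx)) ?a'0//.
  by rewrite ler_wpM2r ?powR_ge0// le_max lexx orbT.
- by move=> t tT; exact: holder_sphere_path.
Qed.

End Holder.
End RandomSeriesPath.

(** * The field *)

Section QFractionalBrownianMotion.
Variables (R : realType) (e : nat) (H T eta : R) (A : nat -> R).
Local Notation d := e.+2.
Variable S : nat -> nat -> 'rV[R]_d -> R.
Variables (dT : measure_display) (Om : measurableType dT) (P : probability Om R).
Variable beta : nat * nat -> R -> Om -> R.
Hypothesis e0 : (0 < e)%N.
Hypothesis H01 : 0 < H < 1.
Hypothesis T0 : 0 < T.
Hypothesis eta0 : 0 < eta.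
Hypothesis A0 : forall l, 0 <= A l.
Hypothesis HA : (\sum_(0 <= l <oo) (A l * powR (l%:R) (d%:R - 2 + eta))%:E < +oo)%E.
Hypothesis HS : sph_harm_basis S.
Let J : set (nat * nat) := [set k | (1 <= k.2 <= hdim k.1 d)%N].
Hypothesis fB : forall k, J k -> is_fBm P T H (beta k).
Hypothesis iB : indep_procs P T J beta.
Implicit Types (t : R) (x : 'rV[R]_d) (s : seq 'I_d) (w : Om) (j l m : nat).

Let H0 : 0 < H. Proof. by case/andP: H01. Qed.

(** In the hypothesis the term [l = 0] has weight 0, so [A 0] is added separately; for [l >= 1] one
    has [l + 1 <= 2 l]. *)
Lemma weighted_sum_bounded : exists W, forall n, \sum_(0 <= l < n) A l * powR l.+1%:R (e%:R + eta) <= W.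
Proof.
pose p := e%:R + eta; have p0 : 0 < p by rewrite ltr_wpDl.
have pE : d%:R - 2 + eta = p by rewrite /p -addn2 natrD addrK.
pose u l := A l * powR l%:R p.
have u0 l : 0 <= u l by rewrite mulr_ge0 ?powR_ge0.
have HA' := HA; rewrite pE in HA'.
pose V := fine (\sum_(0 <= l <oo) (u l)%:E)%E.
have VE n : \sum_(0 <= l < n) u l <= V.
  rewrite -lee_fin fineK; last first.
    by rewrite ge0_fin_numE//; apply: nneseries_ge0 => l _ _; rewrite lee_fin.
  rewrite -sumEFin; apply: (@nneseries_lim_ge R (fun l => (u l)%:E) xpredT 0 n) => l _ _.
  by rewrite lee_fin.
exists (A 0%N + powR 2 p * V) => n.
have h l : A l * powR l.+1%:R p <= (if l == 0%N then A 0%N else 0) + powR 2 p * u l.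
  case: l => [|l] /=; first by rewrite powR1 mulr1 lerDl mulr_ge0 ?powR_ge0.
  rewrite add0r /u mulrCA ler_wpM2l// -powRM//.
  by rewrite ge0_ler_powR ?nnegrE ?(ltW p0)// -natrM ler_nat mul2n -addnn addSn ltnS leq_addl.
apply: (@le_trans _ _ (\sum_(0 <= l < n) ((if l == 0%N then A 0%N else 0) + powR 2 p * u l))).
  by apply: ler_sum => l _; exact: h.
rewrite big_split/= -mulr_sumr lerD// ?ler_wpM2l ?powR_ge0//.
case: n => [|n]; first by rewrite big_nil.
by rewrite big_nat_recl//= big1 ?addr0.
Qed.

(** Large enough for [b' + 1 < K] whenever [b' < eta / 2], which leaves room for the additional
    derivative. *)
Let K := (Num.trunc (eta / 2)).+2.
(** [a_ q] increases to [H] and [eps_ q] decreases to 0; the shift to [q + 2] keeps [a_ q]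
    positive. *)
Let a_ (q : nat) := H * (1 - q.+2%:R^-1).
Let eps_ (q : nat) : R := q.+1%:R^-1.

Let blockJ j : {subset block e j <= J}.
Proof. by move=> k; rewrite mem_block => /andP[_ h]; exact/mem_set. Qed.

Definition block_field (b : R -> nat * nat -> R) j s t x :=
  \sum_(k <- block e j) sph_coef S A s x k * b t k.

Definition regular_path (b : R -> nat * nat -> R) (a eps M : R) :=
  (forall j s t x, (size s <= K)%N -> 0 <= t <= T -> 2^-1 <= eucl x <= 2 ->
    `|block_field b j s t x| <= M * rate_eps eta eps s ^+ j) /\
  (forall j s t t' x, (size s <= K)%N -> 0 <= t <= T -> 0 <= t' <= T -> 2^-1 <= eucl x <= 2 ->
    `|block_field b j s t x - block_field b j s t' x| <=
      M * rate_eps eta eps s ^+ j * powR `|t - t'| a).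

(** [net_bound] reduces the bounds uniform in [x] to the combinations treated by [path_bound]. It is
    applied to the values of [beta] and again to their time increments, and the two growth factors
    multiply to [rate_eps]. *)
Lemma ae_regular : {ae P, forall w, forall q, exists2 M, 0 <= M &
  regular_path (fun t k => beta k t w) (a_ q) (eps_ q) M}.
Proof.
have [W AW] := weighted_sum_bounded.
have [n [L [c [D [C [[L1 c0 D0 nD C0] HL]]]]]] := net_bound HS e0 A0 eta0 AW K.
apply: ae_foralln => q.
have q1 : (q.+2%:R^-1 : R) < 1 by rewrite invf_lt1// ltr1n.
have q0 : 0 < (q.+2%:R^-1 : R) by rewrite invr_gt0.
have aq : 0 < a_ q < H.
  by rewrite /a_ mulr_gt0 ?subr_gt0//= gtr_pMr// gtrBl.
have eq0 : 0 < eps_ q by rewrite invr_gt0.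
apply: filterS (path_bound T0 H0 fB iB (@uniq_block e) blockJ L1 c0 D0 nD aq eq0).
move=> w [M M0 HM]; exists (C * M); first exact: mulr_ge0.
have rE s j Y : C * rate eta s ^+ j * (M * powR 2 (eps_ q) ^+ j * Y) = C * M * rate_eps eta (eps_ q) s ^+ j * Y.
  by rewrite /rate_eps powRD ?exprMn -/(rate eta s); [ring|apply/implyP].
split=> [j s t x sK tT hx|j s t t' x sK tT t'T hx].
  have := HL j (fun k => beta k t w) (M * powR 2 (eps_ q) ^+ j * 1) _ s x sK hx.
  by rewrite rE !mulr1; apply=> i ij; exact: (HM j i ij).1.
have := HL j (fun k => beta k t w - beta k t' w) (M * powR 2 (eps_ q) ^+ j * powR `|t - t'| (a_ q)) _ s x sK hx.
rewrite rE; have sB (g : nat * nat -> R) : \sum_(k <- block e j) g k * (beta k t w - beta k t' w) =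
    \sum_(k <- block e j) g k * beta k t w - \sum_(k <- block e j) g k * beta k t' w.
  by rewrite -sumrB; apply: eq_bigr => k _; rewrite mulrBr.
by rewrite sB; apply => i ij; rewrite sB; exact: (HM j i ij).2.
Qed.

Lemma block_field_grad b j s t x : x != 0 ->
  grad_at (block_field b j s t) (fun i => block_field b j (i :: s) t x) x.
Proof.
move=> x0; rewrite /block_field.
pose c k := if k \in block e j then b t k * Num.sqrt (A k.1) else 0.
have E s' : (fun x => \sum_(k <- block e j) sph_coef S A s' x k * b t k) =
    fun x => \sum_(k <- block e j) c k * iter_partial s' (zero_homog (S k.1 k.2)) x.
  by apply/funext => z; apply: eq_big_seq => k kB; rewrite /c kB /sph_coef; ring.
rewrite E; apply: (@grad_at_ext _ _ _ (fun i => \sum_(k <- block e j) c k * iter_partial (i :: s) (zero_homog (S k.1 k.2)) x)).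
  by move=> i; have /(congr1 (fun g => g x)) := E (i :: s).
apply: grad_at_sum => k; rewrite /c; case: (boolP (k \in block e j)) => kB; last first.
  move=> v; rewrite (_ : (fun y => _) = cst 0); last by apply/funext => z; rewrite mul0r.
  by rewrite big1 => [|i _]; [exact: is_derive_cst|rewrite mul0r mulr0].
by apply: grad_atZ; apply: sph_grad => //; exact: set_mem (blockJ kB).
Qed.

Lemma block_field_homog b j t x : x != 0 ->
  block_field b j [::] t ((eucl x)^-1 *: x) = block_field b j [::] t x.
Proof.
move=> x0; apply: eq_bigr => k _; congr (_ * _ * _); rewrite /= /zero_homog.
by rewrite (sphere_eucl (sphere_normalize x0)) invr1 scale1r.
Qed.

Lemma regular_holder b (f : R -> 'rV[R]_d -> R) :
  (forall q, exists2 M, 0 <= M & regular_path b (a_ q) (eps_ q) M) ->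
  (forall t x, f t x = path_deriv (block_field b) [::] t x) -> holder_TS_minus T H (eta / 2) f.
Proof.
move=> reg fE a' b' /andP[a'0 a'H] /andP[b'0 b'eta].
have /andP[_ H1] := H01.
(* An index with [1 / (q + 1) < del] gives both [a' <= a_ q] and [b' + eps_ q < eta / 2]. *)
pose del := Num.min ((H - a') / H) (eta / 2 - b').
have del0 : 0 < del by rewrite lt_min divr_gt0 ?subr_gt0.
pose q := Num.trunc del^-1.
have qd : (q.+1%:R^-1 : R) < del by rewrite invf_plt ?posrE// truncnS_gt.
have [M M0 [yb yt]] := reg q.
have q2 : (q.+2%:R^-1 : R) <= q.+1%:R^-1 by rewrite lef_pV2 ?posrE// ler_nat.
have q3 : 0 < (q.+2%:R^-1 : R) by rewrite invr_gt0.
have q4 : (q.+2%:R^-1 : R) < 1 by rewrite invf_lt1// ltr1n.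
have d1 : del <= (H - a') / H by rewrite ge_min lexx.
have d2 : del <= eta / 2 - b' by rewrite ge_min lexx orbT.
apply: (holder_TS_path (block_field_grad b) T0 _ M0 yb yt (@block_field_homog b)) => //.
- rewrite /a_ mulr_gt0 ?subr_gt0//=.
  by rewrite -[leRHS]mulr1 ler_pM ?subr_ge0 ?(ltW H0) ?(ltW q4) ?(ltW H1)// gerBl ltW.
- by rewrite -ltrBrDl; exact: lt_le_trans qd d2.
- by rewrite /K -[X in _ < X]natr1 ltrD2r (lt_trans b'eta)// truncnS_gt.
- rewrite a'0 /=.
  have h : q.+2%:R^-1 <= (H - a') / H by rewrite (le_trans q2)// (le_trans (ltW qd)).
  rewrite /a_ mulrBr mulr1 lerBrDl -lerBrDr.
  by move: h; rewrite ler_pdivlMr// mulrC.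
Qed.

(** [G] has to be measurable for the truncated field to be a random variable. *)
Let regular_set_ex : exists2 G : set Om, measurable G & P (~` G) = 0 /\
  forall w, G w -> forall q, exists2 M, 0 <= M & regular_path (fun t k => beta k t w) (a_ q) (eps_ q) M.
Proof.
have [N [mN PN HN]] := ae_regular; exists (~` N); first exact: measurableC.
split; first by rewrite setCK.
by move=> w Nw; apply: contrapT => h; apply: Nw; apply: HN.
Qed.

Let G := projT1 (cid2 regular_set_ex).
Let mG : measurable G. Proof. by rewrite /G; case: cid2. Qed.
Let PG : P (~` G) = 0. Proof. by rewrite /G; case: cid2 => ? ? []. Qed.
Let regG w : G w -> forall q, exists2 M, 0 <= M & regular_path (fun t k => beta k t w) (a_ q) (eps_ q) M.
Proof. by rewrite /G; case: cid2 => G' _ [_ h] /h. Qed.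

(** Cutting the coefficients off outside [G] makes every path regular, and every series
    convergent. *)
Let bG w t k : R := \1_G w * beta k t w.
Definition qfbm t x w : R := path_deriv (block_field (bG w)) [::] t x.

Let bG_regular w : forall q, exists2 M, 0 <= M & regular_path (bG w) (a_ q) (eps_ q) M.
Proof.
move=> q; have [Gw|Gw] := pselect (G w).
  have [M M0 HM] := regG Gw q; exists M => //.
  by rewrite (_ : bG w = fun t k => beta k t w)//; apply/funext => t; apply/funext => k; rewrite /bG indicE mem_set// mul1r.
have E j s t x : block_field (bG w) j s t x = 0.
  by rewrite /block_field big1// => k _; rewrite /bG indicE memNset// mul0r mulr0.
by exists 0 => //; split=> *; rewrite !E ?subrr normr0 !mul0r.
Qed.

Lemma qfbm_holder w : holder_TS_minus T H (eta / 2) (fun t x => qfbm t x w).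
Proof. exact: regular_holder (bG_regular w) _. Qed.

Let qfbm_cvg w t x : 0 <= t <= T -> sphere x ->
  series (fun j => block_field (bG w) j [::] t x) @ \oo --> qfbm t x w.
Proof.
move=> tT sx; pose q := Num.trunc (eta / 2)^-1.
have qd : (q.+1%:R^-1 : R) < eta / 2 by rewrite invf_plt ?posrE ?divr_gt0// truncnS_gt.
have [M M0 [yb _]] := bG_regular w q.
have [] := @path_cvg R d T eta K (block_field (bG w)) (eps_ q) M yb [::] t x _ (leq0n _) tT (sphere_shell sx).
  by rewrite /= add0r.
by [].
Qed.

Let beta_measurable k t : J k -> 0 <= t <= T -> measurable_fun setT (beta k t).
Proof. by move=> Jk tT; have [_ [mX _]] := fB Jk; exact: mX. Qed.

Lemma measurable_qfbm t x : 0 <= t <= T -> sphere x -> measurable_fun setT (qfbm t x).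
Proof.
move=> tT sx.
apply: (@measurable_fun_cvg _ _ _ setT (fun n w => series (fun j => block_field (bG w) j [::] t x) n)); last first.
  by move=> w _; exact: qfbm_cvg.
move=> n; rewrite /series /=; apply: measurable_sum => j; rewrite /block_field.
rewrite (_ : (fun w => _) = fun w => \sum_(k <- block e j) (if k \in block e j then sph_coef S A [::] x k * bG w t k else 0)); last first.
  by apply/funext => w; apply: eq_big_seq => k ->.
apply: measurable_sum => k; case: (boolP (k \in block e j)) => kB; last exact: measurable_cst.
apply: measurable_funM; first exact: measurable_cst.
by apply: measurable_funM; [exact: measurable_indic|exact: beta_measurable (set_mem (blockJ kB)) tT].
Qed.

Definition partial_field n t x w : R :=
  \sum_(0 <= l < n) \sum_(1 <= m < (hdim l d).+1) Num.sqrt (A l) * beta (l, m) t w * S l m x.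

Lemma measurable_partial_field n t x : 0 <= t <= T -> measurable_fun setT (partial_field n t x).
Proof.
move=> tT; apply: measurable_sum => l; rewrite (_ : (fun w => _) = fun w =>
    \sum_(1 <= m < (hdim l d).+1) (if (1 <= m <= hdim l d)%N then Num.sqrt (A l) * beta (l, m) t w * S l m x else 0)); last first.
  by apply/funext => w; apply: eq_big_nat => m; rewrite ltnS => ->.
apply: measurable_sum => m; case: (boolP (1 <= m <= hdim l d)%N) => hm; last exact: measurable_cst.
apply: measurable_funM; last exact: measurable_cst.
by apply: measurable_funM; [exact: measurable_cst|exact: beta_measurable].
Qed.

(** The first [n] blocks exhaust the degrees [l < 2^n - 1]; this links the dyadic series to the
    partial sums of the expansion. *)
Lemma series_block_field w n t x : sphere x ->
  series (fun j => block_field (bG w) j [::] t x) n = \1_G w * partial_field (2 ^ n).-1 t x w.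
Proof.
move=> sx; rewrite /series /= /partial_field; elim: n => [|n IH].
  by rewrite !big_nil mulr0.
rewrite big_nat_recr//= IH (@big_cat_nat _ _ _ (2 ^ n).-1 0 (2 ^ n.+1).-1)//=; last first.
  by rewrite -!subn1 leq_sub2r// leq_exp2l.
rewrite mulrDr; congr (_ + _); rewrite /block_field sum_block mulr_sumr; apply: eq_bigr => l _.
rewrite mulr_sumr; apply: eq_bigr => m _; rewrite /sph_coef /bG /= /zero_homog (sphere_eucl sx) invr1 scale1r.
by ring.
Qed.

(** The second moment of a tail is governed by [A l * hdim l d], of order [A l * (l + 1)^e]; the
    surplus [eta] in the summable weight yields the rate. *)
Lemma partial_field_diff : exists2 C : R, 0 <= C & forall N n t x, (N <= n)%N -> 0 <= t <= T -> sphere x ->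
  (\int[P]_w ((partial_field n t x w - partial_field N t x w) ^+ 2)%:E <= (C * powR N.+1%:R^-1 eta)%:E)%E.
Proof.
have [W AW] := weighted_sum_bounded; have [c c0 Hc] := sph_sum_sqr HS e0.
have W0 : 0 <= W by have := AW 0%N; rewrite big_nil.
(* The outer 2 is the constant of the moment bound for [p = 1], the inner one comes from
   [hdim_le]. *)
exists (2 * (2 * c * W * powR T (2 * H))).
  by rewrite !mulr_ge0 ?powR_ge0.
move=> N n t x Nn tT sx.
pose ks := [seq (l, m) | l <- iota N (n - N), m <- iota 1 (hdim l d)].
have uks : uniq ks.
  apply: allpairs_uniq_dep; [exact: iota_uniq|by move=> l _; exact: iota_uniq|].
  by move=> [l m] [l' m'] _ _ /= [-> ->].
have ksJ : {subset ks <= J}.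
  move=> k /allpairsPdep[l [m [_ + ->]]]; rewrite mem_iota => hm; apply/mem_set.
  by rewrite /J /=; move: hm; rewrite add1n ltnS.
have sumE (F : nat * nat -> R) : \sum_(k <- ks) F k = \sum_(N <= l < n) \sum_(1 <= m < (hdim l d).+1) F (l, m).
  by rewrite big_allpairs_dep; apply: eq_bigr => l _; rewrite /index_iota subn1.
pose a (k : nat * nat) := Num.sqrt (A k.1) * S k.1 k.2 x.
have E w : partial_field n t x w - partial_field N t x w = \sum_(k <- ks) a k * beta k t w.
  rewrite sumE /partial_field (@big_cat_nat _ _ _ N 0 n)//= addrAC subrr add0r.
  by apply: eq_bigr => l _; apply: eq_bigr => m _; rewrite /a /=; ring.
under eq_integral do rewrite E.
apply: (le_trans (@fBm_moment _ _ _ P _ J T H beta H0 fB iB ks a t 1 uks ksJ tT isT)).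
rewrite lee_fin !expr1 expr1n mulr1 (_ : 1`!%:R = 1)// divr1 -mulrA ler_wpM2l//.
have S2 : \sum_(k <- ks) a k ^+ 2 <= 2 * c * W * powR N.+1%:R^-1 eta.
  rewrite sumE; apply: (@le_trans _ _ (\sum_(N <= l < n) 2 * c * powR N.+1%:R^-1 eta * (A l * powR l.+1%:R (e%:R + eta)))); last first.
    rewrite -mulr_sumr [leRHS]mulrAC ler_wpM2l ?mulr_ge0 ?powR_ge0//.
    apply: le_trans (AW n); rewrite [leRHS](@big_cat_nat _ _ _ N)//= lerDr.
    by apply: sumr_ge0 => l _; rewrite mulr_ge0 ?powR_ge0.
  rewrite big_nat [leRHS]big_nat; apply: ler_sum => l /andP[Nl _].
  under eq_bigr do rewrite /a /= exprMn sqr_sqrtr//.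
  have Sx : \sum_(1 <= m < (hdim l d).+1) S l m x ^+ 2 = (hdim l d)%:R * c.
    rewrite -(Hc l x (sphere_neq0 sx)); apply: eq_bigr => m _.
    by rewrite /zero_homog (sphere_eucl sx) invr1 scale1r.
  rewrite -mulr_sumr Sx.
  have hd : (hdim l d)%:R <= 2 * l.+1%:R ^+ e :> R by rewrite -natrX -natrM ler_nat hdim_le.
  have l0 : 0 < l.+1%:R :> R by rewrite ltr0n.
  have p1 : 1 <= powR N.+1%:R^-1 eta * powR l.+1%:R eta :> R.
    rewrite -powRM ?invr_ge0 ?ler0n//.
    have q1 : 1 <= N.+1%:R^-1 * l.+1%:R :> R by rewrite ler_pdivlMl ?ltr0n// mulr1 ler_nat.
    by have := ler_powR q1 (ltW eta0); rewrite powRr0.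
  have pe : powR l.+1%:R (e%:R + eta) = l.+1%:R ^+ e * powR l.+1%:R eta :> R.
    by rewrite powRD ?powR_mulrn//; apply/implyP => _; exact: lt0r_neq0.
  have -> : 2 * c * powR N.+1%:R^-1 eta * (A l * powR l.+1%:R (e%:R + eta)) =
    A l * (c * (2 * (powR N.+1%:R^-1 eta * powR l.+1%:R (e%:R + eta)))) by ring.
  rewrite [_ * c]mulrC ler_wpM2l// ler_wpM2l// (le_trans hd)// ler_wpM2l// pe mulrCA.
  by rewrite ler_peMr// exprn_ge0// ltW.
have /andP[t0 tT'] := tT.
rewrite (le_trans (ler_pM _ _ S2 (_ : _ <= powR T (2 * H)))) ?powR_ge0//.
- by apply: sumr_ge0 => k _; exact: sqr_ge0.
- by rewrite ge0_ler_powR ?nnegrE ?mulr_ge0 ?(ltW H0) ?(ltW T0).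
- by rewrite le_eqVlt; apply/orP; left; apply/eqP; ring.
Qed.

(** On [G] the dyadic partial sums converge pointwise to the field, so Fatou's lemma carries the
    tail bound over to the distance between the [N]-th partial sum and the limit. *)
Lemma qfbm_L2 t x : 0 <= t <= T -> sphere x ->
  (fun N => ('E_P[fun w => ((partial_field N t x w - qfbm t x w) ^+ 2)%R])%E) @ \oo --> 0%E.
Proof.
move=> tT sx; have [C C0 HC] := partial_field_diff.
have key N : (\int[P]_w ((partial_field N t x w - qfbm t x w) ^+ 2)%:E <= (C * powR N.+1%:R^-1 eta)%:E)%E.
  (* The shift by [N] ensures [N <= 2^(n + N) - 1]; the indicator removes the paths for which the
     field was set to 0. *)
  pose F n w : R := \1_G w * (partial_field (2 ^ (n + N)).-1 t x w - partial_field N t x w) ^+ 2.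
  have mI : measurable_fun setT (\1_G : Om -> R) by exact: measurable_indic.
  have mD n : measurable_fun setT (fun w => (partial_field n t x w - partial_field N t x w) ^+ 2).
    by apply: measurable_funX; apply: measurable_funB; exact: measurable_partial_field.
  have mF n : measurable_fun setT (F n) by exact: measurable_funM.
  have mQ : measurable_fun setT (fun w => (partial_field N t x w - qfbm t x w) ^+ 2).
    by apply: measurable_funX; apply: measurable_funB; [exact: measurable_partial_field|exact: measurable_qfbm].
  have I01 w : 0 <= (\1_G w : R) <= 1 by rewrite indicE ler0n /= (ler_nat R _ 1) leq_b1.
  have F0 n w : 0 <= F n w by rewrite mulr_ge0 ?sqr_ge0//; case/andP: (I01 w).
  have Nn n : (N <= (2 ^ (n + N)).-1)%N.
    have : (N < 2 ^ (n + N))%N by rewrite (leq_ltn_trans (leq_addl n N))// ltn_expl.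
    by case: (2 ^ _)%N.
  have intF n : (\int[P]_w (F n w)%:E <= (C * powR N.+1%:R^-1 eta)%:E)%E.
    apply: le_trans (HC N (2 ^ (n + N)).-1 t x (Nn n) tT sx).
    apply: ge0_le_integral => //.
    - by move=> w _; rewrite lee_fin.
    - exact/measurable_EFinP.
    - exact/measurable_EFinP.
    - by move=> w _; rewrite lee_fin ler_piMl ?sqr_ge0//; case/andP: (I01 w).
  have cF w : limn_einf (fun n => (F n w)%:E) = (\1_G w * (partial_field N t x w - qfbm t x w) ^+ 2)%:E.
    suff /cvg_limn_einf_sup[-> _] : (fun n => (F n w)%:E) @ \oo --> (\1_G w * (partial_field N t x w - qfbm t x w) ^+ 2)%:E by [].
    apply: cvg_EFin; first by near=> n.
    have [Gw|Gw] := pselect (G w); last first.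
      rewrite (_ : fine \o _ = cst 0); last by apply/funext => n /=; rewrite /F indicE memNset// mul0r.
      by rewrite indicE memNset// mul0r; exact: cvg_cst.
    rewrite (_ : fine \o _ = fun n => (partial_field N t x w - series (fun j => block_field (bG w) j [::] t x) (n + N)%N) ^+ 2); last first.
      apply/funext => n /=; rewrite /F series_block_field// indicE mem_set// !mul1r.
      by rewrite -[in LHS]sqrrN opprB.
    rewrite indicE mem_set// mul1r.
    have h : (fun n => series (fun j => block_field (bG w) j [::] t x) (n + N)%N) @ \oo --> qfbm t x w.
      by rewrite (cvg_shiftn N); exact: qfbm_cvg.
    apply: (@cvg_comp _ _ _ _ (fun y : R => y ^+ 2)); last exact: exprn_continuous.
    by apply: cvgB; [exact: cvg_cst|exact: h].
  have -> : (\int[P]_w ((partial_field N t x w - qfbm t x w) ^+ 2)%:E =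
      \int[P]_w limn_einf (fun n => (F n w)%:E))%E.
    apply: ae_eq_integral => //.
    - exact/measurable_EFinP.
    - under eq_fun do rewrite cF; apply/measurable_EFinP; exact: measurable_funM.
    - exists (~` G); split => //; first exact: measurableC.
      by move=> w; apply: contra_not => Gw _; rewrite cF indicE mem_set// mul1r.
  apply: (le_trans (fatou P measurableT _ _)) => [n|n w _|].
  - exact/measurable_EFinP.
  - by rewrite lee_fin.
  - exact: limn_einf_le.
apply: (@squeeze_cvge _ _ _ _ (fun=> 0%E) _ (fun N => (C * powR N.+1%:R^-1 eta)%:E)).
- near=> N; rewrite unlock key andbT; apply: integral_ge0 => w _; by rewrite lee_fin sqr_ge0.
- exact: cvg_cst.
- apply: cvg_EFin; first by near=> N.
  apply/cvgrPdist_lt => r r0; have [del del0 Hdel] := powR_small C0 eta0 r0.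
  have /cvgrPdist_lt/(_ _ del0)[N0 _ HN0] := @cvg_harmonic R.
  exists N0 => // N /HN0 /=; rewrite !sub0r !normrN => h.
  rewrite ger0_norm ?mulr_ge0 ?powR_ge0//; apply: Hdel; rewrite invr_ge0 ler0n /=.
  by move: h; rewrite /sequences.harmonic ger0_norm ?invr_ge0.
Unshelve. all: by end_near. Qed.

End QFractionalBrownianMotion.

(** Being a modification is expressed in mean square: at each [t] and [x] the partial sums over
    degrees converge in L2 to the measurable variable [X t x], which determines it almost surely.
    Regularity holds for every [w]; joint continuity is contained in the joint Hölder bound. *)
Theorem theorem4p2 (R : realType) (d : nat) (H T eta : R) (A : nat -> R)
  (S : nat -> nat -> 'rV[R]_d -> R)
  (dT : measure_display) (Om : measurableType dT) (P : probability Om R)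
  (beta : nat * nat -> R -> Om -> R) :
  (3 <= d)%N -> 0 < H < 1 -> 0 < T -> 0 < eta ->
  (forall l, 0 <= A l) ->
  (\sum_(0 <= l <oo) (A l * powR (l%:R) (d%:R - 2 + eta))%:E < +oo)%E ->
  sph_harm_basis S ->
  (forall l m, (1 <= m <= hdim l d)%N -> is_fBm P T H (beta (l, m))) ->
  indep_procs P T [set k | (1 <= k.2 <= hdim k.1 d)%N] beta ->
  exists X : R -> 'rV[R]_d -> Om -> R,
    (forall w, holder_TS_minus T H (eta / 2) (fun t x => X t x w)) /\
    (forall t x, 0 <= t <= T -> sphere x ->
       measurable_fun setT (X t x) /\
       ((fun N : nat =>
           ('E_P[fun w => ((\sum_(0 <= l < N) \sum_(1 <= m < (hdim l d).+1)
                             Num.sqrt (A l) * beta (l, m) t w * S l m x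
                          - X t x w) ^+ 2)%R])%E) @ \oo --> 0%E)).
Proof.
(* The construction is parametrised by [d - 2], here [e.+1], which is positive because [d >= 3]. *)
case: d S => [|[|[|e]]] S // _ H01 T0 eta0 A0 HA HS fB iB.
have fB' k : [set k | (1 <= k.2 <= hdim k.1 e.+3)%N] k -> is_fBm P T H (beta k).
  by case: k => l m; exact: fB.
exists (qfbm (isT : (0 < e.+1)%N) H01 T0 eta0 A0 HA HS fB' iB); split => [w|t x tT sx].
  exact: qfbm_holder.
by split; [exact: measurable_qfbm|exact: qfbm_L2].
Qed.
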